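(* Let $\mathscr{E}=\{(T_\alpha,S_\alpha)\}_{\alpha\in I}$ be a set of enhancements for bond percolation on $\mathbb{Z}^2$ such that $S_\alpha$ is a connected subgraph of the nearest-neighbor graph $\mathbb{Z}^2$ for each $\alpha\in I$, and let $q_c=q_c(\mathscr{E})$. If $p<q_c$, then $P_\infty(p)$ percolates if and only if $P_N(p)$ percolates for some finite $N$. On the other hand, if $p>q_c$, then $P_N(p)$ percolates for some finite value of $N$.
   Context: Dimension $d=2$ here. An enhancement is a pair $(T,S)$ where $T$ is a finite subgraph of the nearest-neighbor graph $\mathbb{Z}^d$ and $S$ is a finite subgraph of the complete graph on the vertex set $\mathbb{Z}^d$, with $T\subset S$. In a set of enhancements $\mathscr{E}$, every enhancement appears at most once up to congruence and the origin is a vertex of every $S_\alpha$. Let $\Gamma_d$ be the group of maps $x\mapsto Ax+v$ with $v\in\mathbb{Z}^d$, $A\in SO(d)$, $A\mathbb{Z}^d=\mathbb{Z}^d$; congruence means equality up to an element of $\Gamma_d$. Let $P=P(p)$, $p\in[0,1]$, be Bernoulli bond percolation on the nearest-neighbor graph $\mathbb{Z}^d$ with edge probability $p$, with law $\mathbb{P}_p$. The enhancement percolation $P_\infty=P_\infty(p)$ is the random graph obtained from $P$ by adding $\gamma(S_\alpha)$ for every $\alpha\in I$ and $\gamma\in\Gamma_d$ with $\gamma(T_\alpha)\subset P$. For integers $k\ge 0$, $\mathscr{F}_k$ is the collection of enhancements $(T,S)\in\mathscr{E}$ such that the $\ell^\infty$ diameter of (the vertex set of) $S$ lies in $[2^k,2^{k+1})$.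 The random graph $P_k=P_k(p)$ is obtained from $P$ in the same way, using only the enhancements in $\bigcup_{j=0}^k\mathscr{F}_j$. A random graph percolates if it contains an infinite connected component with probability one. For $(T,S)\in\mathscr{F}\subset\mathscr{E}$ and $\gamma\in\Gamma_d$ with $\gamma(T)\subset P$, $(\gamma(T),\gamma(S))$ is called an activated enhancement of $\mathscr{F}$ with anchor $\gamma(0)$. Let $\Lambda_n=[-n,n]^d$ and let $G_k$ be the event that the anchor of some activated enhancement of $\mathscr{F}_k$ is contained in $\Lambda_{2^k}$. Define $$q_c(\mathscr{E})=\sup\{p:\limsup_{k\to\infty}\mathbb{P}_p(G_k)=0\},$$ the supremum being taken in $[0,1]$. *)

(* Defs.v *)
From HB Require Import structures.
From Stdlib Require Import Relation_Operators.
From mathcomp Require Import all_boot all_order all_algebra finmap.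
From mathcomp Require Import all_classical all_reals all_analysis.

Set Implicit Arguments.
Unset Strict Implicit.
Unset Printing Implicit Defensive.

Import Order.TTheory GRing.Theory Num.Theory.

Local Open Scope classical_set_scope.
Local Open Scope ring_scope.

Definition norm1 (x : 'cV[int]_2) : nat := (\sum_i `|x i 0%R|)%N.
Definition normoo (x : 'cV[int]_2) : nat := (\max_i `|x i 0%R|)%N.

(* An edge is an unordered pair of vertices. The record is only a carrier for
   possibly infinite graphs; [is_graph] is the actual condition. *)
Record graph := Graph { vert : set 'cV[int]_2 ; edge : set {fset 'cV[int]_2} }.

Definition is_graph (G : graph) : Prop :=
  forall e, edge G e ->
    #|` e|%fset = 2%N /\ (forall x, x \in e -> vert G x).

Definition subgraph (G H : graph) : Prop :=
  vert G `<=` vert H /\ edge G `<=` edge H.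

Definition complete_graph : graph :=
  Graph setT [set e | #|` e|%fset = 2%N].

Definition lattice : graph :=
  Graph setT [set e | exists x y, norm1 (x - y) = 1%N /\ e = [fset x; y]%fset].

Definition map_graph (g : 'cV[int]_2 -> 'cV[int]_2) (G : graph) : graph :=
  Graph (g @` vert G) ((fun e => [fset g x | x in e]%fset) @` edge G).

Definition adj (G : graph) (x y : 'cV[int]_2) : Prop :=
  edge G [fset x; y]%fset.

Definition component (G : graph) (x : 'cV[int]_2) : set 'cV[int]_2 :=
  [set y | clos_refl_trans _ (adj G) x y].

Definition connected_graph (G : graph) : Prop :=
  forall x y, vert G x -> vert G y -> component G x y.

Definition has_infinite_component (G : graph) : Prop :=
  exists2 x, vert G x & infinite_set (component G x).

(* Meaningful for finite A only: [fset_set A] is empty when A is infinite. *)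
Definition diamoo (A : set 'cV[int]_2) : nat :=
  (\max_(x <- fset_set A) \max_(y <- fset_set A) normoo (x - y)%R)%N.

(* Rotations in SO(2) preserving the integer lattice, composed with integer
   translations, viewed as maps of the lattice to itself. *)
Definition Gamma (R : realType) : set ('cV[int]_2 -> 'cV[int]_2) :=
  let inj : 'cV[int]_2 -> 'cV[R]_2 := map_mx intr in
  [set g | exists (A : 'M[R]_2) (v : 'cV[int]_2),
    [/\ A *m A^T = 1%:M, \det A = 1,
        (fun x => A *m x) @` range inj = range inj &
        forall x, inj (g x) = A *m inj x + inj v]].

(* The pair is (T, S). Finitely many vertices force finitely many edges. *)
Definition is_enhancement (e : graph * graph) : Prop :=
  [/\ is_graph e.1 /\ is_graph e.2,
      finite_set (vert e.1) /\ finite_set (vert e.2),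
      subgraph e.1 lattice, subgraph e.2 complete_graph &
      subgraph e.1 e.2].

Definition congruent (R : realType) (e e' : graph * graph) : Prop :=
  exists2 g, Gamma R g & e' = (map_graph g e.1, map_graph g e.2).

Definition enhancement_set (R : realType) (E : set (graph * graph)) : Prop :=
  [/\ forall e, E e -> is_enhancement e,
      forall e e', E e -> E e' -> congruent R e e' -> e = e' &
      forall e, E e -> vert e.2 0].

(* An S reduced to one vertex has diameter 0, hence belongs to no scale. *)
Definition scale (E : set (graph * graph)) (k : nat) : set (graph * graph) :=
  [set e | E e /\ (2 ^ k <= diamoo (vert e.2) < 2 ^ k.+1)%N].

Definition scale_upto (E : set (graph * graph)) (k : nat) :
  set (graph * graph) := \bigcup_(j in [set j | (j <= k)%N]) scale E j.

Definition bond : choiceType := set_type (edge lattice).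

Definition cylinders : set (set (bond -> bool)) :=
  [set C | exists b : bond, C = [set w | w b = true]].

(* [true] means open; the sigma-algebra is the product one. *)
Definition config := g_sigma_algebraType cylinders.

Definition open_graph (w : config) : graph :=
  Graph setT [set e | exists2 b : bond, e = val b & w b = true].

(* The product law, which its values on cylinders determine uniquely. *)
Definition bernoulli_percolation (R : realType) (p : R)
    (mu : probability config R) : Prop :=
  forall (B : {fset bond}) (s : bond -> bool),
    mu [set w : config | forall b, b \in B -> w b = s b] =
      (\prod_(b <- B) (if s b then p else 1 - p))%:E.

Definition activated (R : realType) (F : set (graph * graph)) (w : config)
    (e : graph * graph) (g : 'cV[int]_2 -> 'cV[int]_2) : Prop :=
  [/\ F e, Gamma R g & subgraph (map_graph g e.1) (open_graph w)].

Definition enhanced (R : realType) (F : set (graph * graph)) (w : config) :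
    graph :=
  Graph
    (vert (open_graph w) `|`
       [set x | exists e g, activated R F w e g /\ vert (map_graph g e.2) x])
    (edge (open_graph w) `|`
       [set b | exists e g, activated R F w e g /\ edge (map_graph g e.2) b]).

Definition percolates (R : realType) (mu : probability config R)
    (H : config -> graph) : Prop :=
  mu [set w | has_infinite_component (H w)] = 1%E.

Definition anchor_event (R : realType) (E : set (graph * graph)) (k : nat) :
    set config :=
  [set w | exists e g,
    activated R (scale E k) w e g /\ (normoo (g 0%R) <= 2 ^ k)%N].

(* [sup set0 = 0] agrees with the supremum taken in [0, 1]. *)
Definition q_c (R : realType) (P : R -> probability config R)
    (E : set (graph * graph)) : R :=
  sup [set p | 0 <= p <= 1 /\
    limn_esup (fun k => P p (anchor_event R E k)) = 0%E].

(* Main.v *)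
Require Import Defs.
From HB Require Import structures.
From Stdlib Require Import Relation_Operators.
From mathcomp Require Import all_boot all_order all_algebra finmap.
From mathcomp Require Import all_classical all_reals all_analysis.
From mathcomp Require Import zify ring lra.

Set Implicit Arguments.
Unset Strict Implicit.
Unset Printing Implicit Defensive.

Import Order.TTheory GRing.Theory Num.Theory.
Import numFieldNormedType.Exports.

Local Open Scope classical_set_scope.
Local Open Scope ring_scope.

(** A set of enhancements turns a bond configuration into a larger set of lattice edges. When only
    the enhancements up to the scale [k] are used, this map is increasing, commutes with the
    translations and rotations of the lattice, and is local with a range of order [2 ^ k]
    ([zk_model]). Crossing events of the enhanced graph are therefore increasing local events of the
    bond configuration, those of its planar dual are decreasing ones, and both are positively
    associated and invariant. Four tools are available for such graphs.

    - Duality and long crossings ([crossing_dual], [rsw], [dichotomy]). Each square is crossed by the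
      graph or by the dual. If squares are crossed with reasonable probability at several scales, then
      at one of them rectangles of a fixed larger aspect ratio are crossed too. The law is not
      invariant under reflections and is not independent at distances below the range; the proof links
      squares of different sizes by letting a crossing of the larger one land between two arms of the
      smaller one ([landing_linked]), and a pigeonhole argument over the scales finds two sizes that
      fit. So among boundedly many scales there is one with long crossings of the graph, or one with
      long crossings of the dual.
    - A finite-size criterion ([finite_size]). If rectangles larger than the range are crossed with
      probability above an absolute constant, there is an infinite component almost surely.
    - A sharp threshold ([talagrand], [amp_torus]). For an increasing local event seen on a torus of
      side [L], raising the parameter by [d] multiplies the odds that some translate occurs by at
      least a power of [L] whose exponent is proportional to [d].
    - Planarity ([dual_incompat]). Dual crossings stop the connections of the graph.

    Below [q_c], the sharp threshold makes the probability of the anchor event exponentially small in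
    its scale ([anchor_decay]), so that with high probability enhancements of scales beyond [e] do not
    affect a box of size [2 ^ e]. If the graph with all enhancements percolates, the dual cannot have
    long crossings with the probability that the dichotomy would give, so the graph has long crossings
    at some large scale [e] with probability close to one. By the above they are already made by the
    enhancements up to the scale [e], and the finite-size criterion applies to these
    ([subcritical]). The converse is monotonicity ([percolates_up]).

    Above [q_c], the anchor event has a probability bounded below at infinitely many scales [k], even
    at a parameter slightly smaller than [p]. Likely dual crossings of long strips of
    width comparable to [2 ^ k], but smaller, are then impossible, as they would block the connected
    copies of the graphs [S] of that scale. At such a [k], the dichotomy over a bounded number of scales just below [k] gives long
    crossings with a probability that may tend to zero with [k], but more slowly than the sharp
    threshold can compensate. The dual alternative would make dual crossings likely at a smaller
    parameter and is excluded; the other one makes crossings of the graph of scale [k] likely at [p],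
    and the finite-size criterion applies ([supercritical]). *)

(** * Planar paths and duality *)

Definition pt := (int * int)%type.
(** An edge is recorded by its left or lower endpoint and a boolean that is [true] for vertical
    edges. *)
Definition edge_t := (pt * bool)%type.

Inductive conn (r : pt -> pt -> Prop) (B : pt -> Prop) (x : pt) : pt -> Prop :=
| conn_refl : B x -> conn r B x x
| conn_step y z : conn r B x y -> r y z -> B z -> conn r B x z.

Definition adjp (x y : pt) : Prop :=
  (x.1 = y.1 /\ (y.2 = x.2 + 1 \/ x.2 = y.2 + 1)) \/
  (x.2 = y.2 /\ (y.1 = x.1 + 1 \/ x.1 = y.1 + 1)).

Definition link (zt : edge_t -> Prop) (x y : pt) : Prop :=
  [\/ y = (x.1 + 1, x.2) /\ zt (x, false), x = (y.1 + 1, y.2) /\ zt (y, false),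
      y = (x.1, x.2 + 1) /\ zt (x, true) | x = (y.1, y.2 + 1) /\ zt (y, true)].

(** The dual lattice, which is the square lattice shifted by (1/2, 1/2), is indexed by integer
    points again: [(i, j)] stands for the point (i + 1/2, j + 1/2), and a dual edge is open when
    the primal edge that it crosses is closed. *)
Definition dual (zt : edge_t -> Prop) : edge_t -> Prop := fun e =>
  if e.2 then ~ zt ((e.1.1, e.1.2 + 1), false)
  else ~ zt ((e.1.1 + 1, e.1.2), true).

Section conn.
Implicit Types (r : pt -> pt -> Prop) (B : pt -> Prop).

Lemma conn_memr r B x y : conn r B x y -> B y.
Proof. by case. Qed.

Lemma conn_meml r B x y : conn r B x y -> B x.
Proof. by elim. Qed.

Lemma conn_trans r B x y z : conn r B x y -> conn r B y z -> conn r B x z.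
Proof. move=> xy; elim=> // u v _ xu uv Bv; exact: conn_step xu uv Bv. Qed.

Lemma conn_sym r B x y : (forall u v, r u v -> r v u) ->
  conn r B x y -> conn r B y x.
Proof.
move=> rS; elim=> [Bx|u v xu ux uv Bv]; first exact: conn_refl.
apply: conn_trans ux; apply: (conn_step (y := v)); first exact: conn_refl.
  exact: rS.
exact: conn_memr xu.
Qed.

Lemma conn_sub r r' B B' (f : pt -> pt) x y :
    (forall u v, B u -> B v -> r u v -> r' (f u) (f v)) ->
    (forall u, B u -> B' (f u)) ->
  conn r B x y -> conn r' B' (f x) (f y).
Proof.
move=> rr' BB'; elim=> [Bx|u v xu ux uv Bv]; first exact: conn_refl (BB' _ Bx).
by apply: conn_step ux _ (BB' _ Bv); apply: rr' => //; exact: conn_memr xu.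
Qed.

Lemma conn_reach r B x y : conn r B x y -> conn r (conn r B x) x y.
Proof.
elim=> [Bx|u v xu ux uv Bv]; first by do 2 apply: conn_refl.
by apply: (conn_step ux uv); exact: (conn_step xu uv Bv).
Qed.

End conn.

Lemma link_sym zt x y : link zt x y -> link zt y x.
Proof. by case=> h; [apply: Or42|apply: Or41|apply: Or44|apply: Or43]. Qed.

Lemma link_adjp zt x y : link zt x y -> adjp x y.
Proof. by case: x y => [x1 x2] [y1 y2]; rewrite /adjp; case=> -[[-> ->] _] /=; lia. Qed.

Fixpoint par (f : pt -> pt -> bool) (p : pt) (l : seq pt) : bool :=
  if l is q :: l' then f p q (+) par f q l' else false.

Fixpoint walk (r : pt -> pt -> Prop) (p : pt) (l : seq pt) : Prop :=
  if l is q :: l' then r p q /\ walk r q l' else True.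

Lemma walk_conn r B x y : conn r B x y ->
  exists l, [/\ walk r x l, last x l = y & forall z, z \in x :: l -> B z].
Proof.
elim=> [Bx|u v _ [l [wl lu Bl]] uv Bv].
  by exists [::]; split => // z; rewrite inE => /eqP ->.
exists (rcons l v); split.
- elim: l x wl lu {Bl} => [|q l IH] x /=; first by move=> _ ->.
  by move=> [xq wl] lu; split => //; exact: IH.
- by rewrite last_rcons.
- move=> z; rewrite -rcons_cons mem_rcons inE => /orP[/eqP -> //|]; exact: Bl.
Qed.

Lemma par_tele (S : pt -> bool) p l :
  par (fun p q => S p (+) S q) p l = S p (+) S (last p l).
Proof.
elim: l p => [|q l IH] p /=; first by rewrite addbb.
by rewrite IH addbA -[_ (+) S q (+) S q]addbA addbb addbF.
Qed.

Lemma par_eq r f g p l : walk r p l -> (forall p q, r p q -> f p q = g p q) ->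
  par f p l = par g p l.
Proof. by move=> + fg; elim: l p => //= q l IH p [/fg -> /IH ->]. Qed.

Lemma par_add f g p l :
  par (fun p q => f p q (+) g p q) p l = par f p l (+) par g p l.
Proof. by elim: l p => //= q l IH p; rewrite IH addbACA. Qed.

(** The steps from [p] to [q] of a walk on the dual lattice that cross the horizontal half-line
    to the left of the primal point [v]. *)
Definition cut (v p q : pt) : bool :=
  [&& p.1 == q.1, p.1 < v.1 & ((p.2 == v.2) && (q.2 == v.2 - 1)) ||
                             ((q.2 == v.2) && (p.2 == v.2 - 1))].

Local Ltac xsolve :=
  do ?[case: eqP => ? /=]; do ?[case: ltP => ? /=]; do ?[case: leP => ? /=];
  try done; exfalso; lia.

(** A discrete Jordan argument. The parity of the number of times that the dual path crosses the
    half-line to the left of [z] does not change when [z] moves along an open primal edge: a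
    horizontal step could only change it by crossing the dual path, and for a vertical step the
    difference telescopes, since the dual path starts below and ends above. At the left end of
    the primal path the parity is even, because the dual path lies to the right; at the right end
    it is odd, because the dual path lies to the left and passes from below to above. *)
Lemma dual_incompat (zt : edge_t -> Prop) B1 B2 x y u v (a b c d : int) :
  conn (link zt) B1 x y -> conn (link (dual zt)) B2 u v ->
  x.1 <= a -> b <= y.1 -> (forall z, B1 z -> c <= z.2 <= d) ->
  (forall z, B2 z -> a <= z.1 < b) -> u.2 < c -> d <= v.2 -> False.
Proof.
move=> c1 c2 xa yb B1P B2P uc dv.
have [l [wl lu Bl]] := walk_conn c2.
have memB : forall z : pt, z \in u :: l -> a <= z.1 < b by move=> z /Bl /B2P.
have par0 : forall z : pt, z.1 <= a -> par (cut z) u l = false.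
  move=> z za; move: memB; clear -za; elim: l u => [|q l IH] u mB //=.
  rewrite IH; last by move=> w wl; apply: mB; rewrite inE wl orbT.
  rewrite addbF; apply/negbTE/negP => /and3P[_ uz _].
  by have := mB u (mem_head _ _); lia.
have step : forall z w, B1 z -> B1 w -> link zt z w ->
    par (cut z) u l = par (cut w) u l.
  have hor : forall z, zt (z, false) -> par (cut z) u l = par (cut (z.1 + 1, z.2)) u l.
    move=> z zz; apply: par_eq wl _ => p q pq.
    apply/idP/idP; rewrite /cut /=; first by lia.
    case: (ltP p.1 z.1) => [|pz]; first by lia.
    move=> /and3P[/eqP p1 pz' p2]; exfalso.
    have pz1 : p.1 = z.1 by lia.
    case: p q z zz pq p1 p2 pz1 {pz pz'} => [p1 p2] [q1 q2] [z1 z2] zz pq /= e1 e2 e3.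
    subst q1 z1; case: pq => -[[]] /=; try lia.
      move=> ee; rewrite /dual /=; have -> : p2 + 1 = z2 by lia.
      by move/(_ zz).
    move=> ee; rewrite /dual /=; have -> : q2 + 1 = z2 by lia.
    by move/(_ zz).
  have ver : forall z, B1 z -> B1 (z.1, z.2 + 1) -> zt (z, true) ->
     par (cut z) u l = par (cut (z.1, z.2 + 1)) u l.
    move=> z Bz Bz' zz.
    pose S (p : pt) := (p.1 < z.1) && (p.2 == z.2).
    suff : par (cut z) u l (+) par (cut (z.1, z.2 + 1)) u l = false.
      by case: (par _ _ _); case: (par _ _ _).
    rewrite -par_add (par_eq (g := fun p q => S p (+) S q) wl).
      rewrite par_tele lu /S; have := B1P _ Bz; have := B1P _ Bz' => /=; lia.
    move=> p q pq; rewrite /cut /S /=.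
    have no : p.2 = z.2 -> q.2 = z.2 ->
       (p.1 = z.1 /\ q.1 = z.1 - 1) \/ (q.1 = z.1 /\ p.1 = z.1 - 1) -> False.
      case: p q z zz pq {Bz Bz' S} => [p1 p2] [q1 q2] [z1 z2] zz pq /= e1 e2 e3.
      subst p2 q2; case: e3 => -[e3 e4]; subst; case: pq => -[[]] /=; try lia.
        by move=> _; rewrite /dual /= subrK => /(_ zz).
      by move=> _; rewrite /dual /= subrK => /(_ zz).
    have := no; have := link_adjp pq; rewrite /adjp.
    move: p q z {no pq zz Bz Bz' S} => [p1 p2] [q1 q2] [z1 z2] /= pq no.
    by case: pq => -[? [?|?]]; subst; xsolve.
  move=> z w Bz Bw [[-> zz]|[zw zz]|[e zz]|[e zz]].
  - exact: hor.
  - by rewrite zw; symmetry; exact: hor.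
  - by subst w; exact: ver.
  - by subst z; symmetry; apply: ver.
have py : par (cut y) u l = false.
  rewrite -(par0 x xa); symmetry.
  elim: {yb} c1 => // z w xz IH zw Bw; rewrite IH; apply: step => //.
  exact: conn_memr xz.
suff : par (cut y) u l = true by rewrite py.
have By := B1P _ (conn_memr c1).
pose S (p : pt) := y.2 <= p.2.
rewrite (par_eq (g := fun p q => S p (+) S q) (r := fun p q => adjp p q /\ p.1 < b /\ q.1 < b)).
- rewrite par_tele lu /S; lia.
- move: memB wl {lu Bl par0 step py}; elim: l u {c2 uc} => [|q l IH] u mB //= [uq wl].
  split; last by apply: IH => // w wq; apply: mB; rewrite inE wq orbT.
  split; first exact: link_adjp uq.
  by have := mB u (mem_head _ _); have := mB q; rewrite !inE eqxx orbT => /(_ isT); lia.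
- move=> p q; rewrite /adjp /cut /S; lia.
Qed.

Lemma adjp_link (zt : edge_t -> Prop) p q : adjp p q ->
    (q = (p.1 + 1, p.2) -> zt (p, false)) -> (p = (q.1 + 1, q.2) -> zt (q, false)) ->
    (q = (p.1, p.2 + 1) -> zt (p, true)) -> (p = (q.1, q.2 + 1) -> zt (q, true)) ->
  link zt p q.
Proof.
case: p q => [p1 p2] [q1 q2]; rewrite /adjp /= => -[[-> [->|->]]|[-> [->|->]]] h1 h2 h3 h4.
- by apply: Or43; split => //; exact: h3.
- by apply: Or44; split => //; exact: h4.
- by apply: Or41; split => //; exact: h1.
- by apply: Or42; split => //; exact: h2.
Qed.

(** If the two paths were disjoint, [dual_incompat] would apply to the set of the edges with both
    ends on the first path, and to the second path seen as a path of the dual lattice: the primal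
    edge that crosses one of its steps contains an endpoint of that step. Each path is prolonged
    by one step, to obtain the strict inequalities. *)
Lemma meet B1 B2 (x y u v : pt) (a b c d : int) :
  conn adjp B1 x y -> conn adjp B2 u v ->
  x.1 <= a -> b <= y.1 -> (forall z, B1 z -> c <= z.2 <= d) ->
  (forall z, B2 z -> a <= z.1 <= b) -> u.2 <= c -> d <= v.2 ->
  exists z, B1 z /\ B2 z.
Proof.
move=> c1 c2 xa yb B1P B2P uc dv; apply: contrapT => nz.
(* Now both paths are prolonged by one step, the first to the right and the second downwards. *)
have {}nz z : B1 z -> B2 z -> False by move=> ? ?; apply: nz; exists z.
have B1y := conn_memr c1; have B2u := conn_meml c2.
pose B1' z := B1 z \/ z = (y.1 + 1, y.2).
pose B2' z := B2 z \/ z = (u.1, u.2 - 1).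
have nz' z : B1' z -> B2' z -> False.
  have := B1P _ B1y; have := B2P _ B2u => /= h1 h2.
  move=> [h3|->] [h4|].
  - exact: nz h3 h4.
  - by move=> e; have := B1P _ h3; rewrite e /=; lia.
  - by have := B2P _ h4; rewrite /=; lia.
  - by move=> [] /=; lia.
pose zt (e : edge_t) := B1' e.1 /\ B1' (if e.2 then (e.1.1, e.1.2 + 1) else (e.1.1 + 1, e.1.2)).
have r1 p q : B1' p -> B1' q -> adjp p q -> link zt p q.
  move=> h1 h2 pq; apply: adjp_link => // e; rewrite /zt /= -?e //.
have r2 p q : B2' p -> B2' q -> adjp p q -> link (dual zt) p q.
  move=> h1 h2 pq; apply: adjp_link => // e; rewrite /zt /dual /= -?e => -[h3 h4].
  - exact: nz' h3 h2.
  - exact: nz' h3 h1.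
  - exact: nz' h3 h2.
  - exact: nz' h3 h1.
have c1' : conn (link zt) B1' x (y.1 + 1, y.2).
  apply: (@conn_step _ _ _ y); last by right.
    apply: (@conn_sub adjp _ B1 _ id) c1; last by left.
    by move=> p q h1 h2; apply: r1; left.
  by apply: r1; [left|right|rewrite /adjp /=; lia].
have c2' : conn (link (dual zt)) B2' (u.1, u.2 - 1) v.
  apply: (@conn_trans _ _ _ u); last first.
    apply: (@conn_sub adjp _ B2 _ id) c2; last by left.
    by move=> p q h1 h2; apply: r2; left.
  apply: (@conn_step _ _ _ (u.1, u.2 - 1)); first by apply: conn_refl; right.
    by apply: r2; [right|left|rewrite /adjp /=; lia].
  by left.
apply: (dual_incompat (a := a) (b := b + 1) (c := c) (d := d) c1' c2') => //=.
- by lia.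
- by move=> z [/B1P //|->]; exact: B1P _ B1y.
- move=> z [/B2P|->] /=; first by lia.
  by have := B2P _ B2u; lia.
- by lia.
Qed.

(** Along the path, either a crossing of the strip is complete, or the current point is to the
    left of the strip, or it is in the strip and connected inside it to the left side. *)
Lemma clip zt B (x y : pt) (a b : int) : conn (link zt) B x y ->
  x.1 <= a -> a <= b -> b <= y.1 ->
  exists l r : pt, [/\ l.1 = a, r.1 = b &
    conn (link zt) (fun z => B z /\ a <= z.1 <= b) l r].
Proof.
move=> cxy xa ab yb; pose B' z := B z /\ a <= z.1 <= b.
suff [//|[ya|[yab [l [la ly]]]]] : (exists l r : pt, [/\ l.1 = a, r.1 = b & conn (link zt) B' l r])
    \/ y.1 < a \/ (a <= y.1 <= b /\ exists l : pt, l.1 = a /\ conn (link zt) B' l y).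
  - by lia.
  - by exists l, y; split => //; lia.
elim: cxy {yb} => [Bx|p q xp IH pq Bq].
  have [xa'|xa'] := ltP x.1 a; first by right; left.
  have xa2 : x.1 = a by lia.
  right; right; split; first by lia.
  by exists x; split => //; apply: conn_refl; split => //; lia.
have pq' := link_adjp pq; have Bp := conn_memr xp.
case: IH => [|[pa|[pab [l [la lp]]]]]; first by left.
  have [qa|qa] := ltP q.1 a; first by right; left.
  have qa2 : q.1 = a by move: pq'; rewrite /adjp; lia.
  right; right; split; first by lia.
  by exists q; split => //; apply: conn_refl; split => //; lia.
have [qa|qa] := ltP q.1 a; first by right; left.
have [qb|qb] := leP q.1 b; last first.
  by left; exists l, p; split => //; move: pq'; rewrite /adjp; lia.
right; right; split; first by lia.
exists l; split => //; apply: (conn_step lp pq); split => //; lia.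
Qed.

(** The reflection in the diagonal. It exchanges horizontal and vertical statements about paths;
    enhanced graphs are not invariant under it in general, and it is never applied to
    probabilities. *)
Definition tr (z : pt) : pt := (z.2, z.1).
Definition trE (e : edge_t) : edge_t := (tr e.1, ~~ e.2).

Lemma trK : involutive tr. Proof. by case. Qed.
Lemma trEK : involutive trE. Proof. by case=> [[? ?] []]. Qed.

Lemma link_tr zt x y : link zt (tr x) (tr y) <-> link (zt \o trE) x y.
Proof.
case: x y => [x1 x2] [y1 y2]; split.
  case=> -[[/= e1 e2] h]; subst; [apply: Or43|apply: Or44|apply: Or41|apply: Or42] => //.
case=> -[[/= e1 e2] h]; subst; [apply: Or43|apply: Or44|apply: Or41|apply: Or42] => //.
Qed.

Lemma dual_tr zt : dual (zt \o trE) = dual zt \o trE.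
Proof. by apply/funext => -[[z1 z2] []]. Qed.

Lemma conn_tr zt B x y : conn (link zt) B x y ->
  conn (link (zt \o trE)) (B \o tr) (tr x) (tr y).
Proof.
apply: conn_sub => [u v _ _ uv|u]; last by rewrite /= trK.
by rewrite -link_tr !trK.
Qed.

Lemma clip_tb zt B (x y : pt) (a b : int) : conn (link zt) B x y ->
  x.2 <= a -> a <= b -> b <= y.2 ->
  exists l r : pt, [/\ l.2 = a, r.2 = b &
    conn (link zt) (fun z => B z /\ a <= z.2 <= b) l r].
Proof.
move=> /conn_tr /clip h xa ab yb; have [l [r [la rb c]]] := h a b xa ab yb.
exists (tr l), (tr r); split => //.
have -> : zt = (zt \o trE) \o trE by apply/funext => e /=; rewrite trEK.
have := conn_tr c; apply: (@conn_sub _ _ _ _ id) => // -[z1 z2] [] //.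
Qed.

Lemma dual_incompat_tr (zt : edge_t -> Prop) B1 B2 (x y u v : pt) (a b c d : int) :
  conn (link zt) B1 x y -> conn (link (dual zt)) B2 u v ->
  x.2 <= a -> b <= y.2 -> (forall z, B1 z -> c <= z.1 <= d) ->
  (forall z, B2 z -> a <= z.2 < b) -> u.1 < c -> d <= v.1 -> False.
Proof.
move=> /conn_tr c1 /conn_tr c2 h1 h2 h3 h4 h5 h6.
rewrite -dual_tr in c2.
by apply: (dual_incompat c1 c2 h1 h2 _ _ h5 h6) => z; [move/h3|move/h4].
Qed.

Lemma meet_link zt zt' B1 B2 (x y u v : pt) (a b c d : int) :
  conn (link zt) B1 x y -> conn (link zt') B2 u v ->
  x.1 <= a -> b <= y.1 -> (forall z, B1 z -> c <= z.2 <= d) ->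
  (forall z, B2 z -> a <= z.1 <= b) -> u.2 <= c -> d <= v.2 ->
  exists z, conn (link zt) B1 x z /\ conn (link zt') B2 u z.
Proof.
move=> c1 c2 h1 h2 h3 h4 h5 h6.
have la z p q : link z p q -> adjp p q by exact: link_adjp.
apply: (meet (x := x) (y := y) (u := u) (v := v) _ _ h1 h2 _ _ h5 h6).
- by apply: (@conn_sub _ _ _ _ id) (conn_reach c1) => // p q _ _; apply: la.
- by apply: (@conn_sub _ _ _ _ id) (conn_reach c2) => // p q _ _; apply: la.
- by move=> z /conn_memr /h3.
- by move=> z /conn_memr /h4.
Qed.

Fixpoint parity (n : nat) (f : nat -> bool) : bool :=
  if n is m.+1 then parity m f (+) f m else false.

Lemma parity_eq n f g : (forall i, (i < n)%N -> f i = g i) -> parity n f = parity n g.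
Proof.
elim: n => //= n IH fg; rewrite IH ?fg // => i ni; apply: fg; exact: ltnW.
Qed.

Lemma parity_add n f g : parity n (fun i => f i (+) g i) = parity n f (+) parity n g.
Proof. by elim: n => //= n ->; rewrite addbACA. Qed.

(** Summation by parts modulo two, when [d] is constant across the places where [w] is true. *)
Lemma parity_flow n (d w : nat -> bool) : w 0%N = false -> w n = false ->
  (forall i, (i.+1 < n)%N -> w i.+1 -> d i = d i.+1) ->
  parity n (fun i => d i && (w i (+) w i.+1)) = false.
Proof.
case: n => // n w0 wn dw.
suff H m : (m <= n)%N -> parity m.+1 (fun i => d i && (w i (+) w i.+1)) = d m && w m.+1.
  by rewrite H // wn andbF.
elim: m => [|m IH] mn; first by rewrite /= w0.
rewrite [parity _ _]/= -/(parity m.+1 _) IH; last exact: ltnW.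
case E : (w m.+1); last by rewrite andbF /=.
by rewrite (dw m) //= ?E //; case: (d m.+1); case: (w m.+2).
Qed.

Lemma parity_tele n (w : nat -> bool) : parity n (fun i => w i (+) w i.+1) = w 0%N (+) w n.
Proof.
by elim: n => /= [|n ->]; rewrite ?addbb // addbA -[_ (+) w n (+) w n]addbA addbb addbF.
Qed.

Definition inQ (N : int) (z x : pt) : Prop :=
  z.1 - N <= x.1 <= z.1 + N /\ z.2 - N <= x.2 <= z.2 + N.

(** The boundary of the cluster [C] of the left side consists of open dual edges. Count modulo
    two, in the row [j], the boundary edges whose dual edge starts in the cluster [D] of the
    bottom of the dual lattice. The boundary is locally conserved, so the count does not depend
    on the row. In the bottom row it is odd, because the left side belongs to [C] and the right
    side does not; in the top row it would be even if [D] did not reach the top. *)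
Lemma crossing_dual zt (N : nat) :
  ~ (exists l r : pt, [/\ l.1 = - N%:Z, r.1 = N%:Z & conn (link zt) (inQ N (0, 0)) l r]) ->
  exists u v : pt, [/\ u.2 = - N%:Z - 1, v.2 = N%:Z &
    conn (link (dual zt)) (fun z => - N%:Z <= z.1 < N%:Z /\ - N%:Z - 1 <= z.2 <= N%:Z) u v].
Proof.
move=> nLR; apply: contrapT => nTB.
pose B2 (z : pt) := - N%:Z <= z.1 < N%:Z /\ - N%:Z - 1 <= z.2 <= N%:Z.
pose C z := `[< exists l : pt, l.1 = - N%:Z /\ conn (link zt) (inQ N (0, 0)) l z >].
pose D z := `[< exists u : pt, u.2 = - N%:Z - 1 /\ conn (link (dual zt)) B2 u z >].
pose c (i j : nat) := C (i%:Z - N%:Z, j%:Z - N%:Z).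
pose d (i j : nat) := D (i%:Z - N%:Z, j%:Z - N%:Z - 1).
pose n := (2 * N)%N.
have c0 j : (j <= n)%N -> c 0%N j.
  rewrite /n => jn; apply/asboolP; exists (0%:Z - N%:Z, j%:Z - N%:Z); split => /=; first lia.
  by apply: conn_refl; rewrite /inQ /=; lia.
have cn j : c n j = false.
  apply/negbTE/asboolPn => -[l [lN lc]]; apply: nLR.
  by exists l, (n%:Z - N%:Z, j%:Z - N%:Z); split => //=; rewrite /n; lia.
have clos z w : inQ N (0, 0) z -> inQ N (0, 0) w -> link zt z w -> C z = C w.
  have H p q : inQ N (0, 0) q -> link zt p q -> C p -> C q.
    by move=> iq pq /asboolP[l [lN lc]]; apply/asboolP; exists l; split => //; exact: conn_step lc pq iq.
  by move=> iz iw zw; apply/idP/idP; [exact: H|apply: H => //; exact: link_sym].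
have dclos z w : B2 z -> B2 w -> link (dual zt) z w -> D z = D w.
  have H p q : B2 q -> link (dual zt) p q -> D p -> D q.
    by move=> iq pq /asboolP[l [lN lc]]; apply/asboolP; exists l; split => //; exact: conn_step lc pq iq.
  by move=> iz iw zw; apply/idP/idP; [exact: H|apply: H => //; exact: link_sym].
have cH i j : (i < n)%N -> (j <= n)%N -> c i j (+) c i.+1 j -> d i j = d i j.+1.
  rewrite /n => iN jN cc; apply: dclos; rewrite /B2 /=; try lia.
  apply: Or43; split; first by congr pair => /=; lia.
  rewrite /dual /= => zz; move: cc; rewrite /c (clos _ (i.+1%:Z - N%:Z, j%:Z - N%:Z)) ?addbb //.
  - by rewrite /inQ /=; lia.
  - by rewrite /inQ /=; lia.
  - apply: Or41; split => /=; first by congr pair; lia.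
    by congr (zt (_, _, _)): zz; lia.
have cV i j : (i.+1 < n)%N -> (j < n)%N -> c i.+1 j (+) c i.+1 j.+1 -> d i j.+1 = d i.+1 j.+1.
  rewrite /n => iN jN cc; apply: dclos; rewrite /B2 /=; try lia.
  apply: Or41; split; first by congr pair => /=; lia.
  rewrite /dual /= => zz; move: cc; rewrite /c (clos _ (i.+1%:Z - N%:Z, j.+1%:Z - N%:Z)) ?addbb //.
  - by rewrite /inQ /=; lia.
  - by rewrite /inQ /=; lia.
  - apply: Or43; split => /=; first by congr pair; lia.
    by congr (zt (_, _, _)): zz; lia.
pose s j := parity n (fun i => d i j && (c i j (+) c i.+1 j)).
(* Passing to the next row changes the count by the boundary edges around the faces between the
   two rows, where [D] is constant along the boundary. *)
have ss j : (j < n)%N -> s j = s j.+1.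
  move=> jn; have -> : s j = parity n (fun i => d i j.+1 && (c i j (+) c i.+1 j)).
    apply: parity_eq => i ni; case E : (c i j (+) c i.+1 j); last by rewrite !andbF.
    by rewrite (cH _ _ ni (ltnW jn) E).
  suff : parity n (fun i => d i j.+1 && ((c i j (+) c i j.+1) (+) (c i.+1 j (+) c i.+1 j.+1))) = false.
    rewrite -(parity_eq (f := fun i => (d i j.+1 && (c i j (+) c i.+1 j)) (+)
         (d i j.+1 && (c i j.+1 (+) c i.+1 j.+1)))); last first.
      by move=> i _; case: (d i j.+1) => //=; rewrite addbACA.
    by rewrite parity_add /s; case: (parity n _); case: (parity n _).
  apply: (parity_flow (d := fun i => d i j.+1) (w := fun i => c i j (+) c i j.+1)).
  - by rewrite !c0 // ltnW.
  - by rewrite !cn.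
  - by move=> i ni /(cV _ _ ni jn).
have s0 : s 0%N = true.
  rewrite /s (parity_eq (g := fun i => c i 0%N (+) c i.+1 0%N)).
    by rewrite (parity_tele n (fun i => c i 0%N)) c0 // cn.
  move=> i; rewrite /n => ni; rewrite (_ : d i 0%N = true) //; apply/asboolP.
  exists (i%:Z - N%:Z, 0%:Z - N%:Z - 1); split => /=; first by lia.
  by apply: conn_refl; rewrite /B2 /=; lia.
have sn : s n = false.
  rewrite /s (parity_eq (g := fun=> false)); first by elim: {1}n => //= m ->.
  move=> i ni; case E : (c i n (+) c i.+1 n); last by rewrite andbF.
  rewrite (cH _ _ ni (leqnn _) E) andbT; apply/negbTE/asboolPn => -[u [uN uc]].
  apply: nTB; exists u, (i%:Z - N%:Z, n.+1%:Z - N%:Z - 1); split => //=.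
  by rewrite /n; lia.
have : forall j, (j <= n)%N -> s j = true.
  by elim=> // j IH jn; rewrite -ss // IH // ltnW.
by move=> /(_ n (leqnn _)); rewrite sn.
Qed.

(** * Expectations on the discrete cube *)

Section cube.
Variables (R : realType) (X : finType).
Implicit Types (x y : {ffun X -> bool}) (f g h : {ffun X -> bool} -> R) (e : X) (l : seq X).

Definition upd x e b : {ffun X -> bool} := [ffun i => if i == e then b else x i].

Definition wt (p : R) x : R := \prod_e (if x e then p else 1 - p).
Definition Ex p f : R := \sum_x wt p x * f x.
Definition Av p e f x : R := p * f (upd x e true) + (1 - p) * f (upd x e false).
Definition De e f x : R := f (upd x e true) - f (upd x e false).
(** Averaging over all coordinates gives the expectation ([Avl_enum]). Computing it one
    coordinate at a time turns identities and inequalities for product measures into inductions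
    over [l]. *)
Definition Avl p l f := foldr (Av p) f l.

Lemma upd_same x e b b' : upd (upd x e b) e b' = upd x e b'.
Proof. by apply/ffunP => i; rewrite !ffunE; case: eqP. Qed.

Lemma upd_comm x e e' b b' : e != e' -> upd (upd x e b) e' b' = upd (upd x e' b') e b.
Proof.
move=> ee'; apply/ffunP => i; rewrite !ffunE; case: eqP => [->|//].
by rewrite eq_sym (negbTE ee').
Qed.

Lemma upd_id x e : upd x e (x e) = x.
Proof. by apply/ffunP => i; rewrite ffunE; case: eqP => [->|]. Qed.

Lemma updE x e b : upd x e b e = b.
Proof. by rewrite ffunE eqxx. Qed.

Lemma sum_flip e f : \sum_x f x = \sum_(x : {ffun X -> bool} | x e) (f x + f (upd x e false)).
Proof.
rewrite (bigID (fun x : {ffun X -> bool} => x e)) /= big_split /=; congr (_ + _).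
rewrite (reindex_onto (fun x => upd x e false) (fun x => upd x e true)) /=; last first.
  by move=> x xe; rewrite upd_same -{2}(upd_id x e) (negbTE xe).
apply: eq_bigl => x; rewrite updE upd_same /=.
by apply/eqP/idP => [<-|xe]; rewrite ?updE // -{2}(upd_id x e) xe.
Qed.

Definition wt' p e x : R := \prod_(i | i != e) (if x i then p else 1 - p).

Lemma wtE p e x : wt p x = (if x e then p else 1 - p) * wt' p e x.
Proof. by rewrite /wt (bigD1 e). Qed.

Lemma wt'_upd p e x b : wt' p e (upd x e b) = wt' p e x.
Proof. by apply: eq_bigr => i ie; rewrite ffunE (negbTE ie). Qed.

Lemma Ex_Av p e f : Ex p (Av p e f) = Ex p f.
Proof.
rewrite /Ex (sum_flip e) [RHS](sum_flip e); apply: eq_bigr => x xe.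
have xE : upd x e true = x by rewrite -{2}(upd_id x e) xe.
rewrite !(wtE _ e) !wt'_upd !updE xe /Av !upd_same xE; ring.
Qed.

Lemma Ex_Avl p l f : Ex p (Avl p l f) = Ex p f.
Proof. by elim: l => //= e l IH; rewrite Ex_Av. Qed.

Lemma Ex_cst p c : Ex p (fun=> c) = c.
Proof.
rewrite /Ex -mulr_suml; suff -> : \sum_x wt p x = 1 by rewrite mul1r.
rewrite /wt -(bigA_distr_bigA (fun e b => if b then p else 1 - p)).
by rewrite big1 // => e _; rewrite big_bool /= addrC subrK.
Qed.

Lemma ExD p f g : Ex p (fun x => f x + g x) = Ex p f + Ex p g.
Proof. by rewrite /Ex -big_split; apply: eq_bigr => x _; rewrite mulrDr. Qed.

Lemma ExZ p c f : Ex p (fun x => c * f x) = c * Ex p f.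
Proof. by rewrite /Ex mulr_sumr; apply: eq_bigr => x _; rewrite mulrCA. Qed.

Lemma ExN p f : Ex p (fun x => - f x) = - Ex p f.
Proof. by rewrite /Ex -sumrN; apply: eq_bigr => x _; rewrite mulrN. Qed.

Lemma ExB p f g : Ex p (fun x => f x - g x) = Ex p f - Ex p g.
Proof. by rewrite ExD ExN. Qed.

Lemma wt_ge0 p x : 0 <= p <= 1 -> 0 <= wt p x.
Proof.
by move=> /andP[p0 p1]; apply: prodr_ge0 => e _; case: ifP => // _; rewrite subr_ge0.
Qed.

Lemma Ex_le p f g : 0 <= p <= 1 -> (forall x, f x <= g x) -> Ex p f <= Ex p g.
Proof. by move=> p01 fg; apply: ler_sum => x _; apply: ler_wpM2l => //; exact: wt_ge0. Qed.

Lemma Ex_ge0 p f : 0 <= p <= 1 -> (forall x, 0 <= f x) -> 0 <= Ex p f.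
Proof. by move=> p01 f0; rewrite -(Ex_cst p 0); apply: Ex_le. Qed.

Lemma Ex_eq p f g : f =1 g -> Ex p f = Ex p g.
Proof. by move=> fg; apply: eq_bigr => x _; rewrite fg. Qed.

Lemma Av_eq p e f g : f =1 g -> Av p e f =1 Av p e g.
Proof. by move=> fg x; rewrite /Av !fg. Qed.

Lemma Avl_eq p l f g : f =1 g -> Avl p l f =1 Avl p l g.
Proof. by move=> fg; elim: l => //= e l IH; apply: Av_eq. Qed.

Definition indep e f := forall x b, f (upd x e b) = f x.

Lemma indep_Av p e f : indep e (Av p e f).
Proof. by move=> x b; rewrite /Av !upd_same. Qed.

Lemma indep_Av' p e e' f : indep e f -> indep e (Av p e' f).
Proof.
move=> ef x b; have [->|ee'] := eqVneq e' e; first exact: indep_Av.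
by rewrite /Av !(@upd_comm _ e e') 1?eq_sym // !ef.
Qed.

Lemma indep_Avl p e l f : e \in l -> indep e (Avl p l f).
Proof.
elim: l => //= e' l IH; rewrite inE => /orP[/eqP <-|/IH h]; first exact: indep_Av.
exact: indep_Av'.
Qed.

Lemma indep_cst f : (forall e, indep e f) -> forall x y, f x = f y.
Proof.
move=> fi x y.
have H l : f [ffun i => if i \in l then y i else x i] = f x.
  elim: l => [|e l IH]; first by congr f; apply/ffunP => i; rewrite ffunE.
  rewrite -{}IH -(fi e [ffun i => if i \in l then y i else x i] (y e)).
  by congr f; apply/ffunP => i; rewrite !ffunE inE; case: eqP => [->|].
by rewrite -(H (enum X)); congr f; apply/ffunP => i; rewrite ffunE mem_enum.
Qed.

Lemma Avl_enum p f x : Avl p (enum X) f x = Ex p f.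
Proof.
rewrite -(Ex_Avl p (enum X) f) -[LHS](Ex_cst p); apply: Ex_eq => y.
by apply: indep_cst => e; apply: indep_Avl; rewrite mem_enum.
Qed.

Lemma Av_le p e f g : 0 <= p <= 1 -> (forall x, f x <= g x) -> forall x, Av p e f x <= Av p e g x.
Proof.
move=> /andP[p0 p1] fg x; apply: lerD; apply: ler_wpM2l; rewrite ?subr_ge0 //; exact: fg.
Qed.

Lemma Avl_le p l f g : 0 <= p <= 1 -> (forall x, f x <= g x) -> forall x, Avl p l f x <= Avl p l g x.
Proof. by move=> p01 fg; elim: l => //= e l IH; apply: Av_le. Qed.

Lemma AvlD p l f g x : Avl p l (fun x => f x + g x) x = Avl p l f x + Avl p l g x.
Proof. by elim: l x => //= e l IH x; rewrite /Av !IH; ring. Qed.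

Lemma AvlZ p l c f x : Avl p l (fun x => c * f x) x = c * Avl p l f x.
Proof. by elim: l x => //= e l IH x; rewrite /Av !IH; ring. Qed.

Lemma Avl_indepM p l f g x : (forall e, e \in l -> indep e g) ->
  Avl p l (fun x => f x * g x) x = Avl p l f x * g x.
Proof.
elim: l x => //= e l IH x gi; rewrite /Av !IH; try by move=> e' h; apply: gi; rewrite inE h orbT.
by rewrite !(gi e) ?mem_head //; ring.
Qed.

Definition incr f := forall x y, (forall e, x e -> y e) -> f x <= f y.

Lemma incr_Av p e f : 0 <= p <= 1 -> incr f -> incr (Av p e f).
Proof.
move=> /andP[p0 p1] fi x y xy; apply: lerD; apply: ler_wpM2l; rewrite ?subr_ge0 //.
  by apply: fi => i; rewrite !ffunE; case: eqP => // _; exact: xy.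
by apply: fi => i; rewrite !ffunE; case: eqP => // _; exact: xy.
Qed.

Lemma incr_Avl p l f : 0 <= p <= 1 -> incr f -> incr (Avl p l f).
Proof. by move=> p01 fi; elim: l => //= e l IH; exact: incr_Av. Qed.

Lemma incr_De e f x : incr f -> 0 <= De e f x.
Proof. by move=> fi; rewrite subr_ge0; apply: fi => i; rewrite !ffunE; case: eqP. Qed.

(** For a single coordinate the difference of the two sides is [p * (1 - p)] times the product of
    the two increments. *)
Lemma harris_Av p e f g x : 0 <= p <= 1 -> incr f -> incr g ->
  Av p e f x * Av p e g x <= Av p e (fun x => f x * g x) x.
Proof.
move=> /andP[p0 p1] fi gi.
have := incr_De e x fi; have := incr_De e x gi; rewrite /De => g0 f0.
rewrite -subr_ge0 /Av.
set a := f _; set b := f _; set c := g _; set d := g _.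
have -> : p * (a * c) + (1 - p) * (b * d) - (p * a + (1 - p) * b) * (p * c + (1 - p) * d)
   = p * (1 - p) * ((a - b) * (c - d)) by ring.
by rewrite !mulr_ge0 ?subr_ge0 // -subr_ge0.
Qed.

Lemma harris p f g : 0 <= p <= 1 -> incr f -> incr g ->
  Ex p f * Ex p g <= Ex p (fun x => f x * g x).
Proof.
move=> p01 fi gi; pose x0 : {ffun X -> bool} := [ffun=> true].
rewrite -!(Avl_enum p _ x0).
suff H : forall l x, Avl p l f x * Avl p l g x <= Avl p l (fun x => f x * g x) x by exact: H.
elim=> //= e l IH x; apply: le_trans (Av_le _ p01 IH x).
by apply: harris_Av => //; exact: incr_Avl.
Qed.

Lemma Ex_indep p (S : pred X) f g :
  (forall e, S e -> indep e g) -> (forall e, ~~ S e -> indep e f) ->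
  Ex p (fun x => f x * g x) = Ex p f * Ex p g.
Proof.
move=> gi fi; pose l := [seq e <- enum X | S e].
rewrite -(Ex_Avl p l) (@Ex_eq p _ (fun x => Ex p f * g x)) ?ExZ // => x.
rewrite Avl_indepM; last by move=> e; rewrite mem_filter => /andP[Se _]; exact: gi.
congr (_ * _); rewrite -(Ex_Avl p l f) -[LHS](Ex_cst p); apply: Ex_eq => y.
apply: indep_cst => e; case Se : (S e).
  by apply: indep_Avl; rewrite mem_filter Se mem_enum.
have : indep e f by apply: fi; rewrite Se.
by move: {gi} f {fi y x} => f; elim: l => //= e' l IH fi; apply: indep_Av'; exact: IH.
Qed.

Lemma De_Av p e e' f x : e != e' -> De e (Av p e' f) x = Av p e' (De e f) x.
Proof. by move=> ee'; rewrite /De /Av !(@upd_comm _ e e') //; ring. Qed.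

Lemma De_Avl p e l f x : e \notin l -> De e (Avl p l f) x = Avl p l (De e f) x.
Proof.
elim: l x => //= e' l IH x; rewrite inE negb_or => /andP[ee' el].
by rewrite De_Av //; apply: Av_eq => y; exact: IH.
Qed.

Lemma Av_comm p e e' f x : Av p e (Av p e' f) x = Av p e' (Av p e f) x.
Proof.
have [->//|ee'] := eqVneq e e'.
by rewrite /Av !(@upd_comm _ e e') //; ring.
Qed.

Lemma Avl_Av p e l f x : Av p e (Avl p l f) x = Avl p l (Av p e f) x.
Proof.
elim: l x => //= e' l IH x; rewrite Av_comm; apply: Av_eq => y; exact: IH.
Qed.

(** Russo's formula: each coordinate has its own copy of the parameter, and the product rule adds
    up their contributions. *)
Lemma russo_l (p : R) l f x : uniq l ->
  is_derive p 1 (fun p => Avl p l f x) (\sum_(e <- l) Avl p l (De e f) x).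
Proof.
elim: l x => [|e l IH] x /=; first by move=> _; rewrite big_nil; exact: is_derive_cst.
move=> /andP[el ul].
have H := IH^~ ul.
rewrite big_cons.
apply: is_derive_eq.
rewrite (eq_bigr (fun i => Av p e (Avl p l (De i f)) x)) //.
rewrite /Av big_split /= -!mulr_sumr /GRing.scale /=.
rewrite -!De_Avl // /De !upd_same; ring.
Qed.

Lemma russo (p : R) f : is_derive p 1 (fun p => Ex p f) (\sum_e Ex p (De e f)).
Proof.
pose x0 : {ffun X -> bool} := [ffun=> true].
have := russo_l p f x0 (enum_uniq X).
have -> : (fun p => Avl p (enum X) f x0) = (fun p => Ex p f).
  by apply/funext => q; exact: Avl_enum.
by rewrite big_enum /= (eq_bigr (fun e => Ex p (De e f))) // => e _; exact: Avl_enum.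
Qed.

End cube.

(** * Talagrand's inequality *)

Section real_lemmas.
Variable R : realType.

Definition phi (t : R) : R := t * ln t.

Lemma ln_le_sub1 (t : R) : 0 < t -> ln t <= t - 1.
Proof. move=> t0; have := @le_ln1Dx R (t - 1).
have -> : 1 + (t - 1) = t by ring.
by apply; lra. Qed.

(** The tangent bound of the logarithm at [M]. *)
Lemma phi_le (A M : R) : 0 <= A -> 0 < M -> phi A <= A * ln M + A * (A / M - 1).
Proof.
rewrite le_eqVlt => /orP[/eqP <-|A0] M0; first by rewrite /phi !mul0r addr0.
rewrite /phi -mulrDr ler_pM2l //.
have := @ln_le_sub1 (A / M) (divr_gt0 A0 M0); rewrite ln_div ?posrE //; lra.
Qed.

(** The logarithmic Sobolev inequality on two points, with a constant that does not depend on
    [p]. Bounding both logarithms by their tangent at the mean [M] makes the left side rational,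
    and the difference of the two sides becomes a sum of squares. *)
Lemma two_point (p a b : R) : 0 <= p <= 1 ->
  p * phi (a ^+ 2) + (1 - p) * phi (b ^+ 2) - phi (p * a ^+ 2 + (1 - p) * b ^+ 2)
    <= 2 * (a - b) ^+ 2.
Proof.
move=> /andP[p0 p1]; set M := p * a ^+ 2 + (1 - p) * b ^+ 2.
have q0 : 0 <= 1 - p by lra.
have a0 := sqr_ge0 a; have b0 := sqr_ge0 b.
have r0 : 0 <= 2 * (a - b) ^+ 2 by rewrite mulr_ge0 // sqr_ge0.
have pa := mulr_ge0 p0 a0; have qb := mulr_ge0 q0 b0.
have [M0|M0] := leP M 0.
  have pa0 : p * a ^+ 2 = 0 by rewrite /M in M0; lra.
  have qb0 : (1 - p) * b ^+ 2 = 0 by rewrite /M in M0; lra.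
  by rewrite /phi (mulrA p) (mulrA (1 - p)) pa0 qb0 /M pa0 qb0 !(addr0, mul0r, subr0).
have h1 := ler_wpM2l p0 (phi_le a0 M0).
have h2 := ler_wpM2l q0 (phi_le b0 M0).
apply: (@le_trans _ _ ((p * a ^+ 2 * a ^+ 2 + (1 - p) * b ^+ 2 * b ^+ 2) / M - M)).
  have -> : (p * a ^+ 2 * a ^+ 2 + (1 - p) * b ^+ 2 * b ^+ 2) / M - M =
     p * (a ^+ 2 * ln M + a ^+ 2 * (a ^+ 2 / M - 1)) +
     (1 - p) * (b ^+ 2 * ln M + b ^+ 2 * (b ^+ 2 / M - 1)) - phi M.
    rewrite /phi; have MN : M != 0 by rewrite gt_eqF.
    by move: (ln M) => lm; rewrite /M; field.
  by rewrite lerD2r lerD.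
rewrite lerBlDr ler_pdivrMr // -subr_ge0.
have -> : (2 * (a - b) ^+ 2 + M) * M - (p * a ^+ 2 * a ^+ 2 + (1 - p) * b ^+ 2 * b ^+ 2) =
   (a - b) ^+ 2 * ((p * a - (1 - p) * b) ^+ 2 + p * a ^+ 2 + (1 - p) * b ^+ 2).
  by rewrite /M; ring.
by rewrite mulr_ge0 ?sqr_ge0 // !addr_ge0 // sqr_ge0.
Qed.

End real_lemmas.

Section lsi.
Variables (R : realType) (X : finType) (p : R).
Hypothesis p01 : 0 <= p <= 1.
Implicit Types (x y : {ffun X -> bool}) (f g h : {ffun X -> bool} -> R) (e : X) (l : seq X).

Lemma Avl_ge0 l f x : (forall x, 0 <= f x) -> 0 <= Avl p l f x.
Proof.
have /andP[p0 p1] := p01; move=> f0; elim: l x => //= e l IH x.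
by apply: addr_ge0; apply: mulr_ge0; rewrite ?subr_ge0.
Qed.

Lemma Avl_upd l f x e b : e \notin l ->
  Avl p l f (upd x e b) = Avl p l (fun y => f (upd y e b)) x.
Proof.
elim: l x => //= e' l IH x; rewrite inE negb_or => /andP[ee' el].
by rewrite /Av !(@upd_comm _ _ e e') // !IH.
Qed.

Lemma Avl_CS l f g x :
  (Avl p l (fun x => f x * g x) x) ^+ 2 <=
  Avl p l (fun x => f x ^+ 2) x * Avl p l (fun x => g x ^+ 2) x.
Proof.
set a := Avl _ _ _ _; set b := Avl _ _ _ _; set c := Avl _ _ _ _.
have H s t : 0 <= s ^+ 2 * b - 2 * s * t * a + t ^+ 2 * c.
  have -> : s ^+ 2 * b - 2 * s * t * a + t ^+ 2 * c =
     Avl p l (fun x => (s * f x - t * g x) ^+ 2) x.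
    rewrite (_ : _ - _ = s ^+ 2 * b + (- (2 * s * t)) * a); last by ring.
    rewrite /a /b /c -!AvlZ -!AvlD.
    by apply: Avl_eq => y; ring.
  by apply: Avl_ge0 => y; exact: sqr_ge0.
have b0 : 0 <= b by apply: Avl_ge0 => y; exact: sqr_ge0.
have c0 : 0 <= c by apply: Avl_ge0 => y; exact: sqr_ge0.
have [cp|cp] := ltP 0 c.
  have := H c a; have -> : c ^+ 2 * b - 2 * c * a * a + a ^+ 2 * c = c * (b * c - a ^+ 2) by ring.
  by rewrite pmulr_rge0 // subr_ge0.
have {cp} c00 : c = 0 by lra.
have [bp|bp] := ltP 0 b.
  have := H a b; have -> : a ^+ 2 * b - 2 * a * b * a + b ^+ 2 * c = b * (b * c - a ^+ 2) by ring.
  by rewrite pmulr_rge0 // subr_ge0.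
have b00 : b = 0 by lra.
have := H 1 1; have := H 1 (-1); rewrite b00 c00 => h1 h2.
have -> : a = 0 by lra.
by rewrite expr0n mulr0.
Qed.

(** Entropy is additive over coordinates. Integrating out the coordinates of [l] one after
    another, the two-point inequality is applied to the square root of the partial average [K] of
    the square of [g]; by the Cauchy-Schwarz inequality that square root varies less than [g]
    does. *)
Lemma lsi_list l g : uniq l ->
  Ex p (fun x => phi (g x ^+ 2)) - Ex p (fun x => phi (Avl p l (fun y => g y ^+ 2) x))
   <= 2 * \sum_(e <- l) Ex p (fun x => De e g x ^+ 2).
Proof.
elim: l => [|e l IH] /=; first by rewrite big_nil mulr0 subrr.
move=> /andP[el /IH {}IH]; rewrite big_cons mulrDr.
set K := Avl p l (fun y => g y ^+ 2) in IH *.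
suff H : Ex p (fun x => phi (K x)) - Ex p (fun x => phi (Av p e K x)) <=
    2 * Ex p (fun x => De e g x ^+ 2) by rewrite addrC; move: IH H; lra.
rewrite -(Ex_Av p e (fun x => phi (K x))) -ExB -ExZ -(Ex_Avl p l) /=.
rewrite -(Ex_Avl p l (fun x => 2 * _)) (Ex_Avl p l (fun x => Av _ _ _ _ - _)).
apply: Ex_le => // x; rewrite AvlZ.
have K0 y : 0 <= K y by apply: Avl_ge0 => z; exact: sqr_ge0.
have KE b : K (upd x e b) = Num.sqrt (K (upd x e b)) ^+ 2 by rewrite sqr_sqrtr.
rewrite /Av; set a := K (upd x e true); set b := K (upd x e false).
have aE : a = Num.sqrt a ^+ 2 by exact: KE.
have bE : b = Num.sqrt b ^+ 2 by exact: KE.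
rewrite {1 2}aE {1 2}bE; apply: le_trans (two_point _ _ p01) _.
rewrite ler_pM2l //.
have -> : Avl p l (fun y => De e g y ^+ 2) x =
   a + b - 2 * Avl p l (fun y => g (upd y e true) * g (upd y e false)) x.
  rewrite /a /b /K !Avl_upd // -mulNr -AvlZ -!AvlD.
  by apply: Avl_eq => y; rewrite /De; ring.
have := Avl_CS l (fun y => g (upd y e true)) (fun y => g (upd y e false)) x.
rewrite -(Avl_upd (fun y => g y ^+ 2) x true el) -(Avl_upd (fun y => g y ^+ 2) x false el).
rewrite -/K -/a -/b; set c := Avl _ _ _ _ => h.
have h' : c <= Num.sqrt a * Num.sqrt b.
  have [c0|c0] := leP c 0; first by apply: le_trans c0 _; rewrite mulr_ge0 ?sqrtr_ge0.
  rewrite -(@ler_pXn2r _ 2) ?nnegrE ?mulr_ge0 ?sqrtr_ge0 ?(ltW c0) //.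
  by rewrite exprMn -aE -bE.
rewrite {2}aE {2}bE; move: h'; rewrite sqrrB -mulr_natl; lra.
Qed.

(** A function whose first moment is small compared with its second moment has large entropy,
    hence large energy by [lsi_list]. The ratio that counts as small is set by [T]. *)
Lemma ent_lower g (T : R) : 0 < T ->
  Ex p (fun x => g x ^+ 2) * ln T - T * Ex p (fun x => `|g x|) ^+ 2 <=
  2 * \sum_e Ex p (fun x => De e g x ^+ 2).
Proof.
move=> T0; set v := Ex p (fun x => g x ^+ 2); set m := Ex p _.
have v0 : 0 <= v by apply: Ex_ge0 => // x; exact: sqr_ge0.
have rhs0 : 0 <= 2 * \sum_e Ex p (fun x => De e g x ^+ 2).
  by apply: mulr_ge0 => //; apply: sumr_ge0 => e _; apply: Ex_ge0 => // x; exact: sqr_ge0.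
have [vp|vp] := ltP 0 v; last first.
  have -> : v = 0 by lra.
  by rewrite mul0r; apply: le_trans rhs0; rewrite sub0r oppr_le0 mulr_ge0 ?sqr_ge0 // ltW.
have := lsi_list g (enum_uniq X); rewrite big_enum /= => h; apply: le_trans h.
have -> : Ex p (fun x => phi (Avl p (enum X) (fun y => g y ^+ 2) x)) = phi v.
  by rewrite -[RHS](Ex_cst X p); apply: Ex_eq => x; rewrite Avl_enum.
(* The logarithm of [g] is bounded below by its tangent at [b], which makes the first moment of
   [g] appear. *)
pose b := Num.sqrt (v * T).
have vT : 0 < v * T by rewrite mulr_gt0.
have b0 : 0 < b by rewrite sqrtr_gt0.
have H t : 2 * t ^+ 2 * ln b + 2 * (t ^+ 2 - b * `|t|) <= phi (t ^+ 2).
  have [->|t0] := eqVneq t 0; first by rewrite /phi normr0 expr0n /= !(mulr0, mul0r) subrr mulr0 addr0.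
  have nt : 0 < `|t| by rewrite normr_gt0.
  have := ln_le_sub1 (divr_gt0 b0 nt); rewrite ln_div ?posrE // => lb.
  rewrite /phi -(real_normK (num_real t)) lnXn // -mulr_natl.
  have : `|t| ^+ 2 * (ln b - ln `|t|) <= `|t| ^+ 2 * (b / `|t| - 1) by apply: ler_wpM2l => //; exact: sqr_ge0.
  have -> : `|t| ^+ 2 * (b / `|t| - 1) = b * `|t| - `|t| ^+ 2.
    by field; rewrite gt_eqF.
  lra.
apply: (@le_trans _ _ (Ex p (fun x => 2 * g x ^+ 2 * ln b + 2 * (g x ^+ 2 - b * `|g x|)) - phi v)); last first.
  by rewrite lerD2r; apply: Ex_le.
have -> : Ex p (fun x => 2 * g x ^+ 2 * ln b + 2 * (g x ^+ 2 - b * `|g x|)) =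
   2 * v * ln b + 2 * (v - b * m).
  rewrite (@Ex_eq _ _ _ _ (fun x => (2 * ln b + 2) * g x ^+ 2 + (- 2 * b) * `|g x|)).
    by rewrite ExD !ExZ -/v -/m; ring.
  by move=> x; ring.
have lb : 2 * ln b = ln v + ln T.
  have bb : b ^+ 2 = v * T by rewrite /b sqr_sqrtr // ltW.
  by rewrite -lnM ?posrE // -bb lnXn // mulr_natl.
have -> : 2 * v * ln b = v * ln v + v * ln T by rewrite mulrAC lb; ring.
have bm : 2 * (b * m) <= v + T * m ^+ 2.
  have s : 0 <= (Num.sqrt v - Num.sqrt T * m) ^+ 2 by exact: sqr_ge0.
  have bE : b = Num.sqrt v * Num.sqrt T by rewrite /b sqrtrM.
  move: s; rewrite sqrrB exprMn !sqr_sqrtr ?(ltW T0) // bE -mulr_natl; lra.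
rewrite /phi; lra.
Qed.

(** A sum over the decompositions of a list into initial entries, one entry, and the entries
    after it. The martingale differences of a function are indexed in this way. *)
Fixpoint dsum (F : X -> seq X -> R) l : R :=
  if l is e :: l' then F e l' + dsum F l' else 0.

(** The martingale difference of [f] at the coordinate [e], once the coordinates of [l] have been
    averaged out. *)
Definition mdiff f e l x := Avl p l f x - Av p e (Avl p l f) x.

Lemma Ex_pyth e f : Ex p (fun x => (f x - Av p e f x) ^+ 2) =
  Ex p (fun x => f x ^+ 2) - Ex p (fun x => Av p e f x ^+ 2).
Proof.
have h : Ex p (fun x => f x * Av p e f x) = Ex p (fun x => Av p e f x ^+ 2).
  rewrite -(Ex_Av p e); apply: Ex_eq => x.
  rewrite -[LHS]/(Avl p [:: e] (fun x0 => f x0 * Av p e f x0) x).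
  by rewrite (@Avl_indepM _ _ p [:: e]) //= => e' ; rewrite inE => /eqP ->; exact: indep_Av.
rewrite (@Ex_eq _ _ _ _ (fun x => (f x ^+ 2 + (- 2) * (f x * Av p e f x)) + Av p e f x ^+ 2)).
  by rewrite !ExD ExZ h; ring.
by move=> x; ring.
Qed.

(** Orthogonality of the martingale differences. *)
Lemma dsum_var f l : dsum (fun e l' => Ex p (fun x => mdiff f e l' x ^+ 2)) l =
  Ex p (fun x => f x ^+ 2) - Ex p (fun x => Avl p l f x ^+ 2).
Proof.
by elim: l => [|e l IH] /=; rewrite ?subrr // IH Ex_pyth; ring.
Qed.

(** The energy in a fixed direction is also additive over the martingale differences, because
    differentiation commutes with averaging over the other coordinates. *)
Lemma dsum_energy f l e' : 
  dsum (fun e l' => Ex p (fun x => De e' (mdiff f e l') x ^+ 2)) l +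
  Ex p (fun x => De e' (Avl p l f) x ^+ 2) = Ex p (fun x => De e' f x ^+ 2).
Proof.
elim: l => [|e l IH] /=; first by rewrite add0r.
rewrite -{}IH addrAC addrC; congr (_ + _).
set F := Avl p l f.
have [<-|ee'] := eqVneq e' e.
  rewrite [X in _ + X](@Ex_eq _ _ _ _ (fun=> 0)) ?Ex_cst ?addr0; last first.
    by move=> x; rewrite /De !(@indep_Av _ _ p e' F) subrr expr0n.
  apply: Ex_eq => x; rewrite /De /mdiff -/F !(@indep_Av _ _ p e' F).
  by congr (_ ^+ 2); ring.
rewrite (@Ex_eq _ _ _ _ (fun x => (De e' F x - Av p e (De e' F) x) ^+ 2)); last first.
  by move=> x; rewrite -De_Av // /De /mdiff -/F; congr (_ ^+ 2); ring.
rewrite (@Ex_eq _ _ _ (fun x => De e' (Av p e F) x ^+ 2) (fun x => Av p e (De e' F) x ^+ 2)).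
  by rewrite Ex_pyth subrK.
by move=> x; rewrite De_Av.
Qed.

Lemma dsum_le F G l : (forall e l', e \notin l' -> F e l' <= G e l') -> uniq l -> dsum F l <= dsum G l.
Proof. by move=> FG; elim: l => //= e l IH /andP[el ul]; rewrite lerD ?FG ?IH. Qed.

Lemma dsum_sum (F : X -> X -> seq X -> R) l :
  \sum_e' dsum (F e') l = dsum (fun e l' => \sum_e' F e' e l') l.
Proof. by elim: l => [|e l IH] /=; rewrite ?big_split /= ?IH // big1. Qed.

(** The argument of Falik and Samorodnitsky. Apply [ent_lower] to each martingale difference of
    [f]: the variances add up to the variance of [f], the energies to its total energy, which for
    an increasing indicator function is the total influence, and the first moment of the
    difference at [e] is at most the influence of [e]. *)
Lemma talagrand f (T : R) : 0 < T -> incr f -> (forall x, f x = 0 \/ f x = 1) ->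
  (Ex p f - Ex p f ^+ 2) * ln T - T * \sum_e Ex p (De e f) ^+ 2 <=
  2 * \sum_e Ex p (De e f).
Proof.
move=> T0 fi fb.
have /andP[p0 p1] := p01.
have -> : Ex p f - Ex p f ^+ 2 = dsum (fun e l' => Ex p (fun x => mdiff f e l' x ^+ 2)) (enum X).
  rewrite dsum_var; congr (_ - _).
    by apply: Ex_eq => x; have [->|->] := fb x; rewrite ?expr0n ?expr1n.
  by rewrite -[LHS](Ex_cst X p); apply: Ex_eq => x; rewrite Avl_enum.
have -> : \sum_e Ex p (De e f) ^+ 2 = dsum (fun e _ => Ex p (De e f) ^+ 2) (enum X).
  by rewrite -big_enum /=; elim: (enum X) => [|e l IH] /=; rewrite ?big_nil ?big_cons ?IH.
have -> : \sum_e Ex p (De e f) = \sum_e Ex p (fun x => De e f x ^+ 2).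
  apply: eq_bigr => e _; apply: Ex_eq => x; have := incr_De e x fi; rewrite /De.
  by have [->|->] := fb (upd x e true); have [->|->] := fb (upd x e false);
    rewrite ?(subrr, subr0, sub0r, expr0n, expr1n) //=; lra.
apply: (@le_trans _ _ (2 * \sum_e dsum (fun e0 l' => Ex p (fun x => De e (mdiff f e0 l') x ^+ 2)) (enum X))); last first.
  rewrite ler_pM2l //; apply: ler_sum => e _; rewrite -(dsum_energy f (enum X) e) lerDl.
  by apply: Ex_ge0 => // x; exact: sqr_ge0.
rewrite dsum_sum.
apply: (@le_trans _ _ (dsum (fun e l' => Ex p (fun x => mdiff f e l' x ^+ 2) * ln T - T * Ex p (De e f) ^+ 2) (enum X))).
  rewrite le_eqVlt; apply/orP; left; apply/eqP.
  elim: (enum X) => [|e l IH] /=; first by rewrite mul0r mulr0 subrr.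
  by rewrite -IH; ring.
apply: (@le_trans _ _ (dsum (fun e l' => 2 * \sum_e' Ex p (fun x => De e' (mdiff f e l') x ^+ 2)) (enum X))); last first.
  rewrite le_eqVlt; apply/orP; left; apply/eqP.
  by elim: (enum X) => [|e l IH] /=; rewrite ?mulr0 // IH; ring.
apply: dsum_le (enum_uniq X) => e l el.
apply: le_trans (ent_lower (mdiff f e l) T0); rewrite lerD2l lerN2 ler_pM2l //.
have dE x : mdiff f e l x = Avl p l (fun y => f y - Av p e f y) x.
  rewrite /mdiff Avl_Av -mulN1r -AvlZ -AvlD; apply: Avl_eq => y; ring.
rewrite ler_sqr ?nnegrE; try by apply: Ex_ge0 => // x; rewrite ?normr_ge0 // incr_De.
apply: (@le_trans _ _ (Ex p (fun x => Avl p l (fun y => De e f y) x))); last by rewrite Ex_Avl.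
apply: Ex_le => // x; rewrite dE ler_norml; apply/andP; split.
  rewrite -mulN1r -AvlZ; apply: Avl_le => // y; rewrite mulN1r.
  have := incr_De e y fi; rewrite /De /Av.
  have : f y = f (upd y e true) \/ f y = f (upd y e false).
    by rewrite -{1 3}(upd_id y e); case: (y e); [left|right].
  move: (f y) (f (upd y e true)) (f (upd y e false)) => c a b [->|->] ab.
    by have := mulr_ge0 (_ : 0 <= 1 - p) ab; lra.
  by have := mulr_ge0 p0 ab; have := mulr_ge0 (_ : 0 <= 1 - p) ab; lra.
apply: Avl_le => // y.
have := incr_De e y fi; rewrite /De /Av.
have : f y = f (upd y e true) \/ f y = f (upd y e false).
  by rewrite -{1 3}(upd_id y e); case: (y e); [left|right].
move: (f y) (f (upd y e true)) (f (upd y e false)) => c a b [->|->] ab.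
  by have := mulr_ge0 p0 ab; lra.
by have := mulr_ge0 p0 ab; lra.
Qed.

End lsi.

(** * Sharp thresholds on the cube *)

Section sharp.
Variables (R : realType) (X : finType).
Implicit Types (x y : {ffun X -> bool}) (f g h : {ffun X -> bool} -> R) (e : X).

(** When every influence is at most a fraction [L ^- 2] of the total influence [U], the sum of
    the squares of the influences is at most [U ^+ 2 / L ^+ 2], and [talagrand] with [T := L]
    bounds [U] below, unless [U] already exceeds [L]. *)
Lemma sharp_deriv (p : R) f (L : R) : 0 <= p <= 1 -> 1 <= L -> incr f ->
  (forall x, f x = 0 \/ f x = 1) ->
  (forall e, L ^+ 2 * Ex p (De e f) <= \sum_e' Ex p (De e' f)) ->
  ln L / 3 * (Ex p f - Ex p f ^+ 2) <= \sum_e Ex p (De e f).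
Proof.
move=> p01 L1 fi fb hL; set U := \sum_e _ in hL *.
set u := Ex p f.
have L0 : 0 < L by lra.
have I0 e : 0 <= Ex p (De e f) by apply: Ex_ge0 => // x; exact: incr_De.
have U0 : 0 <= U by apply: sumr_ge0.
have lnL : ln L <= L - 1 by exact: ln_le_sub1.
have lnL0 : 0 <= ln L by rewrite ln_ge0.
have u01 : 0 <= u <= 1.
  apply/andP; split; first by apply: Ex_ge0 => // x; have [->|->] := fb x.
  by rewrite -[leRHS](Ex_cst X p); apply: Ex_le => // x; have [->|->] := fb x.
have V4 : u - u ^+ 2 <= 1 by have := sqr_ge0 u; lra.
have V0 : 0 <= u - u ^+ 2 by have : 0 <= u * (1 - u) by [apply: mulr_ge0; lra]; lra.
have sq : L * \sum_e Ex p (De e f) ^+ 2 <= U * U / L.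
  rewrite ler_pdivlMr // mulrC mulrA -expr2 mulr_sumr {1}/U mulr_suml.
  by apply: ler_sum => e _; rewrite expr2 mulrA mulrC ler_wpM2l.
have := talagrand p01 L0 fi fb; rewrite -/u -/U => tal.
have [UL|UL] := leP U L.
  have : U * U / L <= U by rewrite ler_pdivrMr // ler_wpM2l.
  lra.
have h : ln L * (u - u ^+ 2) <= ln L by rewrite -[leRHS]mulr1 ler_wpM2l.
lra.
Qed.

Lemma Ex_mono f (a b : R) : 0 <= a -> a <= b -> b <= 1 -> incr f -> Ex a f <= Ex b f.
Proof.
move=> a0 ab b1 fi; pose u (p : R) := Ex p f; rewrite -/(u a) -/(u b).
have du (p : R) : is_derive p 1 u (\sum_e Ex p (De e f)) by exact: russo.
have du0 (p : R) : 0 <= p <= 1 -> 0 <= \sum_e Ex p (De e f).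
  by move=> p01; apply: sumr_ge0 => e _; apply: Ex_ge0 => // x; exact: incr_De.
have cu (p : R) : {for p, continuous u}.
  by apply: differentiable_continuous; apply/derivable1_diffP; have [] := du p.
move: ab; rewrite le_eqVlt => /orP[/eqP -> //|ab].
have [c cab E] : exists2 c, c \in `]a, b[%R & u b - u a = (\sum_e Ex c (De e f)) * (b - a).
  by apply: MVT => //; apply: continuous_subspaceT => c; exact: cu.
move: cab; rewrite in_itv /= => /andP[ac cb].
by rewrite -subr_ge0 E mulr_ge0 ?du0; lra.
Qed.

(** Integrate [sharp_deriv], divided by [u * (1 - u)], where [u] is the expectation as a function
    of the parameter: it bounds below the increase of the log-odds [ln (u / (1 - u))] between
    [p1] and [p2]. *)
Lemma sharp_threshold f (L p1 p2 : R) : 0 <= p1 -> p1 <= p2 -> p2 <= 1 -> 1 <= L -> incr f ->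
  (forall x, f x = 0 \/ f x = 1) ->
  (forall (p : R) e, 0 <= p <= 1 -> L ^+ 2 * Ex p (De e f) <= \sum_e' Ex p (De e' f)) ->
  Ex p1 f * (1 - Ex p2 f) <= expR (- (p2 - p1) / 3 * ln L).
Proof.
move=> p10 p12 p21 L1 fi fb hL.
pose u (p : R) := Ex p f; rewrite -/(u p1) -/(u p2).
have lnL0 : 0 <= ln L by rewrite ln_ge0.
have u01 (p : R) : 0 <= p <= 1 -> 0 <= u p <= 1.
  move=> p01; apply/andP; split; first by apply: Ex_ge0 => // x; have [->|->] := fb x.
  by rewrite -[leRHS](Ex_cst X p); apply: Ex_le => // x; have [->|->] := fb x.
have du (p : R) : is_derive p 1 u (\sum_e Ex p (De e f)) by exact: russo.
have du0 (p : R) : 0 <= p <= 1 -> 0 <= \sum_e Ex p (De e f).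
  by move=> p01; apply: sumr_ge0 => e _; apply: Ex_ge0 => // x; exact: incr_De.
have cu (p : R) : {for p, continuous u}.
  by apply: differentiable_continuous; apply/derivable1_diffP; have [] := du p.
have um (a b : R) : 0 <= a -> a <= b -> b <= 1 -> u a <= u b by move=> *; apply: Ex_mono.
have := u01 p1 (_ : _ = true); have := u01 p2 (_ : _ = true).
set E := expR _; have E0 : 0 < E by exact: expR_gt0.
have [u1|u1] := leP (u p1) 0.
  move=> h2 h1; have -> : u p1 = 0 by apply/eqP; rewrite eq_le u1; have := h1; lra.
  by rewrite mul0r ltW.
have [u2|u2] := leP 1 (u p2).
  move=> h2 h1; have -> : u p2 = 1 by apply/eqP; rewrite eq_le u2; have := h2; lra.
  by rewrite subrr mulr0 ltW.
move=> _ _.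
have uI c : p1 <= c <= p2 -> 0 < u c < 1.
  move=> /andP[c1 c2]; have := um _ _ p10 c1; have := um _ _ (_ : 0 <= c) c2; lra.
pose F := fun p : R => ln (u p) - ln (1 - u p).
have dF (c : R) : p1 <= c <= p2 -> is_derive c 1 F ((\sum_e Ex c (De e f)) / (u c * (1 - u c))).
  move=> /uI /andP[c0 c1]; have dc := du c.
  have l1 : is_derive (u c) 1 (@ln R) (u c)^-1 by exact: is_derive1_ln.
  have l2 : is_derive (1 - u c) 1 (@ln R) (1 - u c)^-1 by apply: is_derive1_ln; lra.
  have d1 : is_derive c 1 (@ln R \o u) ((u c)^-1 * (\sum_e Ex c (De e f))).
    by apply: is_derive1_comp.
  have dv := is_deriveB (is_derive_cst (1 : R) c (1 : R)) dc.
  have d2 : is_derive c 1 (@ln R \o (fun p => 1 - u p)) ((1 - u c)^-1 * (0 - \sum_e Ex c (De e f))).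
    by apply: is_derive1_comp.
  have d3 := is_deriveB d1 d2.
  apply: is_derive_eq.
  by field; apply/andP; split; lra.
have HF : (p2 - p1) / 3 * ln L <= F p2 - F p1.
  move: p12; rewrite le_eqVlt => /orP[/eqP ->|p12]; first by rewrite !subrr !mul0r.
  have [c cab ->] : exists2 c, c \in `]p1, p2[%R & F p2 - F p1 = ((\sum_e Ex c (De e f)) / (u c * (1 - u c))) * (p2 - p1).
    apply: MVT => //.
      by move=> c; rewrite in_itv /= => /andP[c1 c2]; apply: dF; lra.
    apply: derivable_within_continuous => c; rewrite in_itv /= => c12.
    by have [] := dF c c12.
  move: cab; rewrite in_itv /= => /andP[c1 c2].
  have /andP[uc0 uc1] : 0 < u c < 1 by apply: uI; lra.
  rewrite mulrAC [leRHS]mulrC -mulrA ler_wpM2l //; first by lra.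
  rewrite ler_pdivlMr ?mulr_gt0 //; last by lra.
  have := @sharp_deriv c f L (_ : _ = true) L1 fi fb (_ : _).
  rewrite -/(u c); move=> h; have -> : u c * (1 - u c) = u c - u c ^+ 2 by ring.
  by apply: h; [lra|move=> e; apply: hL; lra].
have /andP[a0 a1] : 0 < u p1 < 1 by apply: uI; lra.
have /andP[b0 b1] : 0 < u p2 < 1 by apply: uI; lra.
have X0 : 0 < u p1 * (1 - u p2) by rewrite mulr_gt0 // subr_gt0.
rewrite -[leLHS](@lnK R) ?posrE // ler_expR lnM ?posrE ?subr_gt0 //.
have l1 : ln (u p2) <= 0 by rewrite ln_le0 // ltW.
have l2 : ln (1 - u p1) <= 0 by rewrite ln_le0 //; lra.
move: HF; rewrite /F; lra.
Qed.

End sharp.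

(** * The law of finitely many edges *)

(** Edges in coordinates. Bond configurations are transported to this type, where lattice motions
    act by arithmetic, and lattice points to pairs of integers ([toV], [ofV]). *)
Definition cfg := edge_t -> bool.

Definition ehead (e : edge_t) : pt :=
  if e.2 then (e.1.1, e.1.2 + 1) else (e.1.1 + 1, e.1.2).

Definition toV (x : pt) : 'cV[int]_2 := \col_i (if i == 0 then x.1 else x.2).
Definition ofV (v : 'cV[int]_2) : pt := (v 0 0, v 1 0).

Lemma toVK : cancel toV ofV.
Proof. by case=> a b; rewrite /ofV !mxE. Qed.

Lemma ofVK : cancel ofV toV.
Proof.
move=> v; apply/colP => i; rewrite mxE; case: eqP => [->//|/eqP i0].
by congr (v _ _); apply/val_inj; case: i i0 => -[|[]].
Qed.

Lemma toV_inj : injective toV. Proof. exact: can_inj toVK. Qed.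

Lemma norm1_toV x y : norm1 (toV x - toV y) = (`|x.1 - y.1| + `|x.2 - y.2|)%N.
Proof. by rewrite /norm1 !big_ord_recl big_ord0 !mxE /= addn0. Qed.

Lemma norm1_adjp x y : norm1 (toV x - toV y) = 1%N <-> adjp x y.
Proof. by rewrite norm1_toV /adjp; split; lia. Qed.

Definition edgeV (e : edge_t) : {fset 'cV[int]_2} := [fset toV e.1; toV (ehead e)]%fset.

Lemma adjp_ehead e : adjp e.1 (ehead e).
Proof. by case: e => -[a b] [] /=; rewrite /adjp /ehead /=; lia. Qed.

Lemma edgeV_lattice e : edge lattice (edgeV e).
Proof. by exists (toV e.1), (toV (ehead e)); split => //; apply/norm1_adjp/adjp_ehead. Qed.

Lemma adjp_edge x y : adjp x y -> exists e, (e.1 = x /\ ehead e = y) \/ (e.1 = y /\ ehead e = x).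
Proof.
case: x y => [a b] [c d]; rewrite /adjp /= => -[[-> [->|->]]|[-> [->|->]]].
- by exists ((c, b), true); left.
- by exists ((c, d), true); right.
- by exists ((a, d), false); left.
- by exists ((c, d), false); right.
Qed.

Lemma edgeV_surj b : edge lattice b -> exists e, b = edgeV e.
Proof.
move=> [x [y [n1 ->]]]; move: n1; rewrite -[x]ofVK -[y]ofVK => /norm1_adjp /adjp_edge [e h].
by exists e; rewrite /edgeV; case: h => -[-> ->] //; rewrite fsetUC.
Qed.

Lemma fset2_eq (K : choiceType) (a b c d : K) : [fset a; b]%fset = [fset c; d]%fset ->
  (a = c /\ b = d) \/ (a = d /\ b = c).
Proof.
move=> E.
have : a \in [fset c; d]%fset by rewrite -E !inE eqxx.
have : b \in [fset c; d]%fset by rewrite -E !inE eqxx orbT.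
have : c \in [fset a; b]%fset by rewrite E !inE eqxx.
have : d \in [fset a; b]%fset by rewrite E !inE eqxx orbT.
rewrite !inE => /orP[]/eqP d1 /orP[]/eqP c1 /orP[]/eqP b1 /orP[]/eqP a1; subst; auto.
Qed.

Lemma edgeV_inj : injective edgeV.
Proof.
move=> e e' /fset2_eq h.
have {h} : (e.1 = e'.1 /\ ehead e = ehead e') \/ (e.1 = ehead e' /\ ehead e = e'.1).
  by case: h => -[/toV_inj h1 /toV_inj h2]; [left|right].
case: e e' => -[a b] [] [[c d] []] //=; rewrite /ehead /= => -[] [[? ?] [? ?]];
  first [by exfalso; lia | by f_equal; f_equal; lia].
Qed.

Definition bondof (e : edge_t) : bond := SigSub (mem_set (edgeV_lattice e)).

Lemma bondof_inj : injective bondof.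
Proof. by move=> e e' /(congr1 val)/edgeV_inj. Qed.

Definition cfg_of (w : config) : cfg := fun e => w (bondof e).

Lemma cylinder_measurable (b : bond) v : measurable [set w : config | w b = v].
Proof.
have mt : measurable [set w : config | w b = true].
  by apply: sub_sigma_algebra; exists b.
case: v => //; rewrite (_ : [set w | _] = ~` [set w : config | w b = true]).
  exact: measurableC.
by apply/seteqP; split=> w /=; case: (w b).
Qed.

Section law.
Variables (R : realType) (p : R) (mu : probability config R).
Hypothesis hmu : bernoulli_percolation p mu.
Variables (X : finType) (io : X -> edge_t).
Hypothesis io_inj : injective io.

Definition smp (w : config) : {ffun X -> bool} := [ffun x => cfg_of w (io x)].

Lemma smpE s : [set w | smp w = s] = \bigcap_(x in [set: X]) [set w : config | w (bondof (io x)) = s x].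
Proof.
apply/seteqP; split=> w /=; first by move=> <- x _ /=; rewrite ffunE.
by move=> h; apply/ffunP => x; rewrite ffunE; exact: h.
Qed.

Lemma smp_measurable Q : measurable [set w | Q (smp w)].
Proof.
rewrite (_ : [set w | _] = \bigcup_(s in [set s | Q s]) [set w | smp w = s]).
  apply: fin_bigcup_measurable => // s _; rewrite smpE.
  by apply: fin_bigcap_measurable => // x _; exact: cylinder_measurable.
apply/seteqP; split=> w /=; first by move=> h; exists (smp w).
by case=> s /= Qs ->.
Qed.

(** This is where the definition of the product law enters: it gives the probability of each
    assignment to finitely many edges. *)
Lemma smp_law s : mu [set w | smp w = s] = (wt p s)%:E.
Proof.
pose f x := bondof (io x).
have f_inj : injective f by apply: inj_comp io_inj; exact: bondof_inj.
pose B := [fset f x | x in X]%fset.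
pose s' (b : bond) := if [pick x | f x == b] is Some x then s x else false.
have s'f x : s' (f x) = s x.
  by rewrite /s'; case: pickP => [y /eqP/f_inj -> //|/(_ x)]; rewrite eqxx.
have := hmu B s'; rewrite big_imfset /=; last by move=> x y _ _; exact: f_inj.
rewrite big_enum /= /wt => h.
rewrite (eq_bigr (fun x => if s' (f x) then p else 1 - p)) -?h; last by move=> x _; rewrite s'f.
congr (mu _); apply/seteqP; split=> w /=.
  by move=> ws b /imfsetP[x _ ->]; rewrite s'f -ws ffunE.
by move=> h'; apply/ffunP => x; rewrite ffunE -s'f /cfg_of -/(f x) h' // in_imfset.
Qed.

Lemma mu_smp (Q : {ffun X -> bool} -> Prop) :
  mu [set w | Q (smp w)] = (Ex p (fun s => (`[< Q s >])%:R))%:E.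
Proof.
rewrite (_ : [set w | _] = \bigcup_(s in [set s | Q s]) [set w | smp w = s]); last first.
  apply/seteqP; split=> w /=; first by move=> h; exists (smp w).
  by case=> s /= Qs ->.
rewrite measure_fin_bigcup //; first last.
- by move=> s _; exact: (smp_measurable (fun t => t = s)).
- by move=> s t _ _ [w [/= <- <-]].
  exact: finite_finset.
rewrite fsbig_mkcond (@fsbigE _ _ _ _ _ (enum {ffun X -> bool})) ?enum_uniq //; last first.
  by move=> s _; rewrite mem_enum.
rewrite (eq_bigl xpredT) => [|s]; last by rewrite in_setT.
rewrite big_enum /= /Ex -sumEFin; apply: eq_bigr => s _.
rewrite /patch; case: ifPn => Qs.
  by rewrite smp_law (asboolT (set_mem Qs)) mulr1.
by rewrite asboolF ?mulr0 // => Q'; case/negP: Qs; rewrite inE.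
Qed.

End law.

(** * Probabilities of local events *)

Definition inbox (r : nat) (e : edge_t) : bool := (`|e.1.1| <= r)%N && (`|e.1.2| <= r)%N.

(** The converse implication follows by exchanging [c] and [c']. *)
Definition supp (S : edge_t -> Prop) (A : cfg -> Prop) :=
  forall c c', (forall e, S e -> c e = c' e) -> A c -> A c'.

Definition local (A : cfg -> Prop) := exists r, supp (inbox r) A.

Definition incE (A : cfg -> Prop) := forall c c' : cfg, (forall e, c e -> c' e) -> A c -> A c'.
Definition decE (A : cfg -> Prop) := forall c c' : cfg, (forall e, c e -> c' e) -> A c' -> A c.

Lemma supp_sub (S S' : edge_t -> Prop) A : (forall e, S e -> S' e) -> supp S A -> supp S' A.
Proof. by move=> SS sA c c' h; apply: sA => e /SS; exact: h. Qed.

Lemma supp_iff S A c c' : supp S A -> (forall e, S e -> c e = c' e) -> A c <-> A c'.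
Proof. by move=> sA h; split; apply: sA => // e /h. Qed.

Lemma inbox_le r r' e : (r <= r')%N -> inbox r e -> inbox r' e.
Proof. by rewrite /inbox => rr /andP[h1 h2]; rewrite !(leq_trans _ rr). Qed.

Lemma local_le r A : supp (inbox r) A -> forall r', (r <= r')%N -> supp (inbox r') A.
Proof. by move=> sA r' rr; apply: supp_sub sA => e; exact: inbox_le. Qed.

Lemma local2 A B : local A -> local B -> exists r, supp (inbox r) A /\ supp (inbox r) B.
Proof.
move=> [a sA] [b sB]; exists (maxn a b).
by split; [apply: (local_le sA)|apply: (local_le sB)]; rewrite ?leq_maxl ?leq_maxr.
Qed.

Lemma suppI S A B : supp S A -> supp S B -> supp S (fun c => A c /\ B c).
Proof. by move=> sA sB c c' h [a b]; split; [exact: sA h a|exact: sB h b]. Qed.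

Lemma suppC S A : supp S A -> supp S (fun c => ~ A c).
Proof. by move=> sA c c' h nA A'; apply/nA/(sA c') => // e /h. Qed.

Lemma localI A B : local A -> local B -> local (fun c => A c /\ B c).
Proof. by move=> lA lB; have [r [sA sB]] := local2 lA lB; exists r; exact: suppI. Qed.

Lemma localC A : local A -> local (fun c => ~ A c).
Proof. by move=> [r /suppC]; exists r. Qed.

Lemma localU A B : local A -> local B -> local (fun c => A c \/ B c).
Proof.
move=> lA lB; have [r [sA sB]] := local2 lA lB; exists r => c c' h.
by case=> ?; [left; apply: sA h _|right; apply: sB h _].
Qed.

Section ext.
Variables (X : finType) (io : X -> edge_t).
Hypothesis io_inj : injective io.

Definition ext (s : {ffun X -> bool}) : cfg :=
  fun e => if [pick x | io x == e] is Some x then s x else false.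

Lemma extE s x : ext s (io x) = s x.
Proof. by rewrite /ext; case: pickP => [y /eqP/io_inj -> //|/(_ x)]; rewrite eqxx. Qed.

Lemma ext_mono (s t : {ffun X -> bool}) e : (forall x, s x -> t x) -> ext s e -> ext t e.
Proof. by rewrite /ext => st; case: pickP => // x _; exact: st. Qed.

Lemma ext_smp A w : supp (fun e => exists x, e = io x) A -> A (cfg_of w) <-> A (ext (smp io w)).
Proof. by move=> sA; apply: (supp_iff sA) => e [x ->]; rewrite extE ffunE. Qed.

End ext.

Definition boxX r : finType := ('I_(2 * r + 1) * 'I_(2 * r + 1) * bool)%type.
Definition boxio r (x : boxX r) : edge_t :=
  ((Posz x.1.1 - Posz r, Posz x.1.2 - Posz r), x.2).

Lemma boxio_inj r : injective (@boxio r).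
Proof.
move=> [[i j] d] [[i' j'] d'] [] /= h1 h2 ->.
by congr (_, _, _); apply/val_inj => /=; lia.
Qed.

Lemma boxio_range r e : inbox r e -> exists x, e = @boxio r x.
Proof.
case: e => -[a b] d /andP[/= ha hb].
have h1 : (absz (a + Posz r)%R < 2 * r + 1)%N by lia.
have h2 : (absz (b + Posz r)%R < 2 * r + 1)%N by lia.
exists ((Ordinal h1, Ordinal h2), d); rewrite /boxio /=.
by f_equal; f_equal; lia.
Qed.

Section prb.
Variables (R : realType) (P : R -> probability config R).
Hypothesis hP : forall p : R, 0 <= p <= 1 -> bernoulli_percolation p (P p).
Implicit Types (p : R) (A B : cfg -> Prop).

Definition prb p A : R := fine (P p [set w | A (cfg_of w)]).

Definition ind (X : finType) (io : X -> edge_t) A (s : {ffun X -> bool}) : R := (`[< A (ext io s) >])%:R.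
Arguments ind : clear implicits.

(** An event supported by finitely many edges has the probability of its indicator on the finite
    cube, so that inequalities proved there apply to it. *)
Lemma prb_Ex p (X : finType) (io : X -> edge_t) A : 0 <= p <= 1 -> injective io ->
  supp (fun e => exists x, e = io x) A -> prb p A = Ex p (ind _ io A).
Proof.
move=> p01 ii sA; have h := mu_smp (hP p01) ii (fun s => A (ext io s)).
rewrite /prb (_ : [set w | _] = [set w | A (ext io (smp io w))]) ?h //.
by apply/seteqP; split => w /= /(ext_smp ii w sA).
Qed.

Lemma local_measurable A : local A -> measurable [set w | A (cfg_of w)].
Proof.
move=> [r sA]; have sA' := supp_sub (@boxio_range r) sA.
rewrite (_ : [set w | _] = [set w | A (ext (@boxio r) (smp (@boxio r) w))]).
  exact: (smp_measurable (@boxio r) (fun s => A (ext (@boxio r) s))).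
by apply/seteqP; split => w /= /(ext_smp (@boxio_inj r) w sA').
Qed.

Lemma prbK p A : local A -> P p [set w | A (cfg_of w)] = (prb p A)%:E.
Proof. by move=> lA; rewrite /prb fineK // fin_num_measure //; exact: local_measurable. Qed.

Lemma prb_ge0 p A : 0 <= prb p A.
Proof. by rewrite fine_ge0. Qed.

Lemma prb_le1 p A : local A -> prb p A <= 1.
Proof. by move=> lA; rewrite -lee_fin -prbK // probability_le1 //; exact: local_measurable. Qed.

Lemma prb_mono p A B : local A -> local B -> (forall c, A c -> B c) -> prb p A <= prb p B.
Proof.
move=> lA lB AB; rewrite -lee_fin -!prbK //; apply: le_measure; rewrite ?inE; try exact: local_measurable.
by move=> w /=; exact: AB.
Qed.

Lemma prb_ext p A B : (forall c, A c <-> B c) -> prb p A = prb p B.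
Proof. by move=> AB; rewrite /prb; congr (fine (P p _)); apply/seteqP; split=> w /= /AB. Qed.

Lemma prbC p A : local A -> prb p (fun c => ~ A c) = 1 - prb p A.
Proof.
move=> lA; apply: EFin_inj; rewrite -prbK ?EFinB -?prbK //; last exact: localC.
by rewrite -probability_setC //; exact: local_measurable.
Qed.

Lemma indI (X : finType) (io : X -> edge_t) A B s :
  ind X io (fun c => A c /\ B c) s = ind _ io A s * ind _ io B s.
Proof.
rewrite /ind -natrM mulnb; congr (_%:R : R); congr nat_of_bool.
by apply/asboolP/andP => -[/asboolP a /asboolP b].
Qed.

Lemma ind_incr (X : finType) (io : X -> edge_t) A : incE A -> incr (ind X io A).
Proof.
move=> iA s t st; rewrite /ind ler_nat.
case: asboolP => // a; rewrite asboolT //; apply: iA a => e; exact: ext_mono.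
Qed.

Lemma prb_harris p A B : 0 <= p <= 1 -> local A -> local B -> incE A -> incE B ->
  prb p A * prb p B <= prb p (fun c => A c /\ B c).
Proof.
move=> p01 lA lB iA iB; have [r [sA sB]] := local2 lA lB.
have sE := fun A => supp_sub (A := A) (@boxio_range r).
rewrite !(prb_Ex p01 (@boxio_inj r)); try by apply: sE => //; exact: suppI.
rewrite (Ex_eq p (indI (@boxio r) A B)).
by apply: harris => //; exact: ind_incr.
Qed.

Lemma prbU_ge p A B : local A -> local B ->
  prb p A + prb p B - prb p (fun c => A c /\ B c) = prb p (fun c => A c \/ B c).
Proof.
move=> lA lB; apply: EFin_inj; rewrite EFinB EFinD -!prbK //; last 2 first.
- exact: localU.
- exact: localI.
rewrite (_ : [set w | A (cfg_of w) \/ B (cfg_of w)] =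
  [set w | A (cfg_of w)] `|` [set w | B (cfg_of w)]) // measureUfinl //; try exact: local_measurable.
by rewrite ltey_eq fin_num_measure //; exact: local_measurable.
Qed.

Lemma prb_harris_dec p A B : 0 <= p <= 1 -> local A -> local B -> decE A -> decE B ->
  prb p A * prb p B <= prb p (fun c => A c /\ B c).
Proof.
move=> p01 lA lB dA dB.
have lA' := localC lA; have lB' := localC lB.
have h := @prb_harris p _ _ p01 lA' lB'.
have {}h := h (fun c c' cc nA => contra_not (dA c c' cc) nA) (fun c c' cc nB => contra_not (dB c c' cc) nB).
have e := prbU_ge p lA lB.
have : prb p (fun c => ~ A c /\ ~ B c) = 1 - prb p (fun c => A c \/ B c).
  rewrite -prbC; last exact: localU.
  by apply: prb_ext => c; rewrite not_orE.
move=> e2; rewrite e2 !prbC // in h; move: h e; lra.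
Qed.

Lemma prb_union p A B : local A -> local B -> prb p (fun c => A c \/ B c) <= prb p A + prb p B.
Proof. by move=> lA lB; rewrite -prbU_ge //; have := prb_ge0 p (fun c => A c /\ B c); lra. Qed.

Lemma prb_indep p (S : pred edge_t) A B : 0 <= p <= 1 -> local A -> local B ->
  supp S A -> supp (fun e => ~~ S e) B ->
  prb p (fun c => A c /\ B c) = prb p A * prb p B.
Proof.
move=> p01 lA lB SA SB; have [r [sA sB]] := local2 lA lB.
have sE := fun A => supp_sub (A := A) (@boxio_range r).
rewrite !(prb_Ex p01 (@boxio_inj r)); try by apply: sE => //; exact: suppI.
rewrite (Ex_eq p (indI (@boxio r) A B)).
apply: (@Ex_indep _ _ _ (fun x => S (boxio x))) => x Sx s b.
  rewrite /ind; congr (nat_of_bool _)%:R; apply: asbool_equiv_eq; apply: (supp_iff SB) => e nS.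
  rewrite /ext; case: pickP => // y /eqP ye; rewrite ffunE; case: eqP => // yx.
  by move: nS; rewrite -ye yx Sx.
rewrite /ind; congr (nat_of_bool _)%:R; apply: asbool_equiv_eq; apply: (supp_iff SA) => e eS.
rewrite /ext; case: pickP => // y /eqP ye; rewrite ffunE; case: eqP => // yx.
by move: Sx; rewrite -yx ye eS.
Qed.

(** The image of independent variables under a permutation of the edges has the same law. *)
Lemma prb_bij p A (sg : edge_t -> edge_t) : 0 <= p <= 1 -> injective sg -> local A ->
  prb p (fun c => A (fun e => c (sg e))) = prb p A.
Proof.
move=> p01 si [r sA]; have ii := @boxio_inj r.
have ii' : injective (fun x => sg (@boxio r x)) by apply: inj_comp.
rewrite (prb_Ex p01 ii (supp_sub (@boxio_range r) sA)).
rewrite (prb_Ex p01 ii'); last first.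
  by move=> c c' h; apply: sA => e /boxio_range[x ->]; apply: h; exists x.
apply: Ex_eq => s; rewrite /ind; congr (nat_of_bool _)%:R; apply: asbool_equiv_eq.
by apply: (supp_iff sA) => e /boxio_range[x ->]; rewrite (extE ii) (extE ii').
Qed.

(** Exchanging open and closed edges exchanges [p] and [1 - p]; decreasing events become
    increasing ones. *)
Lemma prb_neg p A : 0 <= p <= 1 -> local A ->
  prb (1 - p) (fun c => A (fun e => ~~ c e)) = prb p A.
Proof.
move=> p01 [r sA]; have ii := @boxio_inj r.
have sA' := supp_sub (@boxio_range r) sA.
rewrite (prb_Ex p01 ii sA') (prb_Ex _ ii); first last.
- by move=> c c' h; apply: sA' => e he; rewrite h.
- by lra.
pose ng (s : {ffun boxX r -> bool}) : {ffun boxX r -> bool} := [ffun x => ~~ s x].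
have ngK : cancel ng ng by move=> s; apply/ffunP => x; rewrite !ffunE negbK.
rewrite /Ex (reindex_onto ng ng) //=; apply: eq_big => s; first by rewrite ngK eqxx.
move=> _; congr (_ * _).
  by apply: eq_bigr => x _; rewrite ffunE; case: (s x) => //=; ring.
rewrite /ind; congr (nat_of_bool _)%:R; apply: asbool_equiv_eq.
by apply: (supp_iff sA') => e [x ->]; rewrite !(extE ii) ffunE negbK.
Qed.

End prb.

(** * Sharp thresholds for translates of a local event *)

Definition shE (v : pt) (e : edge_t) : edge_t := ((e.1.1 + v.1, e.1.2 + v.2), e.2).

Definition window (n : nat) (B : cfg -> Prop) (c : cfg) : Prop :=
  exists v : pt, [/\ (`|v.1| <= n)%N, (`|v.2| <= n)%N & B (fun e => c (shE v e))].

Lemma window_supp n r B : supp (inbox r) B -> supp (inbox (n + r)) (window n B).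
Proof.
move=> sB c c' h [v [v1 v2 b]]; exists v; split=> //; apply: sB b => e; rewrite /inbox => /andP[e1 e2].
by apply: h; rewrite /inbox /shE /=; lia.
Qed.

Lemma window_inc n B : incE B -> incE (window n B).
Proof. by move=> iB c c' h [v [v1 v2 b]]; exists v; split=> //; apply: iB b => e; exact: h. Qed.

Lemma harris_dec (R : realType) (X : finType) (p : R) (f g : {ffun X -> bool} -> R) :
  0 <= p <= 1 -> incr (fun x => - f x) -> incr (fun x => - g x) ->
  Ex p f * Ex p g <= Ex p (fun x => f x * g x).
Proof.
move=> p01 fi gi; have := harris p01 fi gi; rewrite !ExN mulrNN => h; apply: le_trans h _.
by rewrite (@Ex_eq _ _ _ _ (fun x => f x * g x)) // => x; rewrite mulrNN.
Qed.

Lemma harris_prod (R : realType) (X I : finType) (p : R) (f : I -> {ffun X -> bool} -> R) :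
  0 <= p <= 1 -> (forall i, incr (fun x => - f i x)) -> (forall i x, 0 <= f i x) ->
  \prod_i Ex p (f i) <= Ex p (fun x => \prod_i f i x).
Proof.
move=> p01 fi f0; rewrite -big_enum (@Ex_eq _ _ _ _ (fun x => \prod_(i <- enum I) f i x)); last first.
  by move=> x; rewrite big_enum.
elim: (enum I) => [|i l IH].
  by rewrite big_nil (@Ex_eq _ _ _ _ (fun=> 1)) ?Ex_cst // => x; rewrite big_nil.
have E x : \prod_(j <- i :: l) f j x = f i x * \prod_(j <- l) f j x by rewrite big_cons.
rewrite big_cons (Ex_eq p E) /=.
have F0 x : 0 <= \prod_(i <- l) f i x by apply: prodr_ge0.
apply: le_trans (harris_dec p01 (fi i) _).
  by rewrite ler_wpM2l //; apply: Ex_ge0.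
move=> x y xy; rewrite lerN2; elim: l {IH F0 E} => [|j l IH]; first by rewrite !big_nil.
rewrite !big_cons; apply: ler_pM => //; first by apply: prodr_ge0.
by have := fi j x y xy; rewrite lerN2.
Qed.

Section torus.
Variables (R : realType) (l : nat).
Let L := l.+1.
Definition torX : finType := ('I_L * 'I_L * bool)%type.
(** The reduction of a coordinate modulo the side of the torus, as the image of the integer under
    the ring morphism to the residues, so that it is additive. *)
Definition tmod (a : int) : 'I_L := (inZp 1 : 'I_L) *~ a.

Lemma tmodn (n : nat) : val (tmod n) = (n %% L)%N.
Proof. by rewrite /tmod -pmulrn Zp_mulrn /= modnMml mul1n. Qed.

Lemma tmodD a b : tmod (a + b) = tmod a + tmod b.
Proof. by rewrite /tmod mulrzDr. Qed.

Lemma tmodN a : tmod (- a) = - tmod a.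
Proof. by rewrite /tmod mulrNz. Qed.

Lemma tmodK (i : 'I_L) : tmod (Posz i) = i.
Proof. by apply/val_inj; rewrite tmodn modn_small. Qed.

Lemma tmodL : tmod L = 0.
Proof. by apply/val_inj; rewrite tmodn modnn. Qed.

Definition per (s : {ffun torX -> bool}) : cfg := fun e => s ((tmod e.1.1, tmod e.1.2), e.2).
Definition trT (u : pt) (s : {ffun torX -> bool}) : {ffun torX -> bool} :=
  [ffun x => s ((x.1.1 + tmod u.1, x.1.2 + tmod u.2), x.2)].

Lemma per_trT u s e : per (trT u s) e = per s (shE u e).
Proof. by rewrite /per ffunE /shE /= !tmodD. Qed.

Lemma trTK u : cancel (trT u) (trT (- u.1, - u.2)).
Proof. by move=> s; apply/ffunP => -[[i j] d]; rewrite !ffunE /= !tmodN !addrNK. Qed.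

Lemma trTK' u : cancel (trT (- u.1, - u.2)) (trT u).
Proof. by move=> s; apply/ffunP => -[[i j] d]; rewrite !ffunE /= !tmodN !addrK. Qed.

Definition mvX (u : pt) (x : torX) : torX := ((x.1.1 + tmod u.1, x.1.2 + tmod u.2), x.2).

Lemma mvX_inj u : injective (mvX u).
Proof.
apply: (@can_inj _ _ _ (mvX (- u.1, - u.2))) => -[[i j] d].
by rewrite /mvX /= !tmodN !addrK.
Qed.

Lemma Ex_trT (p : R) u f : Ex p (fun s => f (trT u s)) = Ex p f.
Proof.
rewrite /Ex [RHS](reindex_onto (trT u) (trT (- u.1, - u.2))) /=; last by move=> s _; exact: trTK'.
apply: eq_big => s; first by rewrite trTK eqxx.
move=> _; congr (_ * _); rewrite /wt [LHS](reindex_onto (mvX u) (mvX (- u.1, - u.2))) /=; last first.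
  by move=> [[i j] d] _; rewrite /mvX /= !tmodN !addrNK.
apply: eq_big => -[[i j] d]; first by rewrite /mvX /= !tmodN !addrK eqxx.
by move=> _; rewrite ffunE.
Qed.

Lemma upd_trT u s x b : upd (trT u s) x b = trT u (upd s (mvX u x) b).
Proof.
apply/ffunP => y; rewrite !ffunE -(inj_eq (@mvX_inj u)).
by case: y => -[i j] d; case: x => -[i' j'] d'.
Qed.

(** The translations of the torus permute the edges of one direction transitively, so that at
    least [L ^ 2] edges have the same influence as [x]. *)
Lemma invariant_influence (p : R) f x : 0 <= p <= 1 -> incr f -> (forall u s, f (trT u s) = f s) ->
  L%:R ^+ 2 * Ex p (De x f) <= \sum_y Ex p (De y f).
Proof.
move=> p01 fi finv.
have I0 y : 0 <= Ex p (De y f) by apply: Ex_ge0 => // s; exact: incr_De.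
have E u : Ex p (De (mvX u x) f) = Ex p (De x f).
  by rewrite -(Ex_trT p u (De x f)); apply: Ex_eq => s; rewrite /De !upd_trT !finv.
rewrite (bigID (fun y : torX => y.2 == x.2)) /= ler_wpDr ?sumr_ge0 //.
rewrite (reindex_onto (fun i : 'I_L * 'I_L => (i, x.2)) (fun y => y.1)) /=; last first.
  by move=> -[i d] /= /eqP ->.
rewrite (eq_bigl xpredT) => [|[i j]]; last by rewrite !eqxx.
rewrite (eq_bigr (fun=> Ex p (De x f))).
  by rewrite sumr_const card_prod card_ord -[leRHS]mulr_natl natrM expr2.
move=> [i j] _; rewrite -(E (Posz i - Posz x.1.1, Posz j - Posz x.1.2)) /mvX /=.
by rewrite !tmodD !tmodN !tmodK !(addrC _ (_ - _)) !addrNK.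
Qed.

Definition trep N (i : 'I_L) : int := if (i <= N)%N then Posz i else Posz i - Posz L.
Definition torio N (x : torX) : edge_t := ((trep N x.1.1, trep N x.1.2), x.2).

Lemma trepK N i : tmod (trep N i) = i.
Proof. by rewrite /trep; case: ifP => _; rewrite ?tmodD ?tmodN ?tmodL ?subr0 tmodK. Qed.

Lemma torio_inj N : injective (torio N).
Proof. by move=> [[i j] d] [[i' j'] d'] [] /(can_inj (@trepK N)) -> /(can_inj (@trepK N)) -> ->. Qed.

Lemma tmodrep N (a : int) : (2 * N + 1 <= L)%N -> (`|a| <= N)%N -> trep N (tmod a) = a.
Proof.
move=> NL; case: a => n /= hn.
  by rewrite /trep tmodn modn_small ?hn //; lia.
have -> : tmod (Negz n) = tmod (Posz (L - n.+1)%N).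
  have -> : Posz (L - n.+1)%N = Posz L + Negz n by lia.
  by rewrite tmodD tmodL add0r.
rewrite /trep tmodn modn_small; last by lia.
by case: ifP; lia.
Qed.

Variables (P : R -> probability config R).
Hypothesis hP : forall p : R, 0 <= p <= 1 -> bernoulli_percolation p (P p).

(** A torus that is larger than the support of [A] is indistinguishable from the lattice for [A]. *)
Lemma prb_torus p A N : 0 <= p <= 1 -> (2 * N + 1 <= L)%N -> supp (inbox N) A ->
  prb P p A = Ex p (fun s => (`[< A (per s) >])%:R).
Proof.
move=> p01 NL sA.
have sA' : supp (fun e => exists x, e = torio N x) A.
  apply: supp_sub sA => -[[a b] d] /andP[/= ha hb]; exists ((tmod a, tmod b), d).
  by rewrite /torio /= !tmodrep.
rewrite (prb_Ex hP p01 (@torio_inj N) sA'); apply: Ex_eq => s; rewrite /ind.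
congr (nat_of_bool _)%:R; apply: asbool_equiv_eq; apply: (supp_iff sA') => e [x ->].
by rewrite (extE (@torio_inj N)) /per /torio /= !trepK; case: x => -[].
Qed.

(** A sharp threshold for translates of a local event. On the torus of side [L], the event [F]
    that some translate of [B] occurs is invariant, so its probability obeys [sharp_threshold]
    with all influences equal up to a factor. It contains the window event. Conversely, [M ^ 2]
    translates of the window cover the torus, so that the complement of [F] is an intersection of
    [M ^ 2] decreasing events of the same probability, and the Harris inequality bounds its
    probability from below by a power. *)
Lemma amp_torus (p1 p2 : R) B n r M : 0 <= p1 -> p1 <= p2 -> p2 <= 1 -> incE B -> supp (inbox r) B ->
  (2 * (n + r) + 1 <= L)%N -> (L <= M * (2 * n + 1))%N ->
  prb P p1 (window n B) * (1 - prb P p2 (window n B)) ^+ (M ^ 2)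
    <= expR (- (p2 - p1) / 3 * ln L%:R).
Proof.
move=> p10 p12 p21 iB sB hL hM.
pose F (s : {ffun torX -> bool}) := exists v : pt, B (fun e => per s (shE v e)).
pose f s : R := (`[< F s >])%:R.
have fi : incr f.
  move=> s t st; rewrite /f ler_nat; case: asboolP => // -[v b].
  by rewrite asboolT //; exists v; apply: iB b => e; exact: st.
have fb s : f s = 0 \/ f s = 1 by rewrite /f; case: asboolP; [right|left].
have finv u s : f (trT u s) = f s.
  rewrite /f; congr (nat_of_bool _)%:R; apply: asbool_equiv_eq; split=> -[v b].
    exists (v.1 + u.1, v.2 + u.2); congr (B _): b; apply/funext => e; rewrite per_trT.
    by rewrite /shE /= !addrA.
  exists (v.1 - u.1, v.2 - u.2); congr (B _): b; apply/funext => e; rewrite per_trT.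
  by rewrite /shE /= !addrA !addrNK.
have p1i : 0 <= p1 <= 1 by lra.
have p2i : 0 <= p2 <= 1 by lra.
have sW : supp (inbox (n + r)) (window n B) by exact: window_supp.
pose g s : R := (`[< window n B (per s) >])%:R.
have st := @sharp_threshold R torX f L%:R p1 p2 p10 p12 p21 _ fi fb _.
apply: le_trans (st _ _); last 2 first.
- by rewrite ler1n.
- by move=> p e p01; exact: invariant_influence.
have lW : local (window n B) by exists (n + r)%N.
apply: ler_pM; rewrite ?prb_ge0 ?exprn_ge0 ?subr_ge0 ?prb_le1 //.
  rewrite (prb_torus p1i hL sW); apply: Ex_le => // s; rewrite ler_nat.
  by case: asboolP => // -[v [_ _ b]]; rewrite asboolT //; exists v.
rewrite (prb_torus p2i hL sW) -/g.
(* The centres of [M ^ 2] windows whose union is the whole torus. *)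
pose ctr (ij : 'I_M * 'I_M) : pt := (Posz (ij.1 * (2 * n + 1) + n), Posz (ij.2 * (2 * n + 1) + n)).
have -> : 1 - Ex p2 f = Ex p2 (fun s => 1 - f s) by rewrite ExB Ex_cst.
apply: (@le_trans _ _ (Ex p2 (fun s => \prod_ij (1 - g (trT (ctr ij) s))))).
  apply: le_trans (harris_prod _ _ _) => //.
  - rewrite (eq_bigr (fun=> 1 - Ex p2 g)).
      by rewrite prodr_const card_prod card_ord.
    by move=> ij _; rewrite ExB Ex_cst (Ex_trT p2 (ctr ij) g).
  - move=> ij s t sst; rewrite lerN2 lerD2l lerN2 /g ler_nat.
    case: asboolP => // w; rewrite asboolT //; apply: (window_inc iB) w => e.
    by rewrite !per_trT; exact: sst.
  - by move=> ij s; rewrite subr_ge0 /g; case: asboolP.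
apply: Ex_le => // s; rewrite {1}/f; case: asboolP => [[v b]|_]; last first.
  rewrite subr0; apply: prodr_ile1 => ij _.
  by rewrite /g; case: asboolP => _; rewrite ?subrr ?subr0 ?lexx ?ler01.
rewrite subrr.
(* A translation vector lies in one of these windows, as division with remainder shows in each
   coordinate. *)
have [i [i0 iE]] : exists i : 'I_M, exists a : int, (`|a| <= n)%N /\ tmod v.1 = tmod (Posz (i * (2 * n + 1) + n) + a).
  have h : (tmod v.1 %/ (2 * n + 1) < M)%N.
    by rewrite ltn_divLR ?addn1 // (leq_trans (ltn_ord _)) // -addn1.
  exists (Ordinal h), (Posz (tmod v.1 %% (2 * n + 1)) - Posz n) => /=; split.
    by have := ltn_pmod (tmod v.1) (ltac:(lia) : (0 < 2 * n + 1)%N); lia.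
  rewrite -[LHS]tmodK; congr tmod; have := divn_eq (tmod v.1) (2 * n + 1); lia.
have [j [j0 jE]] : exists i : 'I_M, exists a : int, (`|a| <= n)%N /\ tmod v.2 = tmod (Posz (i * (2 * n + 1) + n) + a).
  have h : (tmod v.2 %/ (2 * n + 1) < M)%N.
    by rewrite ltn_divLR ?addn1 // (leq_trans (ltn_ord _)) // -addn1.
  exists (Ordinal h), (Posz (tmod v.2 %% (2 * n + 1)) - Posz n) => /=; split.
    by have := ltn_pmod (tmod v.2) (ltac:(lia) : (0 < 2 * n + 1)%N); lia.
  rewrite -[LHS]tmodK; congr tmod; have := divn_eq (tmod v.2) (2 * n + 1); lia.
rewrite (bigD1 (i, j)) //= {1}/g asboolT ?subrr ?mul0r //.
exists (i0, j0); case: iE => iE1 iE2; case: jE => jE1 jE2; split => //.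
congr (B _): b; apply/funext => e; rewrite per_trT /per /shE /=.
by rewrite -!addrA !tmodD iE2 jE2 !tmodD !(addrC (tmod i0)) !(addrC (tmod j0)).
Qed.

End torus.

(** * Crossings, squares and their large clusters *)

(** The sets of edges of enhanced graphs; unlike bond configurations, they are not decidable. *)
Definition econf := edge_t -> Prop.

Definition rp (x : pt) : pt := (- x.2, x.1).
(** The rotation by a quarter turn about the origin. *)
Definition rotE (e : edge_t) : edge_t :=
  if e.2 then ((- e.1.2 - 1, e.1.1), false) else (rp e.1, true).

Definition sqball (r : nat) (z : pt) : Prop := (`|z.1| <= r)%N /\ (`|z.2| <= r)%N.

(** One implication expresses both that [F] is increasing and that it depends only on the edges
    of a box. *)
Definition good (F : econf -> Prop) := exists r : nat, forall zt zt' : econf,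
  (forall e, inbox r e -> zt e -> zt' e) -> F zt -> F zt'.

Lemma good_and F G : good F -> good G -> good (fun zt => F zt /\ G zt).
Proof.
move=> [r hF] [r' hG]; exists (maxn r r') => zt zt' h [f g]; split.
  by apply: hF f => e /(inbox_le (leq_maxl r r')); exact: h.
by apply: hG g => e /(inbox_le (leq_maxr r r')); exact: h.
Qed.

Lemma good_or F G : good F -> good G -> good (fun zt => F zt \/ G zt).
Proof.
move=> [r hF] [r' hG]; exists (maxn r r') => zt zt' h [f|g]; [left|right].
  by apply: hF f => e /(inbox_le (leq_maxl r r')); exact: h.
by apply: hG g => e /(inbox_le (leq_maxr r r')); exact: h.
Qed.

Lemma conn_mono (r : nat) (zt zt' : econf) B x y :
  (forall e, inbox r e -> zt e -> zt' e) -> (forall z, B z -> sqball r z) ->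
  conn (link zt) B x y -> conn (link zt') B x y.
Proof.
move=> h hB; apply: (@conn_sub _ _ _ _ id) => // u v /hB[u1 u2] /hB[v1 v2].
by case=> -[E z]; [apply: Or41|apply: Or42|apply: Or43|apply: Or44]; split=> //; apply: h z;
  apply/andP.
Qed.

Lemma link_shift zt v x y : link (fun e => zt (shE v e)) x y ->
  link zt (x.1 + v.1, x.2 + v.2) (y.1 + v.1, y.2 + v.2).
Proof.
by case: x y => [x1 x2] [y1 y2]; case=> -[[/= -> ->] z];
  [apply: Or41|apply: Or42|apply: Or43|apply: Or44]; split=> //=; f_equal; lia.
Qed.

Lemma link_rot zt x y : link (fun e => zt (rotE e)) x y -> link zt (rp x) (rp y).
Proof.
case: x y => [x1 x2] [y1 y2]; rewrite /rotE /rp; case=> -[[/= e1 e2] z]; subst.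
- by apply: Or43.
- by apply: Or44.
- by apply: Or42; split => /=; [f_equal; lia|congr zt: z; f_equal; f_equal; lia].
- by apply: Or41; split => /=; [f_equal; lia|congr zt: z; f_equal; f_equal; lia].
Qed.

Lemma conn_shift zt v B B' x y : (forall z : pt, B z -> B' (z.1 + v.1, z.2 + v.2)) ->
  conn (link (fun e => zt (shE v e))) B x y ->
  conn (link zt) B' (x.1 + v.1, x.2 + v.2) (y.1 + v.1, y.2 + v.2).
Proof.
by move=> h; apply: (@conn_sub _ _ _ _ (fun z : pt => (z.1 + v.1, z.2 + v.2))) => // a b _ _;
  exact: link_shift.
Qed.

Lemma conn_rot zt B B' x y : (forall z, B z -> B' (rp z)) ->
  conn (link (fun e => zt (rotE e))) B x y -> conn (link zt) B' (rp x) (rp y).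
Proof. by move=> h; apply: (@conn_sub _ _ _ _ rp) => // a b _ _; exact: link_rot. Qed.

Lemma conn_linkS zt B x y : conn (link zt) B x y -> conn (link zt) B y x.
Proof. by apply: conn_sym => u v; exact: link_sym. Qed.

Definition hcross (N : nat) (z : pt) (zt : econf) := exists l r : pt,
  [/\ l.1 = z.1 - N%:Z, r.1 = z.1 + N%:Z & conn (link zt) (inQ N z) l r].
Definition vcross (N : nat) (z : pt) (zt : econf) := exists b t : pt,
  [/\ b.2 = z.2 - N%:Z, t.2 = z.2 + N%:Z & conn (link zt) (inQ N z) b t].

Definition land (N : nat) (z : pt) (a b : int) (zt : econf) := exists l r : pt,
  [/\ l.1 = z.1 - N%:Z, r.1 = z.1 + N%:Z, a <= r.2 <= b & conn (link zt) (inQ N z) l r].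

(** By planarity a square contains at most one cluster that reaches all four sides
    ([big_unique]), so that two squares can be linked unambiguously. *)
Definition big (N : nat) (z : pt) (zt : econf) (x : pt) :=
  [/\ exists2 l : pt, l.1 = z.1 - N%:Z & conn (link zt) (inQ N z) x l,
      exists2 r : pt, r.1 = z.1 + N%:Z & conn (link zt) (inQ N z) x r,
      exists2 b : pt, b.2 = z.2 - N%:Z & conn (link zt) (inQ N z) x b &
      exists2 t : pt, t.2 = z.2 + N%:Z & conn (link zt) (inQ N z) x t].

Definition linked (N N' : nat) (z z' : pt) (zt : econf) :=
  exists x, big N z zt x /\ big N' z' zt x.

(** The numbers [160 * n] and [8 * n], with which this is used, leave room for the chains of
    squares of radius [n] in [chain_steps]. *)
Definition hrect (a b : nat) (zt : econf) := exists l r : pt,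
  [/\ l.1 = 0, r.1 = a & conn (link zt) (fun z : pt => 0 <= z.1 <= a%:Z /\ - b%:Z <= z.2 <= b%:Z) l r].

Lemma inQ_ball N z : exists r : nat, forall x, inQ (Posz N) z x -> sqball r x.
Proof. by exists (`|z.1| + `|z.2| + N)%N => x; rewrite /inQ /sqball; lia. Qed.

Lemma good_land N z a b : good (land N z a b).
Proof.
have [r hr] := inQ_ball N z; exists r => zt zt' h [x [y [E1 E2 E3 c]]].
by exists x, y; split=> //; exact: conn_mono h hr c.
Qed.

Lemma good_hcross N z : good (hcross N z).
Proof.
have [r hr] := inQ_ball N z; exists r => zt zt' h [x [y [E1 E2 c]]].
by exists x, y; split=> //; exact: conn_mono h hr c.
Qed.

Lemma good_vcross N z : good (vcross N z).
Proof.
have [r hr] := inQ_ball N z; exists r => zt zt' h [x [y [E1 E2 c]]].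
by exists x, y; split=> //; exact: conn_mono h hr c.
Qed.

Lemma good_linked N N' z z' : good (linked N N' z z').
Proof.
have [r hr] := inQ_ball N z; have [r' hr'] := inQ_ball N' z'.
exists (maxn r r') => zt zt' h [x [X X']]; exists x; split.
  have h1 e : inbox r e -> zt e -> zt' e by move/(inbox_le (leq_maxl r r')); exact: h.
  have cm := conn_mono h1 hr.
  by case: X => -[? ? /cm ?] [? ? /cm ?] [? ? /cm ?] [? ? /cm ?]; split; eexists; eauto.
have h1 e : inbox r' e -> zt e -> zt' e by move/(inbox_le (leq_maxr r r')); exact: h.
have cm := conn_mono h1 hr'.
by case: X' => -[? ? /cm ?] [? ? /cm ?] [? ? /cm ?] [? ? /cm ?]; split; eexists; eauto.
Qed.

Lemma good_hrect a b : good (hrect a b).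
Proof.
exists (a + b)%N => zt zt' h [x [y [E1 E2 c]]].
exists x, y; split=> //; apply: conn_mono h _ c => z; rewrite /sqball; lia.
Qed.

Lemma square_meet N z zt (l r b t : pt) : l.1 = z.1 - N%:Z -> r.1 = z.1 + N%:Z ->
  b.2 = z.2 - N%:Z -> t.2 = z.2 + N%:Z ->
  conn (link zt) (inQ N z) l r -> conn (link zt) (inQ N z) b t ->
  conn (link zt) (inQ N z) l b.
Proof.
move=> hl hr hb ht lr bt.
have [x [lx bx]] : exists x, conn (link zt) (inQ N z) l x /\ conn (link zt) (inQ N z) b x.
  apply: (meet_link lr bt (a := z.1 - N%:Z) (b := z.1 + N%:Z) (c := z.2 - N%:Z) (d := z.2 + N%:Z)); rewrite ?hl ?hr ?hb ?ht //.
  - by move=> x [].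
  - by move=> x [].
exact: conn_trans lx (conn_linkS bx).
Qed.

Lemma big_unique (N : nat) z zt x y : big N z zt x -> big N z zt y -> conn (link zt) (inQ N z) x y.
Proof.
move=> [[l hl xl] [r hr xr] _ _] [_ _ [b hb yb] [t ht yt]].
have lb := square_meet hl hr hb ht (conn_trans (conn_linkS xl) xr) (conn_trans (conn_linkS yb) yt).
exact: conn_trans xl (conn_trans lb (conn_linkS yb)).
Qed.

Lemma big_conn (N : nat) z zt x y : conn (link zt) (inQ N z) x y -> big N z zt x -> big N z zt y.
Proof.
move=> /conn_linkS yx [[l hl xl] [r hr xr] [b hb xb] [t ht xt]].
split; [exists l|exists r|exists b|exists t] => //; exact: conn_trans yx _.
Qed.

Lemma cross_big N z zt (l r : pt) : l.1 = z.1 - N%:Z -> r.1 = z.1 + N%:Z ->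
  conn (link zt) (inQ N z) l r -> vcross N z zt -> big N z zt r.
Proof.
move=> hl hr lr [b [t [hb ht bt]]].
have lb := square_meet hl hr hb ht lr bt; have rl := conn_linkS lr.
have rb := conn_trans rl lb.
split; [exists l|exists r|exists b|exists t] => //.
- exact: conn_trans rl lr.
- exact: conn_trans rb bt.
Qed.

Lemma column (B : pt -> Prop) (x a b : int) : a <= b -> (forall y, a <= y <= b -> B (x, y)) ->
  conn adjp B (x, a) (x, b).
Proof.
move=> ab; have -> : b = a + Posz (absz (b - a)) by lia.
elim: (absz (b - a)) => [|n IH] h.
  by rewrite addr0; apply: conn_refl; apply: h; lia.
apply: (@conn_step _ _ _ (x, a + n%:Z)); first by apply: IH => y hy; apply: h; lia.
  by rewrite /adjp /=; lia.
by apply: h; lia.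
Qed.

(** How two squares of different sizes are linked without any reflection symmetry. The small
    square lies against the right side of the large one, and its big cluster reaches that side at
    [b], below the interval between [j1] and [j2], and at [t], above it. So the crossing of the
    large square, which lands between [b] and [t], must meet the part of that cluster between [b]
    and [t]; both big clusters then have a common point. *)
Lemma landing_linked N1 N2 (y2 j1 j2 am ap : int) zt :
  (N2 <= N1)%N -> am + y2 <= j1 -> j2 <= ap + y2 ->
  land N1 (0, 0) j1 j2 zt -> vcross N1 (0, 0) zt ->
  (exists a, land N2 (N1%:Z - N2%:Z, y2) (ap + y2) a zt) ->
  (exists a, land N2 (N1%:Z - N2%:Z, y2) a (am + y2) zt) ->
  vcross N2 (N1%:Z - N2%:Z, y2) zt ->
  linked N1 N2 (0, 0) (N1%:Z - N2%:Z, y2) zt.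
Proof.
set z2 : pt := (N1%:Z - N2%:Z, y2) => N21 hj1 hj2 [l [r [/= hl hr hrj lr]]] V1.
move=> [a1 [l1 [t [/= hl1 ht tj lt]]]] [a2 [l2 [b [/= hl2 hb bj lb]]]] V2.
have bigr : big N1 (0, 0) zt r by exact: cross_big lr V1.
have bigt : big N2 z2 zt t by exact: cross_big lt V2.
have bigb : big N2 z2 zt b by exact: cross_big lb V2.
have bt := big_unique bigb bigt.
have hpt (x y : pt) : x.1 = y.1 -> x.2 = y.2 -> x = y by case: x y => [? ?] [? ?] /= -> ->.
have [E|rt] := eqVneq r.2 t.2.
  by exists r; split=> //; rewrite (hpt r t) //; lia.
have [E|rb] := eqVneq r.2 b.2.
  by exists r; split=> //; rewrite (hpt r b) //; lia.
have h1 : b.2 < r.2 < t.2 by lia.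
(* To apply [meet], the crossing is prolonged by one step beyond the right side, and the path
   from [b] to [t] by two vertical half-columns just beyond that side, down to the bottom and up
   to the top. *)
pose B1 z := conn (link zt) (inQ N1 (0, 0)) l z \/ z = (r.1 + 1, r.2).
pose B2 (z : pt) := conn (link zt) (inQ N2 z2) b z \/ z.1 = r.1 + 1 /\ (z.2 <= b.2 \/ t.2 <= z.2).
have c1 : conn adjp B1 l (r.1 + 1, r.2).
  apply: (@conn_step _ _ _ r); [|by rewrite /adjp /=; lia|by right].
  apply: (@conn_sub _ _ _ _ id) (conn_reach lr) => [u v _ _|u ?]; [exact: link_adjp|by left].
pose lo := Num.min b.2 (- N1%:Z); pose hi := Num.max t.2 N1%:Z.
have cb : conn adjp B2 (r.1 + 1, lo) (r.1 + 1, b.2).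
  by apply: column; [rewrite /lo; lia|move=> y hy; right; split => //; left => /=; lia].
have ct : conn adjp B2 (r.1 + 1, t.2) (r.1 + 1, hi).
  by apply: column; [rewrite /hi; lia|move=> y hy; right; split => //; right => /=; lia].
have cm : conn adjp B2 b t.
  apply: (@conn_sub _ _ _ _ id) (conn_reach bt) => [u v _ _|u ?]; [exact: link_adjp|by left].
have cA : conn adjp B2 (r.1 + 1, lo) b.
  apply: conn_step cb _ (conn_meml cm); rewrite /adjp /=; lia.
have cB : conn adjp B2 t (r.1 + 1, hi).
  apply: conn_trans ct; apply: (@conn_step _ _ _ t); first exact: conn_refl (conn_memr cm).
    by rewrite /adjp /=; lia.
  by right; split => //; right.
have c2 := conn_trans cA (conn_trans cm cB).
have [x [x1 x2]] : exists x, B1 x /\ B2 x.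
  apply: (meet c1 c2 (a := z2.1 - N2%:Z) (b := r.1 + 1) (c := - N1%:Z) (d := N1%:Z)) => /=.
  - by rewrite hl; lia.
  - by [].
  - move=> z [/conn_memr[/= _ ?]|->]; first by lia.
    by have [/= _] := conn_memr lr; lia.
  - move=> z [/conn_memr[/= ? _]|[-> _]]; lia.
  - by rewrite /lo; lia.
  - by rewrite /hi; lia.
case: x1 x2 => [lx|->]; last first.
  by case=> [/conn_memr[/= ? _]|[_ /= ?]]; exfalso; lia.
case=> [bx|[E _]]; last by have [/= ? _] := conn_memr lx; exfalso; lia.
exists x; split; last exact: big_conn bx bigb.
by apply: big_conn bigr; apply: conn_trans lx; exact: conn_linkS.
Qed.

(** * Long crossings from square crossings *)

(** What the construction of long crossings needs of a law: positive association of good events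
    and of their complements, and invariance under translations and rotations. Independence is
    absent, because the range of the enhancements grows with their scale; reflections are absent,
    because enhancements need not be symmetric. Both an enhanced graph and its dual satisfy these
    conditions ([primal_law], [dual_law]). *)
Record rsw_law (R : realType) (pr : (econf -> Prop) -> R) : Prop := RswLaw {
  rsw0 : pr (fun=> False) = 0;
  rsw1 : pr (fun=> True) = 1;
  rsw_mono : forall F G, good F -> good G -> (forall zt, F zt -> G zt) -> pr F <= pr G;
  rsw_and : forall F G, good F -> good G -> pr F * pr G <= pr (fun zt => F zt /\ G zt);
  rsw_or : forall F G, good F -> good G ->
    (1 - pr F) * (1 - pr G) <= 1 - pr (fun zt => F zt \/ G zt);
  rsw_shift : forall F v, good F -> pr (fun zt => F (fun e => zt (shE v e))) = pr F;
  rsw_rot : forall F, good F -> pr (fun zt => F (fun e => zt (rotE e))) = pr F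
}.

Lemma good_shift F v : good F -> good (fun zt => F (fun e => zt (shE v e))).
Proof.
move=> [r h]; exists (r + `|v.1| + `|v.2|)%N => zt zt' hz; apply: h => e he.
by apply: hz; move: he; rewrite /inbox /shE /=; lia.
Qed.

Lemma good_rot F : good F -> good (fun zt => F (fun e => zt (rotE e))).
Proof.
move=> [r h]; exists (r + 1)%N => zt zt' hz; apply: h => -[[a b] d] he.
by apply: hz; move: he; rewrite /inbox /rotE /rp /=; case: d => /=; lia.
Qed.

Lemma good_cst (Q : Prop) : good (fun=> Q).
Proof. by exists 0%N. Qed.

Lemma big_shift N z v zt x : big N z (fun e => zt (shE v e)) x ->
  big N (z.1 + v.1, z.2 + v.2) zt (x.1 + v.1, x.2 + v.2).
Proof.
have cs y y' := @conn_shift zt v (inQ N z) (inQ N (z.1 + v.1, z.2 + v.2)) y y'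
  (ltac:(rewrite /inQ /=; lia)).
move=> [[l hl /cs xl] [r hr /cs xr] [b hb /cs xb] [t ht /cs xt]].
split; [exists (l.1 + v.1, l.2 + v.2)|exists (r.1 + v.1, r.2 + v.2)|
  exists (b.1 + v.1, b.2 + v.2)|exists (t.1 + v.1, t.2 + v.2)] => //=; lia.
Qed.

Lemma inQ_rp N z x : inQ N z x -> inQ N (rp z) (rp x).
Proof. by rewrite /inQ /rp /=; lia. Qed.

Lemma big_rot N z zt x : big N z (fun e => zt (rotE e)) x -> big N (rp z) zt (rp x).
Proof.
have cs y y' := @conn_rot zt (inQ N z) (inQ N (rp z)) y y' (@inQ_rp N z).
move=> [[l hl /cs xl] [r hr /cs xr] [b hb /cs xb] [t ht /cs xt]].
split; [exists (rp t)|exists (rp b)|exists (rp l)|exists (rp r)] => //=; lia.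
Qed.

Section rsw.
Variables (R : realType) (pr : (econf -> Prop) -> R).
Hypothesis H : rsw_law pr.

Lemma rsw_ge0 F : good F -> 0 <= pr F.
Proof. by move=> gF; rewrite -(rsw0 H); apply: (rsw_mono H) => //; exact: good_cst. Qed.

Lemma rsw_le1 F : good F -> pr F <= 1.
Proof. by move=> gF; rewrite -(rsw1 H); apply: (rsw_mono H) => //; exact: good_cst. Qed.

Lemma rsw_none F : good F -> (forall zt, ~ F zt) -> pr F = 0.
Proof.
move=> gF nF; apply/eqP; rewrite eq_le rsw_ge0 // andbT -(rsw0 H).
by apply: (rsw_mono H) => //; exact: good_cst.
Qed.

Lemma rsw_le_shift F G v : good F -> good G -> (forall zt, F (fun e => zt (shE v e)) -> G zt) ->
  pr F <= pr G.
Proof. by move=> gF gG FG; rewrite -(rsw_shift H v gF); apply: (rsw_mono H) => //; exact: good_shift. Qed.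

Lemma rsw_le_rot F G : good F -> good G -> (forall zt, F (fun e => zt (rotE e)) -> G zt) ->
  pr F <= pr G.
Proof. by move=> gF gG FG; rewrite -(rsw_rot H gF); apply: (rsw_mono H) => //; exact: good_rot. Qed.

Lemma pr_vcross N z : pr (hcross N (0, 0)) <= pr (vcross N z).
Proof.
apply: (@le_trans _ _ (pr (vcross N (0, 0)))).
  apply: rsw_le_rot; [exact: good_hcross|exact: good_vcross|].
  move=> zt [l [r [/= hl hr lr]]]; exists (rp l), (rp r); split; rewrite /rp //=.
  by apply: conn_rot lr => y /inQ_rp; rewrite /rp /= oppr0.
apply: (rsw_le_shift (v := z)); [exact: good_vcross|exact: good_vcross|].
move=> zt [b [t [/= hb ht bt]]]; exists (b.1 + z.1, b.2 + z.2), (t.1 + z.1, t.2 + z.2).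
split=> /=; try lia.
by apply: conn_shift bt; rewrite /inQ /=; lia.
Qed.

Lemma pr_land N z a b : pr (land N (0, 0) a b) <= pr (land N z (a + z.2) (b + z.2)).
Proof.
apply: (rsw_le_shift (v := z)); [exact: good_land|exact: good_land|].
move=> zt [l [r [/= hl hr hab lr]]]; exists (l.1 + z.1, l.2 + z.2), (r.1 + z.1, r.2 + z.2).
split=> /=; try lia.
by apply: conn_shift lr; rewrite /inQ /=; lia.
Qed.

Lemma pr_linked_shift N N' z z' v :
  pr (linked N N' z z') <= pr (linked N N' (z.1 + v.1, z.2 + v.2) (z'.1 + v.1, z'.2 + v.2)).
Proof.
apply: (rsw_le_shift (v := v)); [exact: good_linked|exact: good_linked|].
by move=> zt [x [/big_shift X /big_shift X']]; eexists; split; [exact: X|exact: X'].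
Qed.

Lemma pr_linked_rot N N' z z' : pr (linked N N' z z') <= pr (linked N N' (rp z) (rp z')).
Proof.
apply: rsw_le_rot; [exact: good_linked|exact: good_linked|].
by move=> zt [x [/big_rot X /big_rot X']]; eexists; split; [exact: X|exact: X'].
Qed.

(** If a likely event is the union of two others, one of the two is nearly as likely; this
    product form can be iterated without losing constants. *)
Lemma or_split F G K : good F -> good G -> good K -> (forall zt, K zt -> F zt \/ G zt) ->
  (1 - pr F) * (1 - pr G) <= 1 - pr K.
Proof.
move=> gF gG gK h; apply: le_trans (rsw_or H gF gG) _; rewrite lerD2l lerN2.
by apply: (rsw_mono H) => //; exact: good_or.
Qed.

Lemma pr_land_empty N a b : (b < a) || (N%:Z < a) -> pr (land N (0, 0) a b) = 0.
Proof.
move=> hab; apply: rsw_none; first exact: good_land.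
by move=> zt [l [r [_ _ ? /conn_memr[_ /= ?]]]]; lia.
Qed.

Lemma pr_hcross_land N : pr (hcross N (0, 0)) <= pr (land N (0, 0) (- N%:Z) N).
Proof.
apply: (rsw_mono H); [exact: good_hcross|exact: good_land|].
move=> zt [l [r [hl hr lr]]]; exists l, r; split => //.
by have [_ /=] := conn_memr lr; lia.
Qed.

Lemma pr_land_split N a b y :
  (1 - pr (land N (0, 0) y b)) * (1 - pr (land N (0, 0) a (y - 1))) <= 1 - pr (land N (0, 0) a b).
Proof.
apply: or_split; try exact: good_land.
move=> zt [l [r [hl hr hlr lr]]].
by have [ry|ry] := lerP y r.2; [left|right]; exists l, r; split => //; lia.
Qed.

Section scale.
Variables (th : R) (m : nat).
Hypotheses (th0 : 0 < th) (th1 : th < 1) (m0 : (0 < m)%N).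

Let thm0 k : 0 < th ^+ k. Proof. exact: exprn_gt0. Qed.
Let thle j k : (j <= k)%N -> th ^+ k <= th ^+ j.
Proof. by move=> jk; apply: ler_wiXn2l => //; exact: ltW. Qed.

Lemma land_pieces N a s k :
  (forall i, (i < k)%N -> th ^+ 2 < 1 - pr (land N (0, 0) (a + (i * s)%:Z) (a + (i * s + s)%:Z - 1))) ->
  th ^+ (2 * k) <= 1 - pr (land N (0, 0) a (a + (k * s)%:Z - 1)).
Proof.
elim: k => [|k IH] h.
  by rewrite pr_land_empty ?subr0 ?muln0 ?expr0 //; clear; lia.
apply: le_trans (pr_land_split _ _ _ (a + (k * s)%:Z)); rewrite mulrC.
rewrite (_ : (k.+1 * s = k * s + s)%N); last by rewrite mulSnr.
rewrite mulnS addnC exprD; apply: ler_pM; rewrite ?(ltW (thm0 _)) //.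
  by apply: IH => i ik; apply: h; exact: ltnW.
by apply/ltW/h.
Qed.

(** A crossing of the square lands below [am], above [am + B - 1], or between. The two bounds are
    chosen as the extreme positions at which landing above, respectively landing below, is still
    likely; landing strictly outside is then unlikely on both sides, so that landing between is
    even more likely, and one of [m] consecutive intervals of length about [B / m] inherits from
    it, by [or_split], a failure probability that is at most the [m]-th root. *)
Lemma landing N : 1 - th ^+ (4 * m) <= pr (hcross N (0, 0)) ->
  exists (am j1 : int) (B : nat), [/\ (0 < B <= 2 * N + 1)%N,
    1 - th ^+ m <= pr (land N (0, 0) (am + B%:Z - 1) N),
    1 - th ^+ m <= pr (land N (0, 0) (- N%:Z) am),
    1 - th ^+ 2 <= pr (land N (0, 0) j1 (j1 + ((B + m.-1) %/ m)%N%:Z - 1)) &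
    [/\ - N%:Z <= am, am + B%:Z - 1 <= N & - N%:Z <= j1 <= N]].
Proof.
move=> /le_trans/(_ (pr_hcross_land N)); set c := pr (land _ _ _ _) => hc.
have gl a b : good (land N (0, 0) a b) by exact: good_land.
pose U k := pr (land N (0, 0) (- N%:Z + k%:Z) N).
pose D k := pr (land N (0, 0) (- N%:Z) (- N%:Z + k%:Z)).
have cU0 : U 0%N = c by rewrite /U addr0.
have cD : D (2 * N)%N = c by rewrite /D /c; congr (pr (land _ _ _ _)); clear; lia.
have cm : 1 - th ^+ m <= c by apply: le_trans hc; rewrite lerD2l lerN2; apply: thle; rewrite leq_pmull.
have exU : exists k, (k <= 2 * N)%N && (1 - th ^+ m <= U k).
  by exists 0%N; rewrite cU0.
have exD : exists k, 1 - th ^+ m <= D k by exists (2 * N)%N; rewrite cD.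
(* The bound above which landing is still likely is as high as possible, and the bound below
   which it is likely as low as possible. *)
case: (ex_maxnP exU (fun k hk => (andP hk).1)) => kp /andP[kpN kpU] kpmax.
case: (ex_minnP exD) => km kmD kmmin.
have thm1 : 0 < 1 - th ^+ m by rewrite subr_gt0 exprn_ilt1 // ?ltW // -lt0n.
have pU' : U kp.+1 < 1 - th ^+ m.
  rewrite ltNge; apply/negP => h.
  have [kN|kN] := leqP kp.+1 (2 * N)%N.
    by have := kpmax kp.+1; rewrite kN h => /(_ isT); rewrite ltnn.
  move: h; rewrite /U pr_land_empty ?leNgt ?thm1 //.
  by clear -kN; lia.
have gU k : U k <= 1 by exact: rsw_le1.
have gD k : D k <= 1 by exact: rsw_le1.
have kmp : (km <= kp)%N.
  apply: kmmin; have h := pr_land_split N (- N%:Z) N (- N%:Z + kp.+1%:Z).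
  have {}h : (1 - U kp.+1) * (1 - D kp) <= 1 - c.
    apply: le_trans h; rewrite /D (_ : - N%:Z + kp%:Z = - N%:Z + kp.+1%:Z - 1) //.
    by clear; lia.
  have h2 : th ^+ m * (1 - D kp) <= th ^+ (4 * m).
    apply: le_trans (_ : 1 - c <= _); last by rewrite lerBlDr addrC -lerBlDr.
    apply: le_trans h; rewrite ler_wpM2r ?subr_ge0 ?gD //.
    by rewrite lerBrDr addrC -lerBrDr ltW.
  have h3 : th ^+ (4 * m) = th ^+ m * th ^+ (3 * m) by rewrite -exprD -mulSn.
  move: h2; rewrite h3 ler_pM2l // => h2.
  by rewrite lerBlDr addrC -lerBlDr (le_trans h2) // thle // leq_pmull.
pose B := (kp - km).+1; pose am := - N%:Z + km%:Z.
have BE : am + B%:Z - 1 = - N%:Z + kp%:Z by rewrite /am /B; clear -kmp; lia.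
pose M := pr (land N (0, 0) am (am + B%:Z - 1)).
pose D' := pr (land N (0, 0) (- N%:Z) (am - 1)).
have pD' : D' < 1 - th ^+ m.
  rewrite ltNge; apply/negP => h.
  have [k0|k0] := posnP km.
    move: h; rewrite /D' pr_land_empty ?leNgt ?thm1 // /am k0.
    by clear; lia.
  have := kmmin km.-1; rewrite (_ : D km.-1 = D') => [/(_ h)|].
    by rewrite leqNgt prednK // leqnn.
  by rewrite /D /D' /am; congr (pr (land _ _ _ _)); clear -k0; lia.
have pM : 1 - M <= th ^+ (2 * m).
  have h1 := pr_land_split N (- N%:Z) N (- N%:Z + kp.+1%:Z).
  have h2 := pr_land_split N (- N%:Z) (am + B%:Z - 1) am.
  rewrite -/c (_ : - N%:Z + kp.+1%:Z - 1 = am + B%:Z - 1) -/(U kp.+1) in h1; last first.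
    by rewrite BE; clear; lia.
  rewrite -/M -/D' in h2.
  have M1 : 0 <= 1 - M by rewrite subr_ge0 rsw_le1.
  have h3 : th ^+ m * (th ^+ m * (1 - M)) <= th ^+ (4 * m).
    apply: (@le_trans _ _ (1 - c)); last by rewrite lerBlDr addrC -lerBlDr.
    apply: le_trans h1; apply: ler_pM; rewrite ?(ltW (thm0 _)) ?mulr_ge0 //; try exact: (ltW (thm0 _)).
      by rewrite lerBrDr addrC -lerBrDr ltW.
    apply: le_trans h2; rewrite mulrC ler_wpM2l //.
    by rewrite lerBrDr addrC -lerBrDr ltW.
  have h4 : th ^+ (4 * m) = th ^+ m * (th ^+ m * th ^+ (2 * m)).
    by rewrite -!exprD -!mulSn.
  by move: h3; rewrite h4 !ler_pM2l.
(* Rounding up makes [m] intervals of length [s] cover the [B] landing positions. *)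
set s := ((B + m.-1) %/ m)%N.
have Bms : (B <= m * s)%N.
  have := divn_eq (B + m.-1) m; have := ltn_pmod (B + m.-1) m0; rewrite -/s; lia.
have [i im hi] : exists2 i, (i < m)%N & 1 - th ^+ 2 <= pr (land N (0, 0) (am + (i * s)%:Z) (am + (i * s + s)%:Z - 1)).
  apply: contrapT => hn.
  have lt2 i : (i < m)%N -> th ^+ 2 < 1 - pr (land N (0, 0) (am + (i * s)%:Z) (am + (i * s + s)%:Z - 1)).
    by move=> im; rewrite ltNge; apply/negP => h; apply: hn; exists i => //; rewrite lerBlDr addrC -lerBlDr.
  have := @land_pieces N am s m.-1 (fun i h => lt2 i (leq_trans h (leq_pred m))).
  have last := lt2 m.-1 (ltac:(by rewrite prednK)).
  move=> h.
  have E : (m.-1 * s + s = m * s)%N by rewrite -mulSnr prednK.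
  have g : (1 - pr (land N (0, 0) am (am + (m.-1 * s)%:Z - 1))) * (1 - pr (land N (0, 0) (am + (m.-1 * s)%:Z) (am + (m.-1 * s + s)%:Z - 1))) <= 1 - M.
    rewrite mulrC; apply: le_trans (pr_land_split _ _ _ (am + (m.-1 * s)%:Z)) _.
    rewrite lerD2l lerN2; apply: (rsw_mono H); try exact: gl.
    move=> zt [l [r [hl hr hlr lr]]]; exists l, r; split => //.
    by move: hlr; rewrite E; clear -Bms; lia.
  have : th ^+ (2 * m.-1) * th ^+ 2 < 1 - M.
    apply: lt_le_trans g; apply: (@lt_le_trans _ _ (th ^+ (2 * m.-1) * (1 - pr (land N (0, 0) (am + (m.-1 * s)%:Z) (am + (m.-1 * s + s)%:Z - 1))))).
      by rewrite ltr_pM2l.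
    by rewrite ler_wpM2r // (le_trans _ (ltW last)) // ltW.
  rewrite -exprD (_ : (2 * m.-1 + 2 = 2 * m)%N); last by rewrite -mulnSr prednK.
  by rewrite ltNge pM.
have am0 : - N%:Z <= am by rewrite /am; clear; lia.
have i0 : (am + (i * s)%:Z <= N%:Z).
  rewrite leNgt; apply/negP => hN; move: hi; rewrite pr_land_empty ?hN ?orbT // leNgt.
  by rewrite subr_gt0 exprn_ilt1 // ltW.
exists am, (am + (i * s)%:Z), B; split.
- by rewrite /B; clear -kpN; lia.
- by rewrite BE.
- exact: kmD.
- rewrite -/s (_ : am + (i * s)%:Z + s%:Z = am + (i * s + s)%:Z); first exact: hi.
  by rewrite PoszD addrA.
- split => //; first by rewrite BE; clear -kpN; lia.
  by rewrite i0 andbT; clear -am0; lia.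
Qed.

(** The events of [landing_linked] are all likely when the small square is placed so that the
    interval in which the crossing of the large square lands fits between the two landing regions
    of the small one; this needs [s <= B]. *)
Lemma linked_prob N1 N2 : (N2 <= N1)%N ->
  1 - th ^+ (4 * m) <= pr (hcross N1 (0, 0)) -> 1 - th ^+ (4 * m) <= pr (hcross N2 (0, 0)) ->
  forall (j1 am : int) (s B : nat), (s <= B)%N ->
  1 - th ^+ m <= pr (land N2 (0, 0) (am + B%:Z - 1) N2) ->
  1 - th ^+ m <= pr (land N2 (0, 0) (- N2%:Z) am) ->
  1 - th ^+ 2 <= pr (land N1 (0, 0) j1 (j1 + s%:Z - 1)) ->
  (1 - th) ^+ 5 <= pr (linked N1 N2 (0, 0) (N1%:Z - N2%:Z, j1 - am)).
Proof.
move=> N21 c1 c2 j1 am s B sB pU pL pJ; set z2 := (_, j1 - am).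
pose F1 := land N1 (0, 0) j1 (j1 + s%:Z - 1).
pose F2 := vcross N1 (0, 0).
pose F3 := land N2 z2 (am + B%:Z - 1 + z2.2) (N2%:Z + z2.2).
pose F4 := land N2 z2 (- N2%:Z + z2.2) (am + z2.2).
pose F5 := vcross N2 z2.
have t1 : 0 <= 1 - th by rewrite subr_ge0 ltW.
have le1 k : (0 < k)%N -> 1 - th <= 1 - th ^+ k.
  by move=> k0; rewrite lerD2l lerN2 -{2}(expr1 th); exact: thle.
have p1 : 1 - th <= pr F1 by apply: le_trans pJ; exact: le1.
have p2 : 1 - th <= pr F2 by apply: le_trans (pr_vcross _ _); apply: le_trans c1; apply: le1; rewrite muln_gt0 m0.
have p3 : 1 - th <= pr F3 by apply: le_trans (pr_land _ _ _ _); apply: le_trans pU; exact: le1.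
have p4 : 1 - th <= pr F4 by apply: le_trans (pr_land _ _ _ _); apply: le_trans pL; exact: le1.
have p5 : 1 - th <= pr F5 by apply: le_trans (pr_vcross _ _); apply: le_trans c2; apply: le1; rewrite muln_gt0 m0.
have step F G k : good F -> good G -> 1 - th <= pr F -> (1 - th) ^+ k <= pr G ->
    (1 - th) ^+ k.+1 <= pr (fun zt => F zt /\ G zt).
  move=> gF gG hF hG; rewrite exprS; apply: le_trans (rsw_and H gF gG).
  by apply: ler_pM => //; exact: exprn_ge0.
have g1 : good F1 by exact: good_land.
have g2 : good F2 by exact: good_vcross.
have g3 : good F3 by exact: good_land.
have g4 : good F4 by exact: good_land.
have g5 : good F5 by exact: good_vcross.
have q := step _ _ _ g1 (good_and g2 (good_and g3 (good_and g4 g5))) p1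
  (step _ _ _ g2 (good_and g3 (good_and g4 g5)) p2
    (step _ _ _ g3 (good_and g4 g5) p3 (step _ _ 1%N g4 g5 p4 p5))).
apply: le_trans q _; apply: (rsw_mono H).
- by do !apply: good_and.
- exact: good_linked.
move=> zt [f1 [f2 [f3 [f4 f5]]]].
apply: (landing_linked (am := am) (ap := am + B%:Z - 1) (j1 := j1) (j2 := j1 + s%:Z - 1)) => //.
- by clear; rewrite /=; lia.
- by clear -sB; rewrite /=; lia.
- by eexists; exact: f3.
- by eexists; exact: f4.
Qed.

End scale.
End rsw.

Lemma conn_weak r (B B' : pt -> Prop) x y : (forall u, B u -> B' u) -> conn r B x y -> conn r B' x y.
Proof. by move=> h; apply: (@conn_sub _ _ _ _ id). Qed.

Section chain.
Variables (R : realType) (pr : (econf -> Prop) -> R).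
Hypothesis H : rsw_law pr.
Variables (N1 N2 : nat) (c0 : R).
Hypotheses (N12 : (2 * N2 <= N1)%N) (c00 : 0 <= c0).

Definition step_ok (u : pt) := forall z : pt, c0 <= pr (linked N1 N2 z (z.1 + u.1, z.2 + u.2)).

Lemma step_ok0 (u : pt) : c0 <= pr (linked N1 N2 (0, 0) u) -> step_ok u.
Proof.
move=> h z; apply: (le_trans h); apply: le_trans (pr_linked_shift H _ _ _ _ z) _.
by rewrite /= !add0r addrC (addrC u.2).
Qed.

Lemma step_ok_rp u : step_ok u -> step_ok (rp u).
Proof.
move=> h; apply: step_ok0; apply: le_trans (h (0, 0)) _.
by apply: le_trans (pr_linked_rot H _ _ _ _) _; rewrite /rp /= !add0r oppr0.
Qed.

(** Among the rotations of a good relative position, one points to the right more than it points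
    up or down. *)
Lemma step_dir (y : int) : step_ok (N1%:Z - N2%:Z, y) -> `|y| <= N1%:Z + N2%:Z ->
  exists h : pt, [/\ step_ok h, `|h.2| <= h.1 & N1%:Z <= 2 * h.1 <= 3 * N1%:Z].
Proof.
move=> ok hy.
have [h1|h1] := lerP `|y| (N1%:Z - N2%:Z).
  by exists (N1%:Z - N2%:Z, y); split=> //=; clear -N12 h1; lia.
have [y0|y0] := lerP 0 y.
  exists (rp (rp (rp (N1%:Z - N2%:Z, y)))); split; first by do 3 apply: step_ok_rp.
    by rewrite /rp /=; clear -N12 h1 hy y0; lia.
  by rewrite /rp /=; clear -N12 h1 hy y0; lia.
exists (rp (N1%:Z - N2%:Z, y)); split; first exact: step_ok_rp.
  by rewrite /rp /=; clear -N12 h1 hy y0; lia.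
by rewrite /rp /=; clear -N12 h1 hy y0; lia.
Qed.

(** From the square at [z] go to the small square at [w] and from there, backwards along a
    rotation of the same step, to another large square at [z']. The rotation is chosen according
    to the signs of [h.2] and [z.2], so that [z'] advances by at least [h.1] and stays at bounded
    height. *)
Lemma double_step (h z : pt) : step_ok h -> `|h.2| <= h.1 -> N1%:Z <= 2 * h.1 <= 3 * N1%:Z ->
  `|z.2| <= 3 * N1%:Z ->
  exists w z' : pt, [/\ c0 <= pr (linked N1 N2 z w), c0 <= pr (linked N1 N2 z' w),
    `|w.2| <= 5 * N1%:Z, `|z'.2| <= 3 * N1%:Z & z.1 + h.1 <= z'.1].
Proof.
move=> ok h21 hN zN.
exists (z.1 + h.1, z.2 + h.2).
have wN : `|z.2 + h.2| <= 5 * N1%:Z by clear -h21 hN zN; lia.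
have ok2 : step_ok (- h.1, - h.2) by move: (step_ok_rp (step_ok_rp ok)).
have ok1 : step_ok (- h.2, h.1) by move: (step_ok_rp ok).
have ok3 : step_ok (h.2, - h.1) by move: (step_ok_rp ok2); rewrite /rp /= opprK.
have S (u : pt) : step_ok u -> c0 <= pr (linked N1 N2 (z.1 + h.1 - u.1, z.2 + h.2 - u.2) (z.1 + h.1, z.2 + h.2)).
  by move=> oku; have := oku (z.1 + h.1 - u.1, z.2 + h.2 - u.2); rewrite /= !subrK.
have [hp|hn] := lerP 0 h.2.
  have [zp|zn] := lerP z.2 0.
    exists (z.1 + h.1 - - h.1, z.2 + h.2 - - h.2); split => //=; first exact: S ok2.
      by clear -h21 hN zN hp zp; lia.
    by clear -h21 hN; lia.
  exists (z.1 + h.1 - - h.2, z.2 + h.2 - h.1); split => //=; first exact: S ok1.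
    by clear -h21 hN zN hp zn; lia.
  by clear -h21 hN hp; lia.
have [zp|zn] := lerP 0 z.2.
  exists (z.1 + h.1 - - h.1, z.2 + h.2 - - h.2); split => //=; first exact: S ok2.
    by clear -h21 hN zN hn zp; lia.
  by clear -h21 hN; lia.
exists (z.1 + h.1 - h.2, z.2 + h.2 - - h.1); split => //=; first exact: S ok3.
  by clear -h21 hN zN hn zn; lia.
by clear -h21 hN hn; lia.
Qed.

Let strip (z : pt) := - (8 * N1)%N%:Z <= z.2 <= (8 * N1)%N%:Z.

(** Consecutive links share the big cluster of a common square, which is unique, so that the
    links join up to a connected chain inside a horizontal strip. *)
Lemma chain_steps (h : pt) : step_ok h -> `|h.2| <= h.1 -> N1%:Z <= 2 * h.1 <= 3 * N1%:Z ->
  forall t : nat, exists (z : pt) (E : econf -> Prop),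
  [/\ good E, c0 ^+ (2 * t) <= pr E, `|z.2| <= 3 * N1%:Z /\ t%:Z * h.1 <= z.1,
   forall zt x, E zt -> big N1 z zt x -> exists y, big N1 (0, 0) zt y /\ conn (link zt) strip y x &
   forall zt, E zt -> (0 < t)%N -> exists x, big N1 z zt x].
Proof.
move=> ok h21 hN; elim=> [|t [z [E [gE pE [zN zt'] hE _]]]].
  exists (0, 0), (fun=> True); split => //.
  - exact: good_cst.
  - by rewrite muln0 expr0 (rsw1 H).
  - by rewrite mul0r normr0; split => //; clear; lia.
  move=> zt x _ X; exists x; split => //; apply: conn_refl.
  by case: X => -[l _ /conn_meml[_ /= ?]] _ _ _; rewrite /strip; lia.
have [w [z' [lw lw' wN zN' zz']]] := double_step ok h21 hN zN.
pose E' zt := E zt /\ (linked N1 N2 z w zt /\ linked N1 N2 z' w zt).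
have gl x y : good (linked N1 N2 x y) by exact: good_linked.
exists z', E'; split.
- by do !apply: good_and.
- rewrite mulnS addnC exprD expr2.
  apply: le_trans (rsw_and H gE (good_and (gl _ _) (gl _ _))).
  apply: ler_pM; rewrite ?exprn_ge0 ?mulr_ge0 //.
  by apply: le_trans (rsw_and H (gl _ _) (gl _ _)); apply: ler_pM.
- split => //; apply: le_trans zz'; rewrite -addn1 PoszD mulrDl mul1r lerD2r //.
- move=> zt x [/hE {}hE [[a [az aw]] [b [bz bw]]]] xz.
  have [y [y0 ya]] := hE a az; exists y; split => //.
  apply: conn_trans ya _.
  have ab := big_unique aw bw; have bx := big_unique bz xz.
  apply: (@conn_trans _ _ _ b).
    apply: conn_weak ab => u [_ hu]; rewrite /strip.
    by move: hu wN; clear -N12; lia.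
  apply: conn_weak bx => u [_ hu]; rewrite /strip.
  by move: hu zN'; clear; lia.
- by move=> zt [_ [_ [b [bz _]]]] _; exists b.
Qed.

(** As [2 * h.1 >= N1], 320 double steps, that is 640 links, cover the distance [160 * N1]. *)
Lemma long_crossing (y : int) : (0 < N1)%N -> c0 <= pr (linked N1 N2 (0, 0) (N1%:Z - N2%:Z, y)) ->
  `|y| <= N1%:Z + N2%:Z -> c0 ^+ 640 <= pr (hrect (160 * N1) (8 * N1)).
Proof.
move=> N10 /step_ok0 ok hy; have [h [okh h21 hN]] := step_dir ok hy.
have [z [E [gE pE [zN zt'] hE hx]]] := chain_steps okh h21 hN 320.
apply: le_trans pE _; apply: (rsw_mono H) => //; first exact: good_hrect.
move=> zt Ezt; have [x xz] := hx zt Ezt isT; have [y' [y0 yx]] := hE zt x Ezt xz.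
have [[l /= hl yl] _ _ _] := y0; have [_ [r hr xr] _ _] := xz.
have S u : inQ N1 (0, 0) u -> strip u by rewrite /inQ /strip /=; clear; lia.
have S' u : inQ N1 z u -> strip u by rewrite /inQ /strip /=; clear -zN; lia.
have ly := conn_linkS (conn_weak S yl).
have xr' := conn_weak S' xr.
have lr := conn_trans ly (conn_trans yx xr').
have [] := clip lr (a := 0) (b := (160 * N1)%N%:Z).
- by rewrite hl; clear; lia.
- by clear; lia.
- rewrite hr; apply: le_trans (_ : 320%:Z * h.1 <= _); first by clear -hN; lia.
  by rewrite (le_trans zt') // lerDl.
move=> a [b [ha hb ab]]; exists a, b; split => //.
by apply: conn_weak ab => u [].
Qed.

End chain.

(** Five likely events for each of 640 links. *)
Definition chain_exp : nat := 3200.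

(** The length [B] of the landing interval given by [landing] at the scale [N i] lies between 1
    and [2 * N i + 1]. If at each step it grew by more than the factor [m], it would exceed [m ^
    q] at the scale [q], which is too long. So for some [i] the pieces of the interval at the
    scale [i.+1] are at most as long as the interval at the scale [i]; squares of these two sizes
    are then linked with a probability bounded below, and a chain of links makes a long crossing. *)
Lemma rsw (R : realType) (pr : (econf -> Prop) -> R) (th : R) (m q : nat) (N : nat -> nat) :
  rsw_law pr -> 0 < th -> th < 1 -> (0 < m)%N -> (0 < N 0)%N ->
  (forall i, (i < q)%N -> (2 * N i <= N i.+1)%N) -> (2 * N q + 1 < m ^ q)%N ->
  (forall i, (i <= q)%N -> 1 - th ^+ (4 * m) <= pr (hcross (N i) (0, 0))) ->
  exists2 i, (i <= q)%N & (1 - th) ^+ chain_exp <= pr (hrect (160 * N i) (8 * N i)).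
Proof.
move=> H th0 th1 m0 N0 N2 Nq hN.
have Npos i : (i <= q)%N -> (0 < N i)%N.
  elim: i => // i IH iq; have := IH (ltnW iq); have := N2 i iq; clear; lia.
have L i : (i <= q)%N -> exists t : (int * int * nat), [/\ (0 < t.2 <= 2 * N i + 1)%N,
    1 - th ^+ m <= pr (land (N i) (0, 0) (t.1.1 + t.2%:Z - 1) (N i)),
    1 - th ^+ m <= pr (land (N i) (0, 0) (- (N i)%:Z) t.1.1),
    1 - th ^+ 2 <= pr (land (N i) (0, 0) t.1.2 (t.1.2 + ((t.2 + m.-1) %/ m)%N%:Z - 1)) &
    [/\ - (N i)%:Z <= t.1.1, t.1.1 + t.2%:Z - 1 <= N i & - (N i)%:Z <= t.1.2 <= N i]].
  by move=> /hN/(landing H th0 th1 m0)[am [j1 [B h]]]; exists ((am, j1), B).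
pose T i := if pselect (i <= q)%N is left h then projT1 (cid (L i h)) else ((0, 0), 0%N).
have hT i : (i <= q)%N -> [/\ (0 < (T i).2 <= 2 * N i + 1)%N,
    1 - th ^+ m <= pr (land (N i) (0, 0) ((T i).1.1 + (T i).2%:Z - 1) (N i)),
    1 - th ^+ m <= pr (land (N i) (0, 0) (- (N i)%:Z) (T i).1.1),
    1 - th ^+ 2 <= pr (land (N i) (0, 0) (T i).1.2 ((T i).1.2 + (((T i).2 + m.-1) %/ m)%N%:Z - 1)) &
    [/\ - (N i)%:Z <= (T i).1.1, (T i).1.1 + (T i).2%:Z - 1 <= N i & - (N i)%:Z <= (T i).1.2 <= N i]].
  by move=> iq; rewrite /T; case: pselect => // h; case: cid.
have [i iq hs] : exists2 i, (i < q)%N & (((T i.+1).2 + m.-1) %/ m <= (T i).2)%N.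
  apply: contrapT => hn.
  have B i : (i <= q)%N -> (m ^ i <= (T i).2)%N.
    elim: i => [_|i IH iq]; first by have [/andP[]] := hT 0%N (leq0n _).
    have h : ((T i).2 < ((T i.+1).2 + m.-1) %/ m)%N.
      by rewrite ltnNge; apply/negP => h; apply: hn; exists i.
    have h1 := leq_divM ((T i.+1).2 + m.-1) m; have h2 := IH (ltnW iq).
    have h3 : (m * (T i).2 + m <= (T i.+1).2 + m.-1)%N.
      by apply: leq_trans h1; rewrite addnC -mulnS mulnC leq_mul2r h orbT.
    rewrite expnS; apply: (@leq_trans (m * (T i).2)%N); first by rewrite leq_mul2l h2 orbT.
    by clear -h3 m0; lia.
  have [/andP[_ h] _ _ _ _] := hT q (leqnn _); have := B q (leqnn _); clear -h Nq; lia.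
have [_ _ _ pJ [_ _ hj]] := hT i.+1 iq.
have [hB pU pL _ [ha1 ha2 _]] := hT i (ltnW iq).
have N21 : (N i <= N i.+1)%N by have := N2 i iq; clear; lia.
have lk := linked_prob H th0 th1 m0 N21 (hN _ iq) (hN _ (ltnW iq)) hs pU pL pJ.
exists i.+1 => //; rewrite (_ : chain_exp = 5 * 640)%N // exprM.
apply: (long_crossing H (N2 i iq) _ (Npos _ iq) lk).
  by rewrite exprn_ge0 // subr_ge0 ltW.
by clear -hB hj ha1 ha2; lia.
Qed.

#[global] Opaque chain_exp.

(** * Local models and their crossing laws *)

Definition close_by (r : nat) (e e' : edge_t) : Prop :=
  (`|e'.1.1 - e.1.1| <= r)%N /\ (`|e'.1.2 - e.1.2| <= r)%N.

(** The properties of the map from bond configurations to enhanced edge sets on which the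
    probabilistic argument depends; [r0] bounds the distance at which a bond influences an edge. *)
Record model (f : cfg -> econf) (r0 : nat) : Prop := Model {
  mod_mono : forall c c' : cfg, (forall e, c e -> c' e) -> forall e, f c e -> f c' e;
  mod_loc : forall c c' e, (forall e', close_by r0 e e' -> c e' = c' e') -> f c e -> f c' e;
  mod_shift : forall c v e, f (fun e => c (shE v e)) e <-> f c (shE v e);
  mod_rot : forall c e, f (fun e => c (rotE e)) e <-> f c (rotE e)
}.

Lemma shE_inj v : injective (shE v).
Proof. by move=> [[a b] d] [[a' b'] d'] [] /= /addIr -> /addIr -> ->. Qed.

Lemma rotE_inj : injective rotE.
Proof.
move=> [[a b] d] [[a' b'] d']; rewrite /rotE /rp.
by case: d d' => -[] //= [] h1 h2; congr (_, _); congr (_, _); lia.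
Qed.

Lemma dual_shift (zt : econf) v : dual (fun e => zt (shE v e)) = (fun e => dual zt (shE v e)).
Proof.
by apply/funext => -[[a b] []]; rewrite /dual /shE /=; congr (~ zt _); congr (_, _); congr (_, _); lia.
Qed.

(** Rotating about the origin of the primal lattice rotates the dual lattice about a point that
    is not one of its points, which accounts for the shift by one. *)
Lemma dual_rot (zt : econf) : (fun e => dual zt (rotE e)) = (fun e => dual (fun e => zt (rotE e)) (shE (0, -1) e)).
Proof.
by apply/funext => -[[a b] []]; rewrite /dual /rotE /rp /shE /=; congr (~ zt _); congr (_, _); congr (_, _); lia.
Qed.

Lemma dual_anti (zt zt' : econf) (S : edge_t -> Prop) :
  (forall e, S e -> zt e -> zt' e) ->
  forall e, S (if e.2 then ((e.1.1, e.1.2 + 1), false) else ((e.1.1 + 1, e.1.2), true)) ->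
  dual zt' e -> dual zt e.
Proof. by move=> h [[a b] []] /= hS; rewrite /dual /= => n z; apply: n; exact: h. Qed.

Section model_events.
Variables (f : cfg -> econf) (r0 : nat).
Hypothesis fm : model f r0.

Lemma close_inbox r e e' : inbox r e -> close_by r0 e e' -> inbox (r + r0) e'.
Proof. by rewrite /inbox /close_by; lia. Qed.

Lemma model_supp r (F : econf -> Prop) :
  (forall zt zt' : econf, (forall e, inbox r e -> zt e -> zt' e) -> F zt -> F zt') ->
  supp (inbox (r + r0)) (fun c => F (f c)).
Proof.
by move=> hF c c' h; apply: hF => e er; apply: (mod_loc fm) => e' /(close_inbox er)/h.
Qed.

Lemma model_dsupp r (F : econf -> Prop) :
  (forall zt zt' : econf, (forall e, inbox r e -> zt e -> zt' e) -> F zt -> F zt') ->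
  supp (inbox (r.+1 + r0)) (fun c => F (dual (f c))).
Proof.
move=> hF c c' h; apply: hF => e er; apply: (@dual_anti _ _ (inbox r.+1)); last first.
  by case: e er => -[a b] []; rewrite /inbox /=; lia.
by move=> e1 e1r; apply: (mod_loc fm) => e' /(close_inbox e1r)/h.
Qed.

Lemma model_local F : good F -> local (fun c => F (f c)).
Proof. by move=> [r /model_supp h]; exists (r + r0)%N. Qed.

Lemma model_incE F : good F -> incE (fun c => F (f c)).
Proof. by move=> [r hF] c c' cc; apply: hF => e _; exact: (mod_mono fm). Qed.

Lemma model_dlocal F : good F -> local (fun c => F (dual (f c))).
Proof. by move=> [r /model_dsupp h]; exists (r.+1 + r0)%N. Qed.

Lemma model_decE F : good F -> decE (fun c => F (dual (f c))).
Proof.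
move=> [r hF] c c' cc; apply: hF => e _; apply: (@dual_anti _ _ (fun=> True)) => // e' _.
exact: (mod_mono fm).
Qed.

End model_events.

Section laws.
Variables (R : realType) (P : R -> probability config R).
Hypothesis hP : forall p : R, 0 <= p <= 1 -> bernoulli_percolation p (P p).
Variables (p : R) (f : cfg -> econf) (r0 : nat).
Hypotheses (p01 : 0 <= p <= 1) (fm : model f r0).

Lemma prb_False : prb P p (fun=> False) = 0.
Proof. by rewrite /prb (_ : [set w | _] = set0) ?measure0 //; apply/seteqP; split. Qed.

Lemma prb_True : prb P p (fun=> True) = 1.
Proof. by rewrite /prb (_ : [set w | _] = setT) ?probability_setT //; apply/seteqP; split. Qed.

(** Positive association is the Harris inequality, applied to the increasing events of the bond
    configuration that good events of the enhanced edge set are. *)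
Lemma primal_law : rsw_law (fun F => prb P p (fun c => F (f c))).
Proof.
split; [exact: prb_False|exact: prb_True| | | | |].
- by move=> F G gF gG FG; apply: prb_mono; try exact: (model_local fm); move=> c; exact: FG.
- by move=> F G gF gG; apply: (prb_harris hP) => //; try exact: (model_local fm); exact: (model_incE fm).
- move=> F G gF gG; have lF := model_local fm gF; have lG := model_local fm gG.
  have := prb_harris hP p01 lF lG (model_incE fm gF) (model_incE fm gG).
  have := prbU_ge P p lF lG; set a := prb _ _ _; set b := prb _ _ _; set c := prb _ _ _; lra.
- move=> F v gF; rewrite -[RHS](prb_bij hP p01 (@shE_inj v)); last exact: (model_local fm).
  apply: prb_ext => c; rewrite (_ : f (fun e => c (shE v e)) = (fun e => f c (shE v e))) //.
  by apply/funext => e; apply/propext; exact: (mod_shift fm).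
- move=> F gF; rewrite -[RHS](prb_bij hP p01 rotE_inj); last exact: (model_local fm).
  apply: prb_ext => c; rewrite (_ : f (fun e => c (rotE e)) = (fun e => f c (rotE e))) //.
  by apply/funext => e; apply/propext; exact: (mod_rot fm).
Qed.

(** Good events of the dual are decreasing events of the bond configuration, so the Harris
    inequality applies again. *)
Lemma dual_law : rsw_law (fun F => prb P p (fun c => F (dual (f c)))).
Proof.
have sh F v : good F -> prb P p (fun c => F (fun e => dual (f c) (shE v e))) = prb P p (fun c => F (dual (f c))).
  move=> gF; rewrite -[RHS](prb_bij hP p01 (@shE_inj v)); last exact: (model_dlocal fm).
  apply: prb_ext => c; rewrite -dual_shift (_ : f (fun e => c (shE v e)) = (fun e => f c (shE v e))) //.
  by apply/funext => e; apply/propext; exact: (mod_shift fm).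
split; [exact: prb_False|exact: prb_True| | | |exact: sh|].
- by move=> F G gF gG FG; apply: prb_mono; try exact: (model_dlocal fm); move=> c; exact: FG.
- by move=> F G gF gG; apply: (prb_harris_dec hP) => //; try exact: (model_dlocal fm); exact: (model_decE fm).
- move=> F G gF gG; have lF := model_dlocal fm gF; have lG := model_dlocal fm gG.
  have := prb_harris_dec hP p01 lF lG (model_decE fm gF) (model_decE fm gG).
  have := prbU_ge P p lF lG; set a := prb _ _ _; set b := prb _ _ _; set c := prb _ _ _; lra.
- move=> F gF; rewrite -(sh F (0, -1)) //.
  rewrite -[RHS](prb_bij hP p01 rotE_inj); last exact: (model_dlocal fm (good_shift (0, -1) gF)).
  apply: prb_ext => c; rewrite dual_rot (_ : f (fun e => c (rotE e)) = (fun e => f c (rotE e))) //.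
  by apply/funext => e; apply/propext; exact: (mod_rot fm).
Qed.

End laws.

(** * Infinite components and the finite-size criterion *)

Definition Inf (zt : econf) := exists x : pt, forall M : nat, exists y : pt,
  conn (link zt) (fun=> True) x y /\ ~ sqball M y.

Definition arm (n M : nat) (zt : econf) := exists x y : pt,
  [/\ sqball n x, ~ sqball M y & conn (link zt) (sqball M.+1) x y].

Lemma ball_le r r' x : (r <= r')%N -> sqball r x -> sqball r' x.
Proof. by rewrite /sqball => rr [h1 h2]; rewrite !(leq_trans _ rr). Qed.

Lemma link_ball zt M u v : link zt u v -> sqball M u -> sqball M.+1 v.
Proof. by move=> /link_adjp; rewrite /adjp /sqball; lia. Qed.

Lemma first_exit zt M x y : conn (link zt) (fun=> True) x y -> sqball M x ->
  conn (link zt) (sqball M) x y \/ exists2 y', ~ sqball M y' & conn (link zt) (sqball M.+1) x y'.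
Proof.
move=> + xM; elim=> [_|u v _ IH uv _]; first by left; exact: conn_refl.
case: IH => [xu|?]; last by right.
have [vM|vM] := pselect (sqball M v); first by left; exact: conn_step xu uv vM.
right; exists v => //; apply: (conn_step _ uv (link_ball uv (conn_memr xu))).
by apply: conn_weak xu => z; exact: ball_le.
Qed.

(** The clusters of the finitely many points of a ball cannot all be finite if the ball is joined
    to arbitrarily large distances. This describes percolation by countably many local events. *)
Lemma InfE zt : Inf zt <-> exists n, forall M, (n <= M)%N -> arm n M zt.
Proof.
split=> [[x hx]|[n hn]].
  exists (`|x.1| + `|x.2|)%N => M nM; have [y [xy yM]] := hx M.
  have xM : sqball M x by rewrite /sqball; lia.
  case: (first_exit xy xM) => [/conn_memr //|[y' y'M xy']].
  by exists x, y'; split => //; rewrite /sqball; lia.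
apply: contrapT => nI.
have h x : exists M, forall y, conn (link zt) (fun=> True) x y -> sqball M y.
  apply: contrapT => hM; apply: nI; exists x => M; apply: contrapT => hy; apply: hM.
  by exists M => y xy; apply: contrapT => yM; apply: hy; exists y.
pose Mf x := projT1 (cid (h x)).
pose pp (i j : 'I_(2 * n).+1) : pt := (Posz i - Posz n, Posz j - Posz n).
pose M := (n + \max_i \max_j Mf (pp i j))%N.
have [x [y [xn yM xy]]] := hn M (leq_addr _ _).
apply: yM; apply: (@ball_le (Mf x)); last first.
  by rewrite /Mf; case: cid => /= K; apply; apply: conn_weak xy.
move: xn => [x1 x2].
have i1 : (absz (x.1 + Posz n)%R < (2 * n).+1)%N by lia.
have i2 : (absz (x.2 + Posz n)%R < (2 * n).+1)%N by lia.
have -> : x = pp (Ordinal i1) (Ordinal i2).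
  by case: x x1 x2 i1 i2 {xy} => a b /= ? ? ? ?; rewrite /pp /=; congr (_, _); lia.
apply: leq_trans (leq_addl _ _).
apply: leq_trans (leq_bigmax (Ordinal i1)).
exact: (leq_bigmax (F := fun j => Mf (pp (Ordinal i1) j))).
Qed.

Lemma good_arm n M : good (arm n M).
Proof.
exists M.+1 => zt zt' h [x [y [xn yM xy]]]; exists x, y; split => //.
exact: conn_mono h _ xy.
Qed.

Definition boxr (z : pt) (a b : nat) (u : pt) : Prop :=
  z.1 <= u.1 <= z.1 + a%:Z /\ z.2 <= u.2 <= z.2 + b%:Z.
Definition hx (z : pt) (a b : nat) (zt : econf) := exists l r : pt,
  [/\ l.1 = z.1, r.1 = z.1 + a%:Z & conn (link zt) (boxr z a b) l r].
Definition vx (z : pt) (a b : nat) (zt : econf) := exists l r : pt,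
  [/\ l.2 = z.2, r.2 = z.2 + b%:Z & conn (link zt) (boxr z a b) l r].

Lemma boxr_ball z a b : exists r : nat, forall x, boxr z a b x -> sqball r x.
Proof. by exists (`|z.1| + `|z.2| + a + b)%N => x; rewrite /boxr /sqball; lia. Qed.

Lemma good_hx z a b : good (hx z a b).
Proof.
have [r hr] := boxr_ball z a b; exists r => zt zt' h [x [y [E1 E2 c]]].
by exists x, y; split=> //; exact: conn_mono h hr c.
Qed.

Lemma good_vx z a b : good (vx z a b).
Proof.
have [r hr] := boxr_ball z a b; exists r => zt zt' h [x [y [E1 E2 c]]].
by exists x, y; split=> //; exact: conn_mono h hr c.
Qed.

(** Two horizontal crossings that overlap in a [b] by [b] square are joined there by a vertical
    crossing. *)
Lemma hx_glue z (a0 a' b h : nat) zt : (b <= a')%N -> (b <= h)%N -> hx z (a0 + b) b zt ->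
  hx (z.1 + a0%:Z, z.2) a' b zt -> vx (z.1 + a0%:Z, z.2) b h zt -> hx z (a0 + a') b zt.
Proof.
move=> ba bh [l1 [r1 [hl1 hr1 lr1]]] [l2 [r2 [/= hl2 hr2 lr2]]] [b0 [t0 [/= hb0 ht0 bt0]]].
have [] := clip_tb bt0 (a := z.2) (b := z.2 + b%:Z); rewrite ?hb0 ?ht0 //.
- by clear; lia.
- by clear -bh; lia.
move=> c [d [hc hd cd]].
pose B u := boxr (z.1 + a0%:Z, z.2) b h u /\ z.2 <= u.2 <= z.2 + b%:Z.
have cd' : conn (link zt) B c d by apply: conn_weak cd => u [].
have [x [lx cx]] : exists x, conn (link zt) (boxr z (a0 + b) b) l1 x /\ conn (link zt) B c x.
  apply: (meet_link lr1 cd' (a := z.1 + a0%:Z) (b := z.1 + a0%:Z + b%:Z) (c := z.2) (d := z.2 + b%:Z)).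
  - by rewrite hl1; clear; lia.
  - by rewrite hr1; clear; lia.
  - by move=> u [].
  - by move=> u [[]].
  - by rewrite hc.
  - by rewrite hd.
have [y [ly cy]] : exists x, conn (link zt) (boxr (z.1 + a0%:Z, z.2) a' b) l2 x /\ conn (link zt) B c x.
  apply: (meet_link lr2 cd' (a := z.1 + a0%:Z) (b := z.1 + a0%:Z + b%:Z) (c := z.2) (d := z.2 + b%:Z)).
  - by rewrite hl2; clear; lia.
  - by rewrite hr2; clear -ba; lia.
  - by move=> u [].
  - by move=> u [[]].
  - by rewrite hc.
  - by rewrite hd.
exists l1, r2; split => //; first by rewrite hr2; clear; lia.
have w1 := conn_weak (B' := boxr z (a0 + a') b) _ lx; have w2 := conn_weak (B' := boxr z (a0 + a') b) _ cx.
have w3 := conn_weak (B' := boxr z (a0 + a') b) _ cy; have w4 := conn_weak (B' := boxr z (a0 + a') b) _ ly.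
have w5 := conn_weak (B' := boxr z (a0 + a') b) _ lr2.
have hB u : B u -> boxr z (a0 + a') b u by rewrite /B /boxr /=; clear -ba; lia.
have h2 u : boxr (z.1 + a0%:Z, z.2) a' b u -> boxr z (a0 + a') b u by rewrite /boxr /=; clear; lia.
have h1 u : boxr z (a0 + b) b u -> boxr z (a0 + a') b u by rewrite /boxr /=; clear -ba; lia.
apply: conn_trans (w1 h1) _; apply: conn_trans (conn_linkS (w2 hB)) _.
apply: conn_trans (w3 hB) _; apply: conn_trans (conn_linkS (w4 h2)) _; exact: w5 h2.
Qed.

Section crossing_laws.
Variables (R : realType) (pr : (econf -> Prop) -> R).
Hypothesis H : rsw_law pr.

Lemma pr_hx z a b : pr (hx (0, 0) a b) <= pr (hx z a b).
Proof.
apply: (rsw_le_shift H (v := z)); [exact: good_hx|exact: good_hx|].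
move=> zt [l [r [/= hl hr lr]]]; exists (l.1 + z.1, l.2 + z.2), (r.1 + z.1, r.2 + z.2).
split=> /=; [lia|lia|].
by apply: conn_shift lr; rewrite /boxr /=; lia.
Qed.

Lemma pr_vx z a b : pr (hx (0, 0) a b) <= pr (vx z b a).
Proof.
apply: (@le_trans _ _ (pr (vx (- b%:Z, 0) b a))).
  apply: (rsw_le_rot H); [exact: good_hx|exact: good_vx|].
  move=> zt [l [r [/= hl hr lr]]]; exists (rp l), (rp r); split; rewrite /rp //=.
  by apply: conn_rot lr => y; rewrite /boxr /rp /=; lia.
apply: (rsw_le_shift H (v := (z.1 + b%:Z, z.2))); [exact: good_vx|exact: good_vx|].
move=> zt [l [r [/= hl hr lr]]]; exists (l.1 + (z.1 + b%:Z), l.2 + z.2), (r.1 + (z.1 + b%:Z), r.2 + z.2).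
split=> /=; [lia|lia|].
by apply: (conn_shift (v := (z.1 + b%:Z, z.2))) lr; rewrite /boxr /=; lia.
Qed.

Lemma pr_and_ge F G x y : good F -> good G -> 1 - x <= pr F -> 1 - y <= pr G ->
  1 - (x + y) <= pr (fun zt => F zt /\ G zt).
Proof.
move=> gF gG hF hG; apply: le_trans (rsw_and H gF gG).
have := rsw_le1 H gF; have := rsw_le1 H gG.
move: (pr F) (pr G) hF hG => a b ha hb b1 a1.
have : 0 <= (1 - a) * (1 - b) by apply: mulr_ge0; lra.
lra.
Qed.

Let q b := 1 - pr (hx (0, 0) (2 * b) b).

(** Each further [b] of length costs one more rectangle in each direction. *)
Lemma pr_long b j : 1 - pr (hx (0, 0) ((j + 2) * b) b) <= (2 * j + 1)%:R * q b.
Proof.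
elim: j => [|j IH]; first by rewrite muln0 mul1r.
have gh z a c : good (hx z a c) by exact: good_hx.
pose z : pt := (0 + ((j + 1) * b)%N%:Z, 0).
have h1 : 1 - (2 * j + 1)%:R * q b <= pr (hx (0, 0) ((j + 1) * b + b) b).
  rewrite (_ : ((j + 1) * b + b = (j + 2) * b)%N); last by rewrite -mulSnr addn1 addn2.
  by move: IH; set x := pr _; lra.
have h2 : 1 - q b <= pr (hx z (2 * b) b).
  by apply: le_trans (pr_hx _ _ _); rewrite /q opprB addrC subrK.
have h3 : 1 - q b <= pr (vx z b (2 * b)).
  by apply: le_trans (pr_vx _ _ _); rewrite /q opprB addrC subrK.
have := pr_and_ge (gh _ _ _) (good_and (gh _ _ _) (good_vx _ _ _)) h1 (pr_and_ge (gh _ _ _) (good_vx _ _ _) h2 h3).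
move=> h4.
have : 1 - ((2 * j + 1)%:R * q b + (q b + q b)) <= pr (hx (0, 0) ((j.+1 + 2) * b) b).
  apply: (le_trans h4); apply: (rsw_mono H).
  - by do !apply: good_and => //; exact: good_vx.
  - exact: gh.
  move=> zt [f1 [f2 f3]].
  have := @hx_glue (0, 0) ((j + 1) * b) (2 * b) b (2 * b) zt _ _ f1 f2 f3.
  rewrite -mulnDl (_ : (j + 1 + 2 = j.+1 + 2)%N); last by lia.
  by apply; rewrite leq_pmull.
rewrite (_ : (2 * j.+1 + 1)%:R * q b = (2 * j + 1)%:R * q b + (q b + q b)); first by lra.
by rewrite (_ : (2 * j.+1 + 1 = (2 * j + 1) + 2)%N) ?natrD; [ring|lia].
Qed.

End crossing_laws.

(** Long horizontal and vertical crossings of rectangles with a common corner meet, and so do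
    those of consecutive scales. *)
Lemma crossings_Inf (N J : nat) zt : (0 < N)%N ->
  (forall j, (J <= j)%N -> hx (0, 0) (6 * (3 ^ j * N)) (3 ^ j * N) zt /\
     vx (0, 0) (3 ^ j * N) (6 * (3 ^ j * N)) zt) -> Inf zt.
Proof.
move=> N0 h; have [l0 [r0 [hl0 hr0 lr0]]] := (h J (leqnn _)).1.
exists l0 => M.
pose T := fun _ : pt => True.
have wk B x y : conn (link zt) B x y -> conn (link zt) T x y by apply: conn_weak.
have claim k : exists l r : pt, [/\ l.1 = 0, r.1 = 0 + (6 * (3 ^ (J + k) * N))%N%:Z,
    conn (link zt) (boxr (0, 0) (6 * (3 ^ (J + k) * N)) (3 ^ (J + k) * N)) l r & conn (link zt) T l0 l].
  elim: k => [|k [l [r [hl hr lr l0l]]]].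
    by rewrite addn0; exists l0, r0; split => //; exact: conn_refl.
  rewrite addnS; have [[l' [r' [/= hl' hr' lr']]] [b [t [/= hb ht bt]]]] := h (J + k).+1 (ltac:(lia)).
  exists l', r'; split => //.
  set n := (3 ^ (J + k) * N)%N in hl hr lr *.
  have nE : (3 ^ (J + k).+1 * N = 3 * n)%N by rewrite expnS mulnA.
  rewrite !nE in hl' hr' lr' hb ht bt.
  have [x [lx bx]] : exists x, conn (link zt) (boxr (0, 0) (6 * n) n) l x /\ conn (link zt) (boxr (0, 0) (3 * n) (6 * (3 * n))) b x.
    apply: (meet_link lr bt (a := 0) (b := (3 * n)%N%:Z) (c := 0) (d := n%:Z)).
    - by rewrite hl.
    - by rewrite hr; clear; lia.
    - by move=> u []; clear; rewrite /=; lia.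
    - by move=> u []; clear; rewrite /=; lia.
    - by rewrite hb.
    - by rewrite ht; clear; lia.
  have [y [ly b_y]] : exists x, conn (link zt) (boxr (0, 0) (6 * (3 * n)) (3 * n)) l' x /\ conn (link zt) (boxr (0, 0) (3 * n) (6 * (3 * n))) b x.
    apply: (meet_link lr' bt (a := 0) (b := (3 * n)%N%:Z) (c := 0) (d := (3 * n)%N%:Z)).
    - by rewrite hl'.
    - by rewrite hr'; clear; lia.
    - by move=> u []; clear; rewrite /=; lia.
    - by move=> u []; clear; rewrite /=; lia.
    - by rewrite hb.
    - by rewrite ht; clear; lia.
  apply: conn_trans l0l _; apply: conn_trans (wk _ _ _ lx) _.
  apply: conn_trans (conn_linkS (wk _ _ _ bx)) _; apply: conn_trans (wk _ _ _ b_y) _.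
  exact: conn_linkS (wk _ _ _ ly).
have [l [r [hl hr lr l0l]]] := claim M.
exists r; split; first exact: conn_trans l0l (wk _ _ _ lr).
move=> [+ _]; rewrite hr; have : (M < 3 ^ (J + M))%N by apply: leq_trans (ltn_expl _ _) _; rewrite // leq_exp2l // leq_addl.
have : (3 ^ (J + M) <= 3 ^ (J + M) * N)%N by rewrite leq_pmulr.
by clear; move: (3 ^ (J + M))%N => t; move: (t * N)%N => s; lia.
Qed.

Section finite_size.
Variables (R : realType) (P : R -> probability config R).
Hypothesis hP : forall p : R, 0 <= p <= 1 -> bernoulli_percolation p (P p).
Variables (p : R) (f : cfg -> econf) (r0 : nat).
Hypotheses (p01 : 0 <= p <= 1) (fm : model f r0).

Let pr F := prb P p (fun c => F (f c)).
Let H : rsw_law pr := primal_law hP p01 fm.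
Let q b := 1 - pr (hx (0, 0) (2 * b) b).

Lemma Inf_measurable : measurable [set w | Inf (f (cfg_of w))].
Proof.
rewrite (_ : [set w | _] = \bigcup_n \bigcap_(M in [set M | (n <= M)%N]) [set w | arm n M (f (cfg_of w))]).
  apply: bigcup_measurable => n _; apply: bigcap_measurable; first by exists n => /=.
  by move=> M _; exact: (local_measurable (model_local fm (good_arm n M))).
apply/seteqP; split=> w /=.
  by move=> /InfE[n hn]; exists n => //= M /=; exact: hn.
by move=> [n _ hn]; apply/InfE; exists n => M; exact: hn.
Qed.

Lemma hx_supp (z : pt) a b : supp (fun e : edge_t => z.2 - r0%:Z <= e.1.2 <= z.2 + b%:Z + r0%:Z) (fun c => hx z a b (f c)).
Proof.
move=> c c' h [l [r [hl hr lr]]]; exists l, r; split => //.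
apply: (@conn_sub _ _ _ _ id) lr => // u v [_ u2] [_ v2] uv.
have st (e : edge_t) : z.2 <= e.1.2 <= z.2 + b%:Z -> f c e -> f c' e.
  by move=> he; apply: (mod_loc fm) => e' [_ ee']; apply: h; move: ee' he; clear; lia.
by case: uv => -[E /st h']; [apply: Or41|apply: Or42|apply: Or43|apply: Or44]; split => //; exact: h'.
Qed.

(** A failure at the scale [3 * b] forces two failures in horizontal strips of height [b] at
    vertical distance [b]; as [b] exceeds twice the range of the model, these are independent. *)
Lemma q_triple b : (2 * r0 < b)%N -> q (3 * b) <= (9 * q b) ^+ 2.
Proof.
move=> rb; have gh z a c : good (hx z a c) by exact: good_hx.
pose A1 c := hx (0, 0) (6 * b) b (f c); pose A2 c := hx (0, (2 * b)%N%:Z) (6 * b) b (f c).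
have l1 : local A1 by exact: (model_local fm (gh (0, 0) (6 * b)%N b)).
have l2 : local A2 by exact: (model_local fm (gh (0, (2 * b)%N%:Z) (6 * b)%N b)).
have a1 : 1 - prb P p A1 <= 9 * q b by exact: (pr_long H b 4).
have a2 : 1 - prb P p A2 <= 9 * q b.
  by apply: le_trans a1; rewrite lerD2l lerN2; exact: (pr_hx H).
have ind : prb P p (fun c => ~ A1 c /\ ~ A2 c) = (1 - prb P p A1) * (1 - prb P p A2).
  rewrite -!prbC //.
  apply: (prb_indep hP (S := fun e : edge_t => e.1.2 <= b%:Z + r0%:Z)) => //; try exact: localC.
    apply: supp_sub (suppC (@hx_supp (0, 0) (6 * b) b)) => e /=; rewrite add0r; clear; lia.
  by apply: supp_sub (suppC (@hx_supp (0, (2 * b)%N%:Z) (6 * b) b)) => e /=; clear -rb; lia.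
apply: (@le_trans _ _ (prb P p (fun c => ~ A1 c /\ ~ A2 c))); last first.
  rewrite ind expr2; apply: ler_pM => //; rewrite subr_ge0; exact: prb_le1.
rewrite /q /pr -prbC; last exact: (model_local fm (gh _ _ _)).
apply: prb_mono.
- by apply: localC; exact: (model_local fm (gh _ _ _)).
- by apply: localI; exact: localC.
move=> c nh; split=> -[l [r [hl hr lr]]]; apply: nh; exists l, r; split => //=.
- by rewrite hr /=; clear; lia.
- by apply: conn_weak lr => u; rewrite /boxr /=; clear; lia.
- by rewrite hr /=; clear; lia.
- by apply: conn_weak lr => u; rewrite /boxr /=; clear; lia.
Qed.

Lemma q_decay N : (2 * r0 < N)%N -> 162 * q N <= 1 -> forall j, 81 * q (3 ^ j * N) <= 2^-1 ^+ j.+1.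
Proof.
move=> rN qN; elim=> [|j IH]; first by rewrite mul1n expr1; lra.
rewrite expnS -mulnA; have rj : (2 * r0 < 3 ^ j * N)%N.
  by apply: leq_trans rN _; rewrite leq_pmull // expn_gt0.
have := q_triple rj; set x := q (3 ^ j * N) in IH *.
have x0 : 0 <= x by rewrite subr_ge0; apply: (rsw_le1 H); exact: good_hx.
move=> h; apply: (@le_trans _ _ ((81 * x) ^+ 2)).
  by apply: le_trans (ler_wpM2l _ h) _; rewrite // !exprMn mulrA ler_wpM2r ?sqr_ge0 //; lra.
apply: (@le_trans _ _ ((2^-1 ^+ j.+1) ^+ 2)).
  by rewrite ler_sqr ?nnegrE ?mulr_ge0 // exprn_ge0.
rewrite -exprM; apply: ler_wiXn2l; [lra|lra|lia].
Qed.

(** The recursion [q_triple] contracts as soon as [162 * q N <= 1]: the failure probabilities at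
    the scales [3 ^ j * N] are then summable, and by the Borel-Cantelli lemma all sufficiently
    large scales are crossed. *)
Lemma finite_size N : (2 * r0 < N)%N -> 162 * q N <= 1 ->
  P p [set w | Inf (f (cfg_of w))] = 1%E.
Proof.
move=> rN qN; have N0 : (0 < N)%N by lia.
pose a j := (3 ^ j * N)%N.
pose E j c := hx (0, 0) (6 * a j) (a j) (f c) /\ vx (0, 0) (a j) (6 * a j) (f c).
have gE j : good (fun zt => hx (0, 0) (6 * a j) (a j) zt /\ vx (0, 0) (a j) (6 * a j) zt).
  by apply: good_and; [exact: good_hx|exact: good_vx].
have lE j : local (E j) by exact: (model_local fm (gE j)).
pose F j := [set w | ~ E j (cfg_of w)].
have mF j : measurable (F j) by exact: (local_measurable (localC (lE j))).
have pF j : (P p (F j) <= (1 / (2 ^ j.+1)%:R)%:E)%E.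
  rewrite /F (prbK P p (localC (lE j))).
  rewrite lee_fin prbC //.
  have h1 : 1 - 9 * q (a j) <= pr (hx (0, 0) (6 * a j) (a j)).
    by have := pr_long H (a j) 4; rewrite -/pr -/(q _); lra.
  have h2 : 1 - 9 * q (a j) <= pr (vx (0, 0) (a j) (6 * a j)).
    by apply: le_trans h1 _; exact: (pr_vx H).
  have := pr_and_ge H (good_hx _ _ _) (good_vx _ _ _) h1 h2; rewrite -[pr _]/(prb P p (E j)).
  have := q_decay rN qN j; rewrite -/(a j) natrX div1r -exprVn.
  have q0 : 0 <= q (a j) by rewrite subr_ge0; apply: (rsw_le1 H); exact: good_hx.
  lra.
have lim0 : P p (lim_sup_set F) = 0%E.
  apply: lim_sup_set_cvg0 => //; apply: (@le_lt_trans _ _ 1%:E); last exact: ltry.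
  apply: (@le_trans _ _ (\sum_(i <oo) (1 / (2 ^ i.+1)%:R)%:E)%E); first by apply: lee_nneseries => [i _ _|i _]; [exact: measure_ge0|exact: pF].
  exact: (@epsilon_trick0 R 1 xpredT ler01).
have mlim : measurable (lim_sup_set F).
  by apply: bigcapT_measurable => n; apply: bigcup_measurable.
apply/eqP; rewrite eq_le probability_le1 /=; last exact: Inf_measurable.
apply: (@le_trans _ _ (P p (~` lim_sup_set F))); first by rewrite probability_setC // lim0 sube0.
apply: le_measure; rewrite ?inE.
- exact: measurableC.
- exact: Inf_measurable.
move=> w /= hw.
have [J hJ] : exists J, forall j, (J <= j)%N -> E j (cfg_of w).
  apply: contrapT => hn; apply: hw => n _ /=; apply: contrapT => h.
  apply: hn; exists n => j nj; apply: contrapT => hE; apply: h; exists j => //.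
exact: (crossings_Inf N0 hJ).
Qed.

End finite_size.

(** * Lattice rotations and enhanced configurations *)

(** The rotation with integer entries [a], [b], followed by the translation by [v]. *)
Definition gam (a b : int) (v x : pt) : pt := (a * x.1 - b * x.2 + v.1, b * x.1 + a * x.2 + v.2).

Lemma unit_cases (a b : int) : a * a + b * b = 1 ->
  [\/ a = 1 /\ b = 0, a = 0 /\ b = 1, a = -1 /\ b = 0 | a = 0 /\ b = -1].
Proof.
move=> h; have ha : -1 <= a <= 1 by nia.
have hb : -1 <= b <= 1 by nia.
have [Ea|[Ea|Ea]] : a = -1 \/ a = 0 \/ a = 1 by lia.
- have : b = -1 \/ b = 0 \/ b = 1 by lia.
  case=> [Eb|[Eb|Eb]]; move: h; rewrite Ea Eb => h; first [by apply: Or43|by exfalso; lia].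
- have : b = -1 \/ b = 0 \/ b = 1 by lia.
  case=> [Eb|[Eb|Eb]]; move: h; rewrite Ea Eb => h; first [by apply: Or42|by apply: Or44|by exfalso; lia].
- have : b = -1 \/ b = 0 \/ b = 1 by lia.
  case=> [Eb|[Eb|Eb]]; move: h; rewrite Ea Eb => h; first [by apply: Or41|by exfalso; lia].
Qed.

Lemma gam_adjp a b v x y : a * a + b * b = 1 -> adjp x y -> adjp (gam a b v x) (gam a b v y).
Proof.
move=> /unit_cases; rewrite /adjp /gam /=.
by case=> -[-> ->]; rewrite !(mul1r, mul0r, mulN1r); lia.
Qed.

Section gamma.
Variable R : realType.
Let inj : 'cV[int]_2 -> 'cV[R]_2 := map_mx intr.

Lemma inj_inj : injective inj.
Proof. by move=> u v /matrixP h; apply/matrixP => i j; have := h i j; rewrite !mxE => /intr_inj. Qed.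

Definition rotmx (a b : int) : 'M[R]_2 :=
  \matrix_(i, j) (if i == 0 then (if j == 0 then a else - b) else (if j == 0 then b else a))%:~R.

Lemma rotmx_toV a b x : rotmx a b *m inj (toV x) = inj (toV (gam a b (0, 0) x)).
Proof.
apply/colP => i; rewrite !mxE !big_ord_recl big_ord0 /= !mxE /= /gam /= !addr0.
by case: ifP => _; rewrite -!intrM -!intrD ?mulNr.
Qed.

(** The entries of [A] are integers, because [g] maps integer points to integer points, and an
    orthogonal matrix of determinant one is determined by its first column. *)
Lemma GammaP g : Gamma R g <->
  exists a b v, a * a + b * b = 1 /\ forall x, g (toV x) = toV (gam a b v x).
Proof.
split=> [[A [v [AA dA _ hg]]]|[a [b [v [ab hg]]]]].
  have ent i j : (A *m A^T) i j = A i 0 * A j 0 + A i 1 * A j 1.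
    rewrite !mxE !big_ord_recl big_ord0 /= !mxE addr0; congr (_ + A _ _ * A _ _); exact/val_inj.
  have e00 : A 0 0 * A 0 0 + A 0 1 * A 0 1 = 1 by rewrite -ent AA mxE eqxx.
  have e11 : A 1 0 * A 1 0 + A 1 1 * A 1 1 = 1 by rewrite -ent AA mxE eqxx.
  have ed : A 0 0 * A 1 1 - A 0 1 * A 1 0 = 1.
    rewrite -dA (expand_det_row _ 0) !big_ord_recl big_ord0 /= /cofactor !det_mx11 !mxE /= addr0.
    rewrite expr0 mul1r expr1 mulN1r mulrN; congr (A _ _ * A _ _ - A _ _ * A _ _); exact/val_inj.
  have [E1 E2] : A 1 1 = A 0 0 /\ A 0 1 = - A 1 0.
    have s : (A 0 0 - A 1 1) ^+ 2 + (A 0 1 + A 1 0) ^+ 2 = 0.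
      by rewrite !expr2; move: e00 e11 ed; lra.
    have s1 := sqr_ge0 (A 0 0 - A 1 1); have s2 := sqr_ge0 (A 0 1 + A 1 0).
    have /eqP : (A 0 0 - A 1 1) ^+ 2 = 0 by lra.
    have /eqP : (A 0 1 + A 1 0) ^+ 2 = 0 by lra.
    rewrite !sqrf_eq0 => /eqP h1 /eqP h2; lra.
  have cl x i : (inj (g (toV x))) i 0 = A i 0 * (x.1)%:~R + A i 1 * (x.2)%:~R + (v i 0)%:~R.
    rewrite /inj hg !mxE !big_ord_recl big_ord0 /= !mxE addr0 /=.
    by congr (_ + A _ _ * _ + _); exact/val_inj.
  pose u : 'cV[int]_2 := g (toV (1, 0)) - v.
  have A0 i : A i 0 = (u i 0)%:~R.
    have := cl (1, 0) i; rewrite !mxE intrD intrN /= => ->; ring.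
  clearbody u; exists (u 0 0), (u 1 0), (ofV v); split.
    by apply/(@intr_inj R); rewrite intrD !intrM -!A0 -[RHS]e00 E2; ring.
  move=> x; apply: inj_inj; apply/colP => i; rewrite cl !mxE /gam /=.
  case: eqP => [->|/eqP i0].
    by rewrite E2 !A0 !intrD intrN !intrM; ring.
  have -> : i = 1 by apply/val_inj; case: i i0 => -[|[]].
  by rewrite E1 !A0 !intrD !intrM; ring.
exists (rotmx a b), (toV v); split.
- apply/matrixP => i j; rewrite !mxE !big_ord_recl big_ord0 /= !mxE /=.
  have abR : (a%:~R * a%:~R + b%:~R * b%:~R : R) = 1 by rewrite -!intrM -intrD ab.
  case: i => -[|[|//]] hi; case: j => -[|[|//]] hj; rewrite /= ?intrN.
  + by rewrite -[RHS]abR; ring.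
  + by ring.
  + by ring.
  + by rewrite -[RHS]abR; ring.
- rewrite (expand_det_row _ 0) !big_ord_recl big_ord0 /= /cofactor !det_mx11 !mxE /= addr0.
  by rewrite expr0 mul1r expr1 mulN1r mulrN intrN mulNr opprK -!intrM -intrD ab.
- apply/seteqP; split=> y.
    by move=> [_ [x _ <-] <-]; rewrite -[x]ofVK rotmx_toV; eexists.
  move=> [x _ <-]; exists (inj (toV (gam a (- b) (0, 0) (ofV x)))); first by eexists.
  rewrite rotmx_toV -[in RHS](ofVK x); congr (inj (toV _)).
  case: (ofV x) => x1 x2; rewrite /gam /=.
  by case: (unit_cases ab) => -[-> ->]; congr (_, _); ring.
- move=> x; rewrite -[x]ofVK hg rotmx_toV; apply/colP => i; rewrite !mxE /gam /= !addr0.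
  by case: ifP => _; rewrite -intrD.
Qed.

Lemma Gamma_comp a b v g : a * a + b * b = 1 -> Gamma R g ->
  Gamma R (fun x => toV (gam a b v (ofV (g x)))).
Proof.
move=> ab /GammaP[a' [b' [v' [ab' hg]]]]; apply/GammaP.
exists (a * a' - b * b'), (b * a' + a * b'), (gam a b v v'); split.
  by case: (unit_cases ab) => -[-> ->]; case: (unit_cases ab') => -[-> ->].
move=> x; rewrite hg toVK; congr toV; rewrite /gam /=; congr (_, _); ring.
Qed.

Lemma Gamma_dist g x y : Gamma R g -> normoo (g x - g y) = normoo (x - y).
Proof.
move=> /GammaP[a [b [v [ab hg]]]]; rewrite -[x]ofVK -[y]ofVK !hg.
rewrite /normoo !big_ord_recl !big_ord0 !mxE /= /gam /=; case: (ofV x) (ofV y) => x1 x2 [y1 y2] /=.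
by case: (unit_cases ab) => -[-> ->]; rewrite !(mul1r, mul0r, mulN1r); lia.
Qed.

Lemma imfset_pair (K K' : choiceType) (h : K -> K') a b :
  [fset h x | x in [fset a; b]]%fset = [fset h a; h b]%fset.
Proof.
apply/fsetP => y; apply/imfsetP/idP => [[x /=]|].
  by rewrite !inE => /orP[]/eqP -> ->; rewrite eqxx ?orbT.
rewrite !inE => /orP[]/eqP ->; [exists a|exists b] => //=; by rewrite !inE eqxx ?orbT.
Qed.

Lemma Gamma_edge g x : Gamma R g -> edge lattice x -> exists e, [fset g y | y in x]%fset = edgeV e.
Proof.
move=> /GammaP[a [b [v [ab hg]]]] /edgeV_surj[e ->]; rewrite imfset_pair !hg.
have /adjp_edge[e' h] := gam_adjp v ab (adjp_ehead e).
by exists e'; rewrite /edgeV; case: h => -[-> ->] //; rewrite fsetUC.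
Qed.

End gamma.

(** * The model of an enhancement set *)

Section enhancement.
Variable R : realType.
Implicit Types (F : set (graph * graph)) (en : graph * graph).

(** Activation, in coordinates ([activatedE]). *)
Definition act (c : cfg) en (g : 'cV[int]_2 -> 'cV[int]_2) : Prop :=
  Gamma R g /\ forall e, edge (map_graph g en.1) (edgeV e) -> c e.

(** The edge set of the enhanced graph, in coordinates ([enhanced_edge]). *)
Definition zF F (c : cfg) : econf := fun e =>
  c e \/ exists en g, [/\ F en, act c en g & edge (map_graph g en.2) (edgeV e)].

(** What is known of each enhancement of the set in the theorem. *)
Record nice en : Prop := Nice {
  nice_enh : is_enhancement en;
  nice_lat : subgraph en.2 lattice;
  nice_con : connected_graph en.2;
  nice_0 : vert en.2 0
}.

Lemma activatedE F w en g : nice en ->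
  activated R F w en g <-> F en /\ act (cfg_of w) en g.
Proof.
move=> ne; split=> [[Fe Gg [_ h]]|[Fe [Gg h]]].
  split=> //; split=> // e /h /= [b bE wb].
  by rewrite /cfg_of (_ : bondof e = b) //; exact/val_inj.
split=> //; split=> //= x [y yT <-].
have [_ _ [_ hT] _ _] := nice_enh ne.
have [e eE] := Gamma_edge Gg (hT _ yT); exists (bondof e); first by rewrite eE.
by apply: h; exists y.
Qed.

Section enhanced_graph.
Variables (F : set (graph * graph)).
Hypothesis nF : forall en, F en -> nice en.

Lemma enhanced_edge w e : edge (enhanced R F w) (edgeV e) <-> zF F (cfg_of w) e.
Proof.
split=> /=.
  case=> [[b bE wb]|[en [g [act_ h]]]].
    by left; rewrite /cfg_of (_ : bondof e = b) //; exact/val_inj.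
  have Fe : F en by case: act_.
  by right; exists en, g; move: act_ => /(activatedE _ _ _ (nF Fe))[].
case=> [ce|[en [g [Fe a h]]]]; first by left; exists (bondof e).
by right; exists en, g; split => //; apply/activatedE => //; exact: nF.
Qed.

Lemma enhanced_lattice w x : edge (enhanced R F w) x -> exists e, x = edgeV e.
Proof.
move=> /= [[b -> _]|[en [g [[Fe Gg _] [y yS <-]]]]].
  by apply: edgeV_surj; have /set_mem := valP b.
have [_ hS] := nice_lat (nF Fe).
by have [e ->] := Gamma_edge Gg (hS _ yS); exists e.
Qed.

Lemma enhanced_adj w x y : adj (enhanced R F w) (toV x) (toV y) <-> link (zF F (cfg_of w)) x y.
Proof.
rewrite /adj; split.
  move=> h; have [e E] := enhanced_lattice h; move: h; rewrite E enhanced_edge => h.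
  move: E; rewrite /edgeV => /fset2_eq E.
  have {E} : (x = e.1 /\ y = ehead e) \/ (x = ehead e /\ y = e.1).
    by case: E => -[/toV_inj -> /toV_inj ->]; [left|right].
  by case: e h => -[a b] [] h; rewrite /ehead /= => -[[-> ->]|[-> ->]];
    [apply: Or43|apply: Or44|apply: Or41|apply: Or42].
have E e : zF F (cfg_of w) e -> edge (enhanced R F w) [fset toV e.1; toV (ehead e)]%fset.
  by move/enhanced_edge.
by case=> -[-> /E] //; rewrite fsetUC.
Qed.

Lemma enhanced_component w x y :
  clos_refl_trans _ (adj (enhanced R F w)) (toV x) (toV y) <-> conn (link (zF F (cfg_of w))) (fun=> True) x y.
Proof.
split=> [|xy]; last first.
  elim: xy => [_|u v _ IH uv _]; first exact: rt_refl.
  by apply: rt_trans IH _; apply: rt_step; apply/enhanced_adj.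
have : forall X Y, clos_refl_trans _ (adj (enhanced R F w)) X Y ->
    conn (link (zF F (cfg_of w))) (fun=> True) (ofV X) (ofV Y).
  move=> X Y; elim=> [u v|u|u v t _ h1 _ h2].
  - rewrite -{1}[u]ofVK -{1}[v]ofVK => /enhanced_adj uv.
    by apply: conn_step uv _ => //; exact: conn_refl.
  - exact: conn_refl.
  - exact: conn_trans h1 h2.
by move=> h /h; rewrite !toVK.
Qed.

Lemma sqball_finite M : finite_set [set X : 'cV[int]_2 | sqball M (ofV X)].
Proof.
pose pp (ij : 'I_(2 * M).+1 * 'I_(2 * M).+1) : 'cV[int]_2 := toV (Posz ij.1 - Posz M, Posz ij.2 - Posz M).
apply: (sub_finite_set (B := pp @` setT)); last by apply: finite_image; exact: finite_finset.
move=> X /=; rewrite -{2}[X]ofVK; case: (ofV X) => a b [/= ha hb].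
have i1 : (absz (a + Posz M)%R < (2 * M).+1)%N by lia.
have i2 : (absz (b + Posz M)%R < (2 * M).+1)%N by lia.
exists (Ordinal i1, Ordinal i2) => //; rewrite /pp /=; congr toV; congr (_, _); lia.
Qed.

(** A set of lattice points is infinite exactly when it is unbounded. All vertices are present,
    because they all belong to the open graph. *)
Lemma infinite_Inf w : has_infinite_component (enhanced R F w) <-> Inf (zF F (cfg_of w)).
Proof.
split=> [[X _ inf]|[x hx]].
  exists (ofV X) => M; apply: contrapT => hn; apply: inf.
  apply: sub_finite_set (sqball_finite M) => Y hY /=; apply: contrapT => hM; apply: hn.
  by exists (ofV Y); split => //; apply/enhanced_component; rewrite !ofVK.
exists (toV x); first by left.
move=> fin.
pose A := component (enhanced R F w) (toV x).
pose m := (\max_(X <- fset_set A) normoo X)%N.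
have [y [xy ym]] := hx m; apply: ym.
have : toV y \in fset_set A by rewrite in_fset_set // inE; apply/enhanced_component.
move=> /(@leq_bigmax_seq _ _ xpredT (fun X => normoo X) _) /(_ isT); rewrite -/m.
by rewrite /normoo !big_ord_recl !big_ord0 !mxE /= /sqball; clear; case: y => a b /=; lia.
Qed.

End enhanced_graph.

Lemma zF_mono F (c c' : cfg) : (forall e, c e -> c' e) -> forall e, zF F c e -> zF F c' e.
Proof.
move=> cc e [/cc|[en [g [Fe [Gg h] hS]]]]; first by left.
by right; exists en, g; split=> //; split=> // e' /h/cc.
Qed.

Lemma zF_sub F F' c e : (F `<=` F') -> zF F c e -> zF F' c e.
Proof. by move=> FF [ce|[en [g [/FF Fe a hS]]]]; [left|right; exists en, g]. Qed.

(** Lattice rotations preserve the supremum norm, so that each copy of [S] has the same diameter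
    as [S]. *)
Lemma act_close en g D x y : nice en -> Gamma R g -> (diamoo (vert en.2) < D)%N ->
  vert (map_graph g en.2) (toV x) -> vert (map_graph g en.2) (toV y) ->
  (`|x.1 - y.1| < D)%N /\ (`|x.2 - y.2| < D)%N.
Proof.
move=> ne Gg dD [a aS ax] [b bS bx].
have [_ [_ fin] _ _ _] := nice_enh ne.
have : (normoo (toV x - toV y) < D)%N.
  rewrite -ax -bx (Gamma_dist _ _ Gg); apply: leq_ltn_trans dD; rewrite /diamoo.
  have ha : a \in fset_set (vert en.2) by rewrite in_fset_set // inE.
  have hb : b \in fset_set (vert en.2) by rewrite in_fset_set // inE.
  apply: leq_trans (@leq_bigmax_seq _ _ xpredT (fun x : 'cV[int]_2 =>
    \max_(y <- fset_set (vert en.2)) normoo (x - y)%R)%N _ ha isT).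
  exact: (@leq_bigmax_seq _ _ xpredT (fun y : 'cV[int]_2 => normoo (a - y)%R) _ hb isT).
by rewrite /normoo !big_ord_recl !big_ord0 !mxE /=; clear; case: x y => ? ? [? ?] /=; lia.
Qed.

Lemma img_vert (G : graph) g e x : is_graph G -> edge (map_graph g G) (edgeV e) ->
  x \in edgeV e -> vert (map_graph g G) x.
Proof.
move=> iG [y yG yE]; rewrite -yE => /imfsetP[z /= zy ->].
by exists z => //; exact: (iG _ yG).2.
Qed.

Lemma act_close_edges en g D e e' : nice en -> Gamma R g -> (diamoo (vert en.2) < D)%N ->
  edge (map_graph g en.2) (edgeV e) -> edge (map_graph g en.2) (edgeV e') -> close_by D e e'.
Proof.
move=> ne Gg dD he he'; have [[_ iS] _ _ _ _] := nice_enh ne.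
have v := img_vert iS he (_ : toV e.1 \in _); have v' := img_vert iS he' (_ : toV e'.1 \in _).
have [] := act_close ne Gg dD (v' _) (v _); rewrite ?inE ?eqxx // /close_by => h1 h2.
by split; exact: ltnW.
Qed.

Lemma act_edge_sub en g e : nice en -> edge (map_graph g en.1) (edgeV e) -> edge (map_graph g en.2) (edgeV e).
Proof. by move=> ne [y yT yE]; exists y => //; have [_ _ _ _ [_ h]] := nice_enh ne; exact: h. Qed.

Lemma zF_loc F D : (forall en, F en -> nice en /\ (diamoo (vert en.2) < D)%N) ->
  forall (c c' : cfg) e, (forall e', close_by D e e' -> c e' = c' e') -> zF F c e -> zF F c' e.
Proof.
move=> hF c c' e cc [ce|[en [g [Fe [Gg h] hS]]]].
  by left; rewrite -cc // /close_by !subrr.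
right; exists en, g; split => //; split => // e' he'; have [ne dD] := hF _ Fe.
rewrite -cc; first exact: h.
exact: (act_close_edges ne Gg dD hS (act_edge_sub ne he')).
Qed.

Lemma imfset_injf (K K' : choiceType) (h : K -> K') (A B : {fset K}) : injective h ->
  [fset h x | x in A]%fset = [fset h x | x in B]%fset -> A = B.
Proof.
move=> hi E; apply/fsetP => x.
by rewrite -(mem_imfset imfset_key (mem A) hi) E mem_imfset.
Qed.

(** Copies of an enhancement are carried to copies by lattice motions. *)
Lemma act_transport c en g (hE : edge_t -> edge_t) (h : 'cV[int]_2 -> 'cV[int]_2) :
  injective h -> (forall e, edgeV (hE e) = [fset h x | x in edgeV e]%fset) ->
  Gamma R (h \o g) -> (forall e', exists e, e' = hE e) ->
  act (fun e => c (hE e)) en g -> act c en (h \o g).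
Proof.
move=> hi hV Gh surj [_ hT]; split => // e' [y yT yE]; have [e ee'] := surj e'; subst e'.
apply: hT; exists y => //; apply: (imfset_injf hi); rewrite -hV -yE.
by rewrite -imfset_comp.
Qed.

(** The group of lattice motions acts on the copies of each enhancement, hence enhancing commutes
    with it. *)
Lemma zF_equiv F (hE : edge_t -> edge_t) (h h' : 'cV[int]_2 -> 'cV[int]_2) :
  cancel h h' -> cancel h' h -> (forall e, edgeV (hE e) = [fset h x | x in edgeV e]%fset) ->
  (forall g, Gamma R g -> Gamma R (h \o g)) -> (forall g, Gamma R g -> Gamma R (h' \o g)) ->
  (forall e', exists e, e' = hE e) ->
  forall c e, zF F (fun e => c (hE e)) e <-> zF F c (hE e).
Proof.
move=> hK hK' hV Gh Gh' surj c e; split=> -[ce|[en [g [Fe a hS]]]]; try by left.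
  right; exists en, (h \o g); split=> //.
    by apply: (act_transport (can_inj hK) hV) => //; apply: Gh; case: a.
  by case: hS => y yS yE; exists y => //; rewrite hV -yE -imfset_comp.
right; exists en, (h' \o g); case: a => Gg hT; split=> //.
  split; first exact: Gh'.
  move=> e' [y yT yE]; apply: hT; exists y => //.
  rewrite hV -yE -imfset_comp; apply: eq_imfset => // x /=; by rewrite hK'.
case: hS => y yS yE; exists y => //; apply: (imfset_injf (can_inj hK)).
rewrite -hV -yE -imfset_comp; apply: eq_imfset => // x /=; by rewrite hK'.
Qed.

Lemma edgeV_gam a b v e : a * a + b * b = 1 ->
  [fset toV (gam a b v (ofV x)) | x in edgeV e]%fset =
  [fset toV (gam a b v e.1); toV (gam a b v (ehead e))]%fset.
Proof. by move=> ab; rewrite /edgeV imfset_pair !toVK. Qed.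

Lemma edgeV_shE v e : edgeV (shE v e) = [fset toV (gam 1 0 v (ofV x)) | x in edgeV e]%fset.
Proof.
rewrite edgeV_gam // /edgeV; congr [fset toV _; toV _]%fset; rewrite /gam /shE /ehead;
  case: e => -[x y] [] /=; congr (_, _); ring.
Qed.

Lemma edgeV_rotE e : edgeV (rotE e) = [fset toV (gam 0 1 (0, 0) (ofV x)) | x in edgeV e]%fset.
Proof.
rewrite edgeV_gam // /edgeV; case: e => -[x y] [] /=; rewrite /gam /rotE /rp /ehead /=.
  by rewrite fsetUC; congr [fset toV _; toV _]%fset; congr (_, _); ring.
by congr [fset toV _; toV _]%fset; congr (_, _); ring.
Qed.

Lemma shE_surj v e : exists e', e = shE v e'.
Proof. by exists (shE (- v.1, - v.2) e); case: e => -[a b] d; rewrite /shE /= !subrK. Qed.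

Lemma rotE_surj e : exists e', e = rotE e'.
Proof.
case: e => -[a b] []; first by exists ((b, - a), false); rewrite /rotE /rp /= opprK.
by exists ((b, - a - 1), true); rewrite /rotE /=; congr (_, _, _); ring.
Qed.

Lemma shift_inv v : cancel (fun x => toV (gam 1 0 v (ofV x))) (fun x => toV (gam 1 0 (- v.1, - v.2) (ofV x))).
Proof.
move=> x; rewrite toVK -[RHS]ofVK; congr toV; case: (ofV x) => x1 x2.
by rewrite /gam /=; congr (_, _); ring.
Qed.

Lemma shift_inv' v : cancel (fun x => toV (gam 1 0 (- v.1, - v.2) (ofV x))) (fun x => toV (gam 1 0 v (ofV x))).
Proof.
move=> x; rewrite toVK -[RHS]ofVK; congr toV; case: (ofV x) => x1 x2.
by rewrite /gam /=; congr (_, _); ring.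
Qed.

Lemma zF_model F D : (forall en, F en -> nice en /\ (diamoo (vert en.2) < D)%N) -> model (zF F) D.
Proof.
move=> hF; split.
- by move=> c c' cc; exact: zF_mono.
- exact: zF_loc.
- move=> c v e; apply: (zF_equiv _ (@shift_inv v) (@shift_inv' v) (edgeV_shE v)).
  + by move=> g; exact: Gamma_comp.
  + by move=> g; exact: Gamma_comp.
  + exact: shE_surj.
- move=> c e; apply: (@zF_equiv _ _ _ (fun x => toV (gam 0 (-1) (0, 0) (ofV x))) _ _ edgeV_rotE).
  + by move=> x; rewrite toVK -[RHS]ofVK; congr toV; case: (ofV x) => x1 x2; rewrite /gam /=; congr (_, _); ring.
  + by move=> x; rewrite toVK -[RHS]ofVK; congr toV; case: (ofV x) => x1 x2; rewrite /gam /=; congr (_, _); ring.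
  + by move=> g; exact: Gamma_comp.
  + by move=> g; exact: Gamma_comp.
  + exact: rotE_surj.
Qed.

End enhancement.

(** * Anchors and scales *)

Section anchors.
Variables (R : realType) (E : set (graph * graph)).
Hypothesis nE : forall en, E en -> nice en.

Lemma scaleE k en : scale E k en -> nice en /\ (2 ^ k <= diamoo (vert en.2) < 2 ^ k.+1)%N.
Proof. by move=> [/nE ne d]. Qed.

Lemma scale_upto_nice k en : scale_upto E k en -> nice en /\ (diamoo (vert en.2) < 2 ^ k.+1)%N.
Proof.
move=> [j /= jk /scaleE[ne /andP[_ d]]]; split=> //; apply: leq_trans d _.
by rewrite leq_exp2l.
Qed.

Lemma scale_upto_le i k : (i <= k)%N -> scale_upto E i `<=` scale_upto E k.
Proof. by move=> ik en [j /= ji h]; exists j => //=; exact: leq_trans ik. Qed.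

Lemma scale_upto_sub k : scale_upto E k `<=` E.
Proof. by move=> en [j _ []]. Qed.

Definition zk k : cfg -> econf := zF R (scale_upto E k).

Lemma zk_model k : model (zk k) (2 ^ k.+1).
Proof. by apply: zF_model => en /scale_upto_nice. Qed.

Lemma zk_le i k c e : (i <= k)%N -> zk i c e -> zk k c e.
Proof. by move=> ik; apply: zF_sub; exact: scale_upto_le. Qed.

(** An enhancement that belongs to no scale has diameter zero, hence adds no edge. *)
Lemma zF_union c e : zF R E c e <-> exists k, zk k c e.
Proof.
split=> [[ce|[en [g [Ee a hS]]]]|[k]]; [by exists 0%N; left| |by apply: zF_sub; exact: scale_upto_sub].
set d := diamoo (vert en.2).
have d0 : (0 < d)%N.
  rewrite lt0n; apply/negP => /eqP d0; have ne := nE Ee.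
  have [[_ iS] _ _ _ _] := nice_enh ne.
  have v := img_vert iS hS (_ : toV e.1 \in _); have v' := img_vert iS hS (_ : toV (ehead e) \in _).
  have [] := @act_close R en g 1 e.1 (ehead e) ne a.1 _ (v _) (v' _); rewrite ?inE ?eqxx ?orbT //.
    by rewrite -/d d0.
  by have := adjp_ehead e; rewrite /adjp; clear; lia.
exists (trunc_log 2 d); right; exists en, g; split=> //; exists (trunc_log 2 d) => //=; split=> //.
by rewrite -/d trunc_logP //= trunc_log_ltn.
Qed.

(** The event that the origin is the anchor of an activated copy; its translates describe the
    other anchors ([anchor_at], [at_anchor]). *)
Definition anch k (c : cfg) := exists en g, [/\ scale E k en, act R c en g & g 0 = 0].

Lemma anch_inc k : incE (anch k).
Proof.
move=> c c' cc [en [g [sE [Gg h] g0]]]; exists en, g; split=> //; split=> // e' /h; exact: cc.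
Qed.

Lemma toV0 : toV (0, 0) = 0.
Proof. by apply/colP => i; rewrite !mxE; case: ifP. Qed.

Lemma anch_supp k : supp (inbox (2 ^ k.+1)) (anch k).
Proof.
move=> c c' cc [en [g [sE [Gg h] g0]]]; exists en, g; split=> //; split=> // e' he'.
have [ne /andP[_ d]] := scaleE sE; have [[_ iS] _ _ _ _] := nice_enh ne.
rewrite -cc; first exact: h.
have v := img_vert iS (act_edge_sub ne he') (_ : toV e'.1 \in _).
have v0 : vert (map_graph g en.2) (toV (0, 0)) by exists 0; [exact: nice_0|rewrite g0 toV0].
have [] := act_close ne Gg d (v _) v0; rewrite ?inE ?eqxx //= !subr0 => h1 h2.
by apply/andP; split; exact: ltnW.
Qed.

Lemma Gamma_toV g v : Gamma R g -> Gamma R (fun x => toV (gam 1 0 v (ofV (g x)))).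
Proof. exact: Gamma_comp. Qed.

Lemma act_shift c en g v : act R (fun e => c (shE v e)) en g ->
  act R c en (fun x => toV (gam 1 0 v (ofV (g x)))).
Proof.
move=> a; apply: (act_transport (can_inj (@shift_inv v)) (edgeV_shE v)) => //.
  by apply: Gamma_toV; case: a.
exact: shE_surj.
Qed.

Lemma anchor_at c k en g v : scale E k en -> act R c en g -> g 0 = toV v ->
  anch k (fun e => c (shE v e)).
Proof.
move=> sE a gv; exists en, (fun x => toV (gam 1 0 (- v.1, - v.2) (ofV (g x)))); split=> //.
  apply: act_shift; rewrite (_ : (fun e => _) = c) //.
  apply/funext => -[[x y] d]; rewrite /shE /=; congr (c (_, _, _)); ring.
rewrite gv toVK -[RHS]toV0; congr toV; rewrite /gam /=; congr (_, _); ring.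
Qed.

Lemma at_anchor c k v : anch k (fun e => c (shE v e)) ->
  exists en g, [/\ scale E k en, act R c en g & g 0 = toV v].
Proof.
move=> [en [g [sE a g0]]]; exists en, (fun x => toV (gam 1 0 v (ofV (g x)))); split=> //.
  exact: act_shift.
rewrite g0 -toV0 toVK; congr toV; case: v {a} => v1 v2; rewrite /gam /=; congr (_, _); ring.
Qed.

Lemma normoo_toV v : normoo (toV v) = maxn `|v.1| `|v.2|.
Proof. by rewrite /normoo !big_ord_recl !big_ord0 !mxE /=; lia. Qed.

(** This puts the anchor event in the form to which [amp_torus] applies. *)
Lemma anchor_eventE k w : anchor_event R E k w <-> window (2 ^ k) (anch k) (cfg_of w).
Proof.
split=> [[en [g [a gN]]]|[v [v1 v2 /at_anchor[en [g [sE a gv]]]]]].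
  have ne : nice en by case: a => /scaleE[].
  have [sE a'] : scale E k en /\ act R (cfg_of w) en g by move/(activatedE _ _ _ _ ne): a.
  exists (ofV (g 0)); move: gN; rewrite -{1}[g 0]ofVK normoo_toV geq_max => /andP[h1 h2]; split=> //.
  by apply: anchor_at a' _ => //; rewrite ofVK.
exists en, g; split; last by rewrite gv normoo_toV geq_max v1.
by apply/activatedE => //; case: (scaleE sE).
Qed.

(** The anchor belongs to the copy of [S] to which an added edge belongs, so it is near that
    edge. Without nearby anchors of larger scales, the graphs of different scales agree. *)
Lemma zk_compare i k c e : zk k c e -> zk i c e \/
  exists j v, [/\ (i < j <= k)%N, (`|v.1 - e.1.1| <= 2 ^ j.+1)%N, (`|v.2 - e.1.2| <= 2 ^ j.+1)%N &
    anch j (fun e => c (shE v e))].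
Proof.
move=> [ce|[en [g [[j /= jk sE] a hS]]]]; first by left; left.
have [ji|ij] := leqP j i; first by left; right; exists en, g; split=> //; exists j.
right; exists j, (ofV (g 0)); have [ne /andP[_ d]] := scaleE sE.
have [[_ iS] _ _ _ _] := nice_enh ne.
have v := img_vert iS hS (_ : toV e.1 \in _).
have v0 : vert (map_graph g en.2) (toV (ofV (g 0))) by exists 0; [exact: nice_0|rewrite ofVK].
have [] := act_close ne a.1 d v0 (v _); rewrite ?inE ?eqxx // => h1 h2.
split; [by rewrite ij|exact: ltnW|exact: ltnW|].
by apply: anchor_at sE a _; rewrite ofVK.
Qed.

Lemma diam_attained (A : set 'cV[int]_2) d : finite_set A -> (0 < d)%N -> (d <= diamoo A)%N ->
  exists x y, [/\ A x, A y & (d <= normoo (x - y))%N].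
Proof.
move=> fin d0 dA; apply: contrapT => hn; move: dA; rewrite leqNgt => /negP; apply.
rewrite -(prednK d0) ltnS /diamoo; apply/bigmax_leqP_seq => x xA _; apply/bigmax_leqP_seq => y yA _.
rewrite -ltnS prednK // ltnNge; apply/negP => h; apply: hn; exists x, y; split=> //.
  by move: xA; rewrite in_fset_set // inE.
by move: yA; rewrite in_fset_set // inE.
Qed.

(** The copy of [S] attached to the anchor is connected, open, and at least [2 ^ k] wide. *)
Lemma anchored_conn k c : window (2 ^ k) (anch k) c ->
  exists x y : pt, conn (link (zk k c)) (sqball (3 * 2 ^ k)) x y /\
    ((2 ^ k <= `|x.1 - y.1|)%N \/ (2 ^ k <= `|x.2 - y.2|)%N).
Proof.
move=> [v [v1 v2 /at_anchor[en [g [sE a gv]]]]].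
have [ne /andP[dl d]] := scaleE sE; have [[_ iS] [_ fin] _ _ _] := nice_enh ne.
have k0 : (0 < 2 ^ k)%N by rewrite expn_gt0.
have [X [Y [XS YS XY]]] := diam_attained fin k0 dl.
exists (ofV (g X)), (ofV (g Y)); split; last first.
  move: XY; rewrite -(Gamma_dist _ _ a.1) -{1}[g X]ofVK -{1}[g Y]ofVK.
  rewrite /normoo !big_ord_recl !big_ord0 !mxE /=; case: (ofV (g X)) (ofV (g Y)) => ? ? [? ?] /=.
  by clear; lia.
have v0 : vert (map_graph g en.2) (toV v) by exists 0; [exact: nice_0|].
have inb Z : vert en.2 Z -> sqball (3 * 2 ^ k) (ofV (g Z)).
  move=> ZS; have vZ : vert (map_graph g en.2) (toV (ofV (g Z))) by exists Z; rewrite ?ofVK.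
  have [] := act_close ne a.1 d vZ v0; rewrite /sqball expnS; move: v1 v2; clear.
  by case: (ofV (g Z)) => ? ? /=; lia.
have := nice_con ne XS YS; rewrite /component /=.
have main : forall X Y, clos_refl_trans _ (adj en.2) X Y -> vert en.2 X ->
    vert en.2 Y /\ conn (link (zk k c)) (sqball (3 * 2 ^ k)) (ofV (g X)) (ofV (g Y)).
  move=> {X Y XS YS XY} X Y; elim=> [U V UV US|U US|U V W _ h1 _ h2 US].
  - have VS : vert en.2 V by apply: (iS _ UV).2; rewrite !inE eqxx orbT.
    split=> //; apply: (conn_step (y := ofV (g U))); [exact: conn_refl (inb _ US)| |exact: inb].
    have [e eE] := Gamma_edge a.1 ((nice_lat ne).2 _ UV).
    have ze : zk k c e.
      by right; exists en, g; split=> //; [exists k => //=|exists [fset U; V]%fset].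
    move: eE; rewrite imfset_pair /edgeV -{1}[g U]ofVK -{1}[g V]ofVK => /fset2_eq E'.
    have {E'} : (ofV (g U) = e.1 /\ ofV (g V) = ehead e) \/ (ofV (g U) = ehead e /\ ofV (g V) = e.1).
      by case: E' => -[/toV_inj -> /toV_inj ->]; [left|right].
    by case: e ze => -[? ?] [] ze; rewrite /ehead /= => -[[-> ->]|[-> ->]];
      [apply: Or43|apply: Or44|apply: Or41|apply: Or42].
  - by split=> //; exact: conn_refl (inb _ US).
  - have [VS c1] := h1 US; have [WS c2] := h2 VS; split=> //; exact: conn_trans c1 c2.
by move=> /main/(_ XS)[].
Qed.

End anchors.

(** * Choosing scales *)

Lemma select_scales (T : pred nat) (a n q : nat) : (q < count T (iota a n))%N ->
  exists e : nat -> nat, (forall i, (i <= q)%N -> (a <= e i < a + n)%N && T (e i)) /\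
    (forall i, (i < q)%N -> (e i < e i.+1)%N).
Proof.
move=> hq; pose s := seq.filter T (iota a n).
have ss : (q < size s)%N by rewrite size_filter.
have so : sorted ltn s by apply: sorted_filter; [exact: ltn_trans|exact: iota_ltn_sorted].
exists (nth 0%N s); split=> i iq.
  have : nth 0%N s i \in s by rewrite mem_nth // (leq_ltn_trans iq).
  by rewrite mem_filter mem_iota => /andP[-> ->].
apply: (sorted_ltn_nth ltn_trans 0%N so) => //; rewrite inE //.
  exact: ltn_trans ss.
exact: leq_ltn_trans ss.
Qed.

Lemma rsw_pow (R : realType) (pr : (econf -> Prop) -> R) (th : R) (m a n q : nat) :
  rsw_law pr -> 0 < th -> th < 1 -> (0 < m)%N ->
  (forall e, (e < a + n)%N -> (2 * 2 ^ e + 1 < m ^ q)%N) ->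
  (q < count (fun e => (1 - th ^+ (4 * m) <= pr (hcross (2 ^ e) (0, 0)))%R) (iota a n))%N ->
  exists2 e, (a <= e < a + n)%N & (1 - th) ^+ chain_exp <= pr (hrect (160 * 2 ^ e) (8 * 2 ^ e)).
Proof.
move=> H th0 th1 m0 hm /select_scales[e [he lee]].
have hN i : (i <= q)%N -> 1 - th ^+ (4 * m) <= pr (hcross (2 ^ e i) (0, 0)) by move=> /he/andP[].
have N0 : (0 < 2 ^ e 0)%N by rewrite expn_gt0.
have N2 i : (i < q)%N -> (2 * 2 ^ e i <= 2 ^ e i.+1)%N by move=> iq; rewrite -expnS leq_exp2l // lee.
have Nq : (2 * 2 ^ e q + 1 < m ^ q)%N by apply: hm; have /andP[/andP[_]] := he q (leqnn _).
have [i iq hi] := rsw (N := fun i => 2 ^ e i)%N H th0 th1 m0 N0 N2 Nq hN.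
by exists (e i) => //; have /andP[] := he i iq.
Qed.

Lemma square_dual N zt : ~ hcross N (0, 0) zt -> vcross N (0, 0) (dual zt).
Proof.
move=> nh; have [] := @crossing_dual zt N.
  move=> [l [r [hl hr lr]]]; apply: nh; exists l, r; split=> //=; rewrite ?hl ?hr; lia.
move=> u [v [hu hv uv]].
have [] := clip_tb uv (a := - N%:Z) (b := N%:Z); [lia|lia|lia|].
move=> l [r [hl hr lr]]; exists l, r; split=> /=; [lia|lia|].
by apply: conn_weak lr => z; rewrite /inQ /=; lia.
Qed.

Lemma pr_hcross (R : realType) (pr : (econf -> Prop) -> R) N : rsw_law pr ->
  pr (vcross N (0, 0)) <= pr (hcross N (0, 0)).
Proof.
move=> H; apply: (rsw_le_rot H); [exact: good_vcross|exact: good_hcross|].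
move=> zt [l [r [/= hl hr lr]]]; exists (rp r), (rp l); split; rewrite /rp /=; [lia|lia|].
by apply: conn_linkS; apply: conn_rot lr => y /inQ_rp; rewrite /rp /= oppr0.
Qed.

Section dichotomy.
Variables (R : realType) (P : R -> probability config R).
Hypothesis hP : forall p : R, 0 <= p <= 1 -> bernoulli_percolation p (P p).
Variables (p : R) (f : cfg -> econf) (r0 : nat).
Hypotheses (p01 : 0 <= p <= 1) (fm : model f r0).

Let pr F := prb P p (fun c => F (f c)).
Let prd F := prb P p (fun c => F (dual (f c))).

Lemma dual_square N : 1 - pr (hcross N (0, 0)) <= prd (hcross N (0, 0)).
Proof.
have Hd := dual_law hP p01 fm.
apply: le_trans (pr_hcross N Hd).
rewrite /pr -prbC; last exact: (model_local fm (good_hcross _ _)).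
apply: prb_mono.
- exact: (localC (model_local fm (good_hcross N (0, 0)))).
- exact: (model_dlocal fm (good_vcross N (0, 0))).
by move=> c; exact: square_dual.
Qed.

(** Each square is crossed horizontally by the graph or vertically by its dual. So among [2 * q +
    1] consecutive scales there are [q + 1] at which the squares are likely to be crossed by the
    graph, or [q + 1] at which they are likely to be crossed by the dual, and [rsw] applies to
    one of the two. *)
Lemma dichotomy (th1 th2 : R) (m a q : nat) : 0 < th1 < 1 -> 0 < th2 < 1 -> (0 < m)%N ->
  1 - th2 ^+ (4 * m) <= th1 ^+ (4 * m) ->
  (forall e, (e < a + (2 * q).+1)%N -> (2 * 2 ^ e + 1 < m ^ q)%N) ->
  exists2 e, (a <= e < a + (2 * q).+1)%N &
    (1 - th1) ^+ chain_exp <= pr (hrect (160 * 2 ^ e) (8 * 2 ^ e)) \/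
    (1 - th2) ^+ chain_exp <= prd (hrect (160 * 2 ^ e) (8 * 2 ^ e)).
Proof.
move=> /andP[h10 h11] /andP[h20 h21] m0 hth hm.
pose T e := (1 - th1 ^+ (4 * m) <= pr (hcross (2 ^ e) (0, 0)))%R.
have [hT|hT] := ltnP q (count T (iota a (2 * q).+1)).
  have [e he h] := rsw_pow (primal_law hP p01 fm) h10 h11 m0 hm hT.
  by exists e => //; left.
pose T' e := (1 - th2 ^+ (4 * m) <= prd (hcross (2 ^ e) (0, 0)))%R.
have hT' : (q < count T' (iota a (2 * q).+1))%N.
  have h1 := count_predC T (iota a (2 * q).+1); rewrite size_iota in h1.
  have h2 : (count (predC T) (iota a (2 * q).+1) <= count T' (iota a (2 * q).+1))%N.
    apply: sub_count => e /=; rewrite /T /T' -ltNge => h.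
    by apply: le_trans hth _; apply: le_trans (dual_square _); move: h; lra.
  by move: h1 h2 hT; clear; lia.
have [e he h] := rsw_pow (dual_law hP p01 fm) h20 h21 m0 hm hT'.
by exists e => //; right.
Qed.

End dichotomy.

Lemma bernoulli_ineq (R : realFieldType) (x : R) n : 0 <= x <= 1 -> 1 - n%:R * x <= (1 - x) ^+ n.
Proof.
move=> /andP[x0 x1]; elim: n => [|n IH]; first by rewrite mul0r subr0 expr0.
rewrite exprS; apply: le_trans (ler_wpM2l (_ : 0 <= 1 - x) IH); last by lra.
rewrite -natr1; have : 0 <= n%:R * x * x by rewrite !mulr_ge0.
lra.
Qed.

Lemma expr_small (R : realType) (x y : R) : 0 <= x -> x < 1 -> 0 < y ->
  exists n0, forall n, (n0 <= n)%N -> x ^+ n <= y.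
Proof.
move=> x0 x1 y0; have := @cvg_expr R x; rewrite ger0_norm // => /(_ x1).
move=> /cvgrPdist_le/(_ y y0)[n0 _ h]; exists n0 => n hn.
by have := h n hn; rewrite /= sub0r normrN ger0_norm // exprn_ge0.
Qed.

(** * Windows of different sizes *)

Section windows.
Variables (R : realType) (P : R -> probability config R).
Hypothesis hP : forall p : R, 0 <= p <= 1 -> bernoulli_percolation p (P p).

Lemma prb_bigU p (I : eqType) (s : seq I) (A : I -> cfg -> Prop) (x : R) :
  (forall i, local (A i)) -> (forall i, prb P p (A i) <= x) ->
  exists B, [/\ local B, prb P p B <= (size s)%:R * x &
    forall c i, i \in s -> A i c -> B c].
Proof.
move=> lA hA; elim: s => [|i s [B [lB pB hB]]].
  by exists (fun=> False); split => //; [exists 0%N|rewrite mul0r prb_False].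
exists (fun c => A i c \/ B c); split; first exact: localU.
  by apply: le_trans (prb_union P p (lA i) lB) _; rewrite /= -natr1 mulrDl mul1r addrC lerD.
by move=> c j; rewrite inE => /orP[/eqP ->|/hB h]; [left|right; apply: h].
Qed.

(** A large window is covered by [M ^ 2] translates of a small one. *)
Lemma window_union p B n n' r M : 0 <= p <= 1 -> supp (inbox r) B -> (2 * n' + 1 <= M * (2 * n + 1))%N ->
  prb P p (window n' B) <= (M ^ 2)%:R * prb P p (window n B).
Proof.
move=> p01 sB hM.
have lW k : local (window k B) by exists (k + r)%N; exact: window_supp.
pose ctr (i : 'I_M) : int := Posz (i * (2 * n + 1) + n) - Posz n'.
pose A (ij : 'I_M * 'I_M) (c : cfg) := window n B (fun e => c (shE (ctr ij.1, ctr ij.2) e)).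
have lA ij : local (A ij).
  exists (n + r + `|ctr ij.1| + `|ctr ij.2|)%N => c c' h; apply: (window_supp sB) => e he.
  by apply: h; move: he; rewrite /inbox /shE /=; clear; lia.
have pA ij : prb P p (A ij) <= prb P p (window n B).
  by rewrite (prb_bij hP p01 (@shE_inj (ctr ij.1, ctr ij.2)) (lW n)).
have [C [lC pC hC]] := @prb_bigU p _ (enum {: 'I_M * 'I_M}) A _ lA pA.
rewrite -cardE card_prod card_ord mulnn in pC.
apply: le_trans pC; apply: prb_mono => //.
move=> c [v [v1 v2 b]].
have cover (x : int) : (`|x| <= n')%N -> exists (i : 'I_M) (y : int), (`|y| <= n)%N /\ x = ctr i + y.
  move=> hx; pose u := absz (x + Posz n').
  have uM : (u %/ (2 * n + 1) < M)%N.
    rewrite ltn_divLR; last by rewrite addn1.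
    by apply: leq_trans hM; rewrite /u; move: hx; clear; lia.
  exists (Ordinal uM), (Posz (u %% (2 * n + 1)) - Posz n); rewrite /ctr /=.
  have h1 := divn_eq u (2 * n + 1); have h2 : (u %% (2 * n + 1) < 2 * n + 1)%N by rewrite ltn_mod addn1.
  split; first by move: h2; clear; lia.
  move: h1 hx; rewrite /u; clear; lia.
have [i [y1 [hy1 E1]]] := cover _ v1; have [j [y2 [hy2 E2]]] := cover _ v2.
apply: (hC c (i, j)).
  by rewrite mem_enum.
exists (y1, y2); split=> //; congr (B _): b; apply/funext => e; congr c.
by rewrite /shE /= -!addrA (addrC y1) (addrC y2) -E1 -E2.
Qed.

End windows.

(** * Below the threshold *)

Lemma limsup0_lt (R : realType) (u : nat -> \bar R) (eps : R) : limn_esup u = 0%E -> 0 < eps ->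
  exists n0, forall n, (n0 <= n)%N -> (u n < eps%:E)%E.
Proof.
rewrite /limn_esup /limf_esup => u0 e0.
have : (ereal_inf [set ereal_sup (u @` V) | V in \oo] < eps%:E)%E by rewrite u0 lte_fin.
move=> /ereal_inf_lt[_ [A [N _ hA] <-] h]; exists N => n Nn; apply: le_lt_trans h.
by apply: ereal_sup_ubound; exists n => //; exact: hA.
Qed.

Lemma limsup0_le (R : realType) (u : nat -> \bar R) : (forall n, 0 <= u n)%E ->
  (forall eps : R, 0 < eps -> exists n0, forall n, (n0 <= n)%N -> (u n <= eps%:E)%E) ->
  limn_esup u = 0%E.
Proof.
move=> u0 h; apply/eqP; rewrite eq_le; apply/andP; split; last first.
  by apply: limf_esup_ge0 => //; move=> [N _ /(_ N (leqnn N))].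
apply/lee_addgt0Pr => e e0; rewrite add0e; have [n0 hn0] := h e e0.
apply: le_trans (_ : ereal_sup (u @` [set n | (n0 <= n)%N]) <= _)%E.
  by apply: ereal_inf_lbound; exists [set n | (n0 <= n)%N] => //; exists n0.
by apply: ge_ereal_sup => _ [n /= hn <-]; exact: hn0.
Qed.

Lemma mu_up (R : realType) (mu : probability config R) (A : nat -> set config) (x : \bar R) :
  (forall n, measurable (A n)) -> (forall n, A n `<=` A n.+1) ->
  (x < mu (\bigcup_n A n))%E -> exists n, (x < mu (A n))%E.
Proof.
move=> mA incA hx; apply: contrapT => hn.
have h n : (mu (A n) <= x)%E by rewrite leNgt; apply/negP => hlt; apply: hn; exists n.
have c : mu \o A @ \oo --> mu (\bigcup_n A n).
  apply: nondecreasing_cvg_mu => //; first exact: bigcup_measurable.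
  by apply/nondecreasing_seqP => n; apply/subsetPset; exact: incA.
move: hx; rewrite ltNge => /negP; apply.
rewrite -(cvg_lim _ c) //; apply: lime_le; first by apply/cvg_ex; eexists; exact: c.
by exists 0%N => // n _; exact: h.
Qed.

(** The choice of [th] that makes the crossing probability of [rsw] close to one. *)
Lemma near_one (R : realType) (n : nat) (y : R) : 0 < y < 1 ->
  exists th : R, 0 < th < 1 /\ 1 - y <= (1 - th) ^+ n.
Proof.
move=> /andP[y0 y1]; have n0 : 0 < n.+1%:R :> R by rewrite ltr0n.
exists (y / n.+1%:R); have h : 0 < y / n.+1%:R < 1.
  by rewrite divr_gt0 //= ltr_pdivrMr // mul1r (lt_le_trans y1) // ler1n.
split=> //; apply: le_trans (bernoulli_ineq n (_ : _ <= _ <= 1)); last by case/andP: h => h1 h2; rewrite !ltW.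
rewrite lerD2l lerN2 mulrCA ler_piMr // ?(ltW y0) // ler_pdivrMr // mul1r ler_nat.
exact: leqnSn.
Qed.

(** The choice of [th2] that satisfies the hypothesis of [dichotomy] for a given [th1]; it may be
    close to one, which still gives a positive probability of long dual crossings. *)
Lemma dual_parameter (R : realType) (n : nat) (th : R) : (0 < n)%N -> 0 < th < 1 ->
  exists th2 : R, 0 < th2 < 1 /\ 1 - th2 ^+ n <= th ^+ n.
Proof.
move=> n0 /andP[th0 th1].
have hy : 0 < th ^+ n < 1 by rewrite exprn_gt0 //= exprn_ilt1 // ?ltW // -lt0n.
have [x [h1 h2]] := near_one n hy.
exists (1 - x); split; first by move: h1; lra.
by move: h2; lra.
Qed.

Lemma geometric_tail (R : realType) (C rho y : R) : 0 <= C -> 0 <= rho -> rho < 1 -> 0 < y ->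
  exists n0, forall i, (n0 <= i)%N -> C * rho ^+ i / (1 - rho) <= y.
Proof.
move=> C0 r0 r1 y0.
have z0 : 0 < y * (1 - rho) / (C + 1) by rewrite divr_gt0 ?mulr_gt0 ?subr_gt0 // ltr_wpDl.
have [n1 h] := expr_small r0 r1 z0; exists n1 => i /h hi.
rewrite ler_pdivrMr ?subr_gt0 //.
have C1 : 0 < C + 1 by rewrite ltr_wpDl.
move: hi; rewrite ler_pdivlMr // => hi; apply: le_trans hi.
by rewrite mulrC ler_wpM2l ?exprn_ge0 // lerDl.
Qed.

Section subcritical.
Variables (R : realType) (P : R -> probability config R).
Hypothesis hP : forall p : R, 0 <= p <= 1 -> bernoulli_percolation p (P p).
Variables (E : set (graph * graph)).
Hypothesis nE : forall en, E en -> nice en.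

Let G k := window (2 ^ k) (anch R E k).

Lemma G_local k : local (G k).
Proof. by exists (2 ^ k + 2 ^ k.+1)%N; apply: window_supp; exact: anch_supp. Qed.

Lemma prb_anchor p k : P p (anchor_event R E k) = (prb P p (G k))%:E.
Proof.
rewrite -(prbK P p (G_local k)); congr (P p _).
by apply/seteqP; split=> w /= /(anchor_eventE R nE).
Qed.

(** There is room for the sharp threshold: anchor events are still negligible at some larger
    parameter. *)
Lemma below_threshold p : 0 <= p <= 1 -> p < q_c P E ->
  exists2 p', p < p' <= 1 & limn_esup (fun k => P p' (anchor_event R E k)) = 0%E.
Proof.
move=> /andP[p0 p1]; rewrite /q_c; set S := [set _ | _] => hp.
have S0 : S !=set0.
  apply/set0P/negP => /eqP S0; move: hp; rewrite S0 sup0; lra.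
by have [p' [/andP[p'0 p'1] h] pp'] := sup_gt S0 hp; exists p' => //; rewrite pp' p'1.
Qed.

(** At a parameter larger than [p] the anchor events have small probability. By [amp_torus], on a
    torus of side comparable to [2 ^ k], their probability at [p] is then at most a negative
    power of [2 ^ k], that is, exponentially small in [k]. *)
Lemma anchor_decay p : 0 <= p <= 1 -> p < q_c P E ->
  exists rho : R, [/\ 0 <= rho, rho < 1 &
    exists k1, forall k, (k1 <= k)%N -> prb P p (G k) <= 2 * rho ^+ k].
Proof.
move=> p01 /(below_threshold p01)[p' /andP[pp' p'1] lim0].
have /andP[p0 p1] := p01; have p'01 : 0 <= p' <= 1 by lra.
pose d := (p' - p) / 3; have d0 : 0 < d by rewrite /d; lra.
have ln20 : 0 < ln (2 : R) by rewrite ln_gt0 // ltr1n.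
exists (expR (- d * ln 2)); split; [exact: expR_ge0|by rewrite expR_lt1 mulNr oppr_lt0 mulr_gt0|].
have e0 : (0 : R) < 32^-1 by rewrite invr_gt0.
have [k1 hk1] := limsup0_lt lim0 e0; exists k1 => k /hk1; rewrite prb_anchor lte_fin => hk.
have [l lE] : exists l, (l.+1 = 8 * 2 ^ k)%N by exists (8 * 2 ^ k).-1; rewrite prednK // muln_gt0 expn_gt0.
have h1 : (2 * (2 ^ k + 2 ^ k.+1) + 1 <= l.+1)%N.
  by rewrite lE expnS; have : (0 < 2 ^ k)%N by [rewrite expn_gt0]; clear; lia.
have h2 : (l.+1 <= 4 * (2 * 2 ^ k + 1))%N by rewrite lE; clear; lia.
have := amp_torus hP p0 (ltW pp') p'1 (@anch_inc R E k) (anch_supp nE (k := k)) h1 h2.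
rewrite -/(G k); set x := prb P p (G k); set y := prb P p' (G k) in hk *.
have x0 : 0 <= x by exact: prb_ge0.
have y0 : 0 <= y by exact: prb_ge0.
have y1 : 1 / 2 <= (1 - y) ^+ (4 ^ 2).
  apply: le_trans (bernoulli_ineq (4 ^ 2) _); last by move: hk; lra.
  by rewrite (_ : (4 ^ 2)%N = 16%N) //; move: hk; lra.
have -> : expR (- (p' - p) / 3 * ln (l.+1)%:R) = expR (- d * ln (8 : R)) * expR (- d * ln 2) ^+ k.
  rewrite lE natrM natrX lnM ?posrE ?exprn_gt0 ?ltr0n // lnXn // -expRM_natl -expRD; congr expR.
  by rewrite /d -mulr_natl; lra.
have e8 : expR (- d * ln (8 : R)) <= 1.
  by rewrite expR_le1 mulNr oppr_le0 mulr_ge0 ?(ltW d0) // ln_ge0 // ler1n.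
have z0 : 0 <= expR (- d * ln 2) ^+ k by rewrite exprn_ge0 // expR_ge0.
set z := _ ^+ k in z0 *; set t := expR _ in e8 *; move: e8 => t1 h.
have : x * (1 / 2) <= x * (1 - y) ^+ (4 ^ 2) by rewrite ler_wpM2l.
have : t * z <= 1 * z by rewrite ler_wpM2r.
lra.
Qed.

(** The exponential decay in [anchor_decay] survives the union bound over the translates in a
    larger window and over all scales beyond [i]. *)
Lemma near_prob p (rho : R) k1 (eps : R) : 0 <= p <= 1 -> 0 <= rho -> rho < 1 -> 0 < eps ->
  (forall k, (k1 <= k)%N -> prb P p (G k) <= 2 * rho ^+ k) ->
  exists i0, forall i k, (i0 <= i)%N -> exists B, [/\ local B, prb P p B <= eps &
    forall j c, (i < j <= k)%N -> window (200 * 2 ^ j) (anch R E j) c -> B c].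
Proof.
move=> p01 r0 r1 e0 hG.
have [C [C0 hC]] : exists C : R, 0 <= C /\
    forall j, (k1 <= j)%N -> prb P p (window (200 * 2 ^ j) (anch R E j)) <= C * rho ^+ j.
  exists ((200 ^ 2)%:R * 2); split; first by rewrite mulr_ge0.
  move=> j kj; have hM : (2 * (200 * 2 ^ j) + 1 <= 200 * (2 * 2 ^ j + 1))%N by clear; lia.
  apply: le_trans (window_union hP p01 (anch_supp nE (k := j)) hM) _.
  by rewrite -mulrA ler_wpM2l //; exact: hG.
have [i1 hi1] := geometric_tail C0 r0 r1 e0; exists (maxn i1 k1) => i k; rewrite geq_max => /andP[ii ki].
suff [B [lB pB hB]] : exists B, [/\ local B, prb P p B * (1 - rho) <= C * (rho ^+ i.+1 - rho ^+ (i + k).+1) &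
    forall j c, (i < j <= i + k)%N -> window (200 * 2 ^ j) (anch R E j) c -> B c].
  exists B; split => //; last first.
    by move=> j c /andP[ij jk]; apply: hB; rewrite ij (leq_trans jk) // leq_addl.
  apply: le_trans (hi1 i ii); rewrite ler_pdivlMr ?subr_gt0 //; apply: le_trans pB _; rewrite ler_wpM2l //.
  have h1 : 0 <= rho ^+ (i + k).+1 by rewrite exprn_ge0.
  have h2 : rho ^+ i.+1 <= rho ^+ i by rewrite exprS ler_piMl ?exprn_ge0 // ltW.
  by move: h1 h2; lra.
elim: k => [|k [B [lB pB hB]]].
  exists (fun=> False); split; [by exists 0%N|by rewrite prb_False mul0r addn0 subrr mulr0|].
  by move=> j c; rewrite addn0; case/andP=> h1 h2; move: (leq_trans h1 h2); rewrite ltnn.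
set j0 := (i + k).+1; pose W := window (200 * 2 ^ j0) (anch R E j0).
have lW : local W by exists (200 * 2 ^ j0 + 2 ^ j0.+1)%N; apply: window_supp; exact: anch_supp.
have pW : prb P p W <= C * rho ^+ j0 by apply: hC; rewrite /j0 (leq_trans ki) // leqW // leq_addr.
exists (fun c => B c \/ W c); split; first exact: localU.
  apply: le_trans (_ : (prb P p B + prb P p W) * (1 - rho) <= _).
    by rewrite ler_wpM2r ?subr_ge0 ?(ltW r1) //; exact: (prb_union P p lB lW).
  rewrite mulrDl addnS -/j0 [rho ^+ j0.+1]exprS.
  have : prb P p W * (1 - rho) <= C * rho ^+ j0 * (1 - rho) by rewrite ler_wpM2r // subr_ge0 ltW.
  move: pB; rewrite -/j0; move: (prb P p B * _) (prb P p W * _) (rho ^+ j0) (rho ^+ i.+1) => a b c d; lra.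
move=> j c /andP[ij jk] w; have [jj|jj] := leqP j (i + k).
  by left; apply: hB w; rewrite ij.
by right; rewrite /W (_ : j0 = j) // /j0; lia.
Qed.

(** The box of radius [168 * 2 ^ i] around the rectangle and the range of the scale [j] fit into
    the window of radius [200 * 2 ^ j]. *)
Lemma compare_hrect i k c : (i <= k)%N ->
  (forall j, (i < j <= k)%N -> ~ window (200 * 2 ^ j) (anch R E j) c) ->
  hrect (160 * 2 ^ i) (8 * 2 ^ i) (zk R E k c) -> hrect (160 * 2 ^ i) (8 * 2 ^ i) (zk R E i c).
Proof.
move=> ik hn [l [r [hl hr lr]]]; exists l, r; split => //.
apply: (@conn_mono (168 * 2 ^ i)) lr => [e|z]; last by rewrite /sqball; lia.
move=> /andP[e1 e2] hz; have [//|[j [v [ijk v1 v2 a]]]] := @zk_compare R E nE i k c e hz; exfalso.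
apply: (hn j ijk); exists v; have ij : (2 * 2 ^ i <= 2 ^ j)%N.
  by rewrite -expnS leq_exp2l //; case/andP: ijk.
split => //; move: e1 e2 v1 v2 ij; rewrite expnS; move: (2 ^ i)%N (2 ^ j)%N => a1 a2; clear; lia.
Qed.

(** To leave the box of radius [60 * n], a path from the centre must cross one of the four
    rectangles at distance between [32 * n] and [48 * n] in the short direction, which a dual
    crossing in the long direction prevents. *)
Lemma arm_blocked (n n0 M : nat) zt : (n0 < 32 * n)%N -> (60 * n <= M)%N ->
  vx ((32 * n)%N%:Z, - (80 * n)%N%:Z) (16 * n) (160 * n) (dual zt) ->
  vx (- (48 * n)%N%:Z, - (80 * n)%N%:Z) (16 * n) (160 * n) (dual zt) ->
  hx (- (80 * n)%N%:Z, (32 * n)%N%:Z) (160 * n) (16 * n) (dual zt) ->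
  hx (- (80 * n)%N%:Z, - (48 * n)%N%:Z) (160 * n) (16 * n) (dual zt) -> ~ arm n0 M zt.
Proof.
move=> n0n nM [b1 [t1 [/= hb1 ht1 D1]]] [b2 [t2 [/= hb2 ht2 D2]]].
move=> [l3 [r3 [/= hl3 hr3 D3]]] [l4 [r4 [/= hl4 hr4 D4]]] [x [y [xn yM xy]]].
have xb : sqball (60 * n) x by apply: ball_le xn; lia.
have [/conn_memr yb|[y' y'b xy']] := first_exit (conn_weak (fun _ _ => I) xy) xb.
  by apply: yM; exact: ball_le yb.
have /= y'b' := conn_memr xy'; move: y'b y'b' xn; rewrite /sqball => y'b y'b' [x1 x2].
have [h|[h|[h|h]]] : y'.1 = (60 * n)%N%:Z + 1 \/ y'.1 = - (60 * n)%N%:Z - 1 \/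
    y'.2 = (60 * n)%N%:Z + 1 \/ y'.2 = - (60 * n)%N%:Z - 1 by clear -y'b y'b'; lia.
- apply: (@dual_incompat zt _ _ _ _ _ _ (32 * n)%N%:Z ((48 * n)%N%:Z + 1) (- (80 * n)%N%:Z + 1) (80 * n)%N%:Z xy' D1).
  + by lia.
  + by lia.
  + by move=> z; rewrite /sqball; lia.
  + by move=> z; rewrite /boxr /=; lia.
  + by lia.
  + by lia.
- apply: (@dual_incompat zt _ _ _ _ _ _ (- (48 * n)%N%:Z) (- (32 * n)%N%:Z + 1) (- (80 * n)%N%:Z + 1) (80 * n)%N%:Z (conn_linkS xy') D2).
  + by lia.
  + by lia.
  + by move=> z; rewrite /sqball; lia.
  + by move=> z; rewrite /boxr /=; lia.
  + by lia.
  + by lia.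
- apply: (@dual_incompat_tr zt _ _ _ _ _ _ (32 * n)%N%:Z ((48 * n)%N%:Z + 1) (- (80 * n)%N%:Z + 1) (80 * n)%N%:Z xy' D3).
  + by lia.
  + by lia.
  + by move=> z; rewrite /sqball; lia.
  + by move=> z; rewrite /boxr /=; lia.
  + by lia.
  + by lia.
- apply: (@dual_incompat_tr zt _ _ _ _ _ _ (- (48 * n)%N%:Z) (- (32 * n)%N%:Z + 1) (- (80 * n)%N%:Z + 1) (80 * n)%N%:Z (conn_linkS xy') D4).
  + by lia.
  + by lia.
  + by move=> z; rewrite /sqball; lia.
  + by move=> z; rewrite /boxr /=; lia.
  + by lia.
  + by lia.
Qed.

Lemma pr_hrect (pr : (econf -> Prop) -> R) n : rsw_law pr ->
  pr (hrect (160 * n) (8 * n)) <= pr (hx (0, 0) (160 * n) (16 * n)).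
Proof.
move=> H; apply: (rsw_le_shift H (v := (0, (8 * n)%N%:Z))); [exact: good_hrect|exact: good_hx|].
move=> zt [l [r [hl hr lr]]]; exists (l.1, l.2 + (8 * n)%N%:Z), (r.1, r.2 + (8 * n)%N%:Z).
split=> /=; [lia|lia|]; have := @conn_shift zt (0, (8 * n)%N%:Z) _ (boxr (0, 0) (160 * n) (16 * n)) l r _ lr.
by rewrite /= !addr0; apply; rewrite /boxr /=; lia.
Qed.

End subcritical.

Lemma crossing_long (R : realType) (pr : (econf -> Prop) -> R) (a b c : nat) : rsw_law pr -> (c <= a)%N ->
  pr (hx (0, 0) a b) <= pr (hx (0, 0) c b).
Proof.
move=> H ca; apply: (rsw_mono H); [exact: good_hx|exact: good_hx|].
move=> zt [l [r [/= hl hr lr]]]; have [] := clip lr (a := 0) (b := c%:Z); [by rewrite hl|by []|by rewrite hr; clear -ca; lia|].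
move=> x [y [hx_ hy xy]]; exists x, y; split=> //=.
by apply: conn_weak xy => u; rewrite /boxr /=; lia.
Qed.

Lemma sub_two (R : realFieldType) (x y b e : R) : 1 - e <= x -> x <= y + b -> b <= e -> 1 - 2 * e <= y.
Proof. lra. Qed.

Lemma half_contra (R : realFieldType) (x c : R) : 0 < c -> 1 - c / 2 <= x -> x <= 1 - c -> False.
Proof. lra. Qed.

(** The hypothesis of [dichotomy] for the scales between [j] and [3 * j]. *)
Lemma scales_bound e j : (0 < j)%N -> (e < j + (2 * j).+1)%N -> (2 * 2 ^ e + 1 < 32 ^ j)%N.
Proof.
move=> j0 he; have h1 : (2 ^ e <= 2 ^ (3 * j))%N by apply: leq_pexp2l => //; lia.
have -> : (32 ^ j = 2 ^ (3 * j) * 2 ^ (2 * j))%N.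
  by rewrite -expnD -[32%N]/(2 ^ 5)%N -expnM; congr (2 ^ _)%N; lia.
have h4 : (2 ^ 2 <= 2 ^ (2 * j))%N by apply: leq_pexp2l => //; lia.
have h5 : (2 ^ (3 * j) * 4 <= 2 ^ (3 * j) * 2 ^ (2 * j))%N by rewrite leq_mul2l h4 orbT.
have h6 : (0 < 2 ^ (3 * j))%N by rewrite expn_gt0.
move: (2 ^ e)%N (2 ^ (3 * j))%N (2 ^ (2 * j))%N h1 h5 h6 => a b c; clear; lia.
Qed.

Section subcritical_percolation.
Variables (R : realType) (P : R -> probability config R).
Hypothesis hP : forall p : R, 0 <= p <= 1 -> bernoulli_percolation p (P p).
Variables (E : set (graph * graph)).
Hypothesis nE : forall en, E en -> nice en.

Lemma percolatesE p F : (forall en, F en -> nice en) ->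
  percolates (P p) (enhanced R F) <-> P p [set w | Inf (zF R F (cfg_of w))] = 1%E.
Proof.
move=> nF; rewrite /percolates (_ : [set w | has_infinite_component _] = [set w | Inf (zF R F (cfg_of w))]) //.
by apply/seteqP; split=> w /= /(infinite_Inf _ nF).
Qed.

Lemma percolates_zk p k : percolates (P p) (enhanced R (scale_upto E k)) <->
  P p [set w | Inf (zk R E k (cfg_of w))] = 1%E.
Proof. by apply: percolatesE => en /(scale_upto_nice nE)[]. Qed.

(** A path has finitely many edges, each of which is present from some scale on. *)
Lemma conn_zk c B x y : conn (link (zF R E c)) B x y ->
  exists k, forall k', (k <= k')%N -> conn (link (zk R E k' c)) B x y.
Proof.
elim=> [Bx|u v _ [k hk] uv Bv]; first by exists 0%N => k' _; exact: conn_refl.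
have L e : zF R E c e -> exists k, forall k', (k <= k')%N -> zk R E k' c e.
  by move=> /(zF_union R nE)[k1 h]; exists k1 => k' kk; exact: zk_le h.
have [k1 hk1] : exists k, forall k', (k <= k')%N -> link (zk R E k' c) u v.
  by case: uv => -[-> /L[k1 h]]; exists k1 => k' /h z;
    [apply: Or41|apply: Or42|apply: Or43|apply: Or44].
exists (maxn k k1) => k'; rewrite geq_max => /andP[h1 h2].
by apply: conn_step (hk _ h1) (hk1 _ h2) Bv.
Qed.

Lemma arm_zk n M c : arm n M (zF R E c) <-> exists k, arm n M (zk R E k c).
Proof.
split=> [[x [y [xn yM /conn_zk[k h]]]]|[k [x [y [xn yM xy]]]]].
  by exists k, x, y; split => //; exact: h.
exists x, y; split => //; apply: (@conn_sub _ _ _ _ id) xy => // u v _ _.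
have h e : zk R E k c e -> zF R E c e by move=> z; apply/(zF_union R nE); exists k.
by case=> -[-> /h z]; [apply: Or41|apply: Or42|apply: Or43|apply: Or44].
Qed.

Lemma arm_mono n M k k' c : (k <= k')%N -> arm n M (zk R E k c) -> arm n M (zk R E k' c).
Proof.
move=> kk [x [y [xn yM xy]]]; exists x, y; split => //; apply: (@conn_sub _ _ _ _ id) xy => // u v _ _.
have h e : zk R E k c e -> zk R E k' c e by exact: zk_le.
by case=> -[-> /h z]; [apply: Or41|apply: Or42|apply: Or43|apply: Or44].
Qed.

Let armw n M := [set w | arm n M (zF R E (cfg_of w))].

Lemma armk_measurable n M k : measurable [set w | arm n M (zk R E k (cfg_of w))].
Proof. exact: (local_measurable (model_local (zk_model R nE k) (good_arm n M))). Qed.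

Lemma armwE n M : armw n M = \bigcup_k [set w | arm n M (zk R E k (cfg_of w))].
Proof.
by apply/seteqP; split=> w /=; [move=> /arm_zk[k h]; exists k|move=> [k _ h]; apply/arm_zk; exists k].
Qed.

Lemma armw_measurable n M : measurable (armw n M).
Proof. by rewrite armwE; apply: bigcup_measurable => k _; exact: armk_measurable. Qed.

Let infw n := \bigcap_(M in [set M | (n <= M)%N]) armw n M.

Lemma infw_measurable n : measurable (infw n).
Proof. by apply: bigcap_measurable; [exists n => /=|move=> M _; exact: armw_measurable]. Qed.

Lemma InfwE : [set w | Inf (zF R E (cfg_of w))] = \bigcup_n infw n.
Proof.
apply/seteqP; split=> w /=; first by move=> /InfE[n h]; exists n => //= M /h.
by move=> [n _ h]; apply/InfE; exists n => M /h.
Qed.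

Lemma Infw_measurable : measurable [set w | Inf (zF R E (cfg_of w))].
Proof. by rewrite InfwE; apply: bigcup_measurable => n _; exact: infw_measurable. Qed.

Lemma percolates_up p k : percolates (P p) (enhanced R (scale_upto E k)) -> percolates (P p) (enhanced R E).
Proof.
move=> /percolates_zk h; apply/(percolatesE _ nE); apply/eqP; rewrite eq_le probability_le1 /=; last exact: Infw_measurable.
rewrite -h; apply: le_measure; rewrite ?inE.
- exact: (Inf_measurable (zk_model R nE k)).
- exact: Infw_measurable.
move=> w /= /InfE[n hn]; apply/InfE; exists n => M /hn h'; apply/arm_zk; by exists k.
Qed.

(** By continuity of the measure, the event of percolation at all scales is approximated by an
    arm event of bounded starting radius, and this in turn by an arm event at a finite scale. The
    starting radius must not depend on [M]. *)
Lemma percolates_arm p (eps : R) : 0 < eps -> percolates (P p) (enhanced R E) ->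
  exists n0, forall M, (n0 <= M)%N -> exists k, forall k', (k <= k')%N ->
    1 - eps <= prb P p (fun c => arm n0 M (zk R E k' c)).
Proof.
move=> e0 /(percolatesE _ nE); rewrite InfwE => h.
have [n0 hn0] : exists n, ((1 - eps)%:E < P p (infw n))%E.
  apply: mu_up; [exact: infw_measurable| |by rewrite h lte_fin ltrBlDr ltrDl].
  move=> n w hw M /= nM; have [x [y [xn yM xy]]] := hw M (ltnW nM).
  by exists x, y; split => //; exact: ball_le xn.
exists n0 => M nM.
have [k hk] : exists k, ((1 - eps)%:E < P p [set w | arm n0 M (zk R E k (cfg_of w))])%E.
  apply: mu_up; [by move=> k; exact: armk_measurable|by move=> k w /=; exact: arm_mono|].
  rewrite -armwE; apply: lt_le_trans hn0 _; apply: le_measure; rewrite ?inE.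
  - exact: infw_measurable.
  - exact: armw_measurable.
  by move=> w; apply.
exists k => k' kk; rewrite -lee_fin -prbK; last exact: (model_local (zk_model R nE k') (good_arm n0 M)).
apply: le_trans (ltW hk) _; apply: le_measure; rewrite ?inE; try exact: armk_measurable.
by move=> w /=; exact: arm_mono.
Qed.

(** The four dual crossings of [arm_blocked] are positively associated. *)
Lemma dual_blocks_arm p k n n0 M (c1 : R) : 0 <= p <= 1 -> 0 <= c1 -> (n0 < 32 * n)%N -> (60 * n <= M)%N ->
  c1 <= prb P p (fun c => hrect (160 * n) (8 * n) (dual (zk R E k c))) ->
  prb P p (fun c => arm n0 M (zk R E k c)) <= 1 - c1 ^+ 4.
Proof.
move=> p01 c10 h1 h2 hc; have fm := zk_model R nE k; have H := dual_law hP p01 fm.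
have hx0 := le_trans hc (pr_hrect n H).
set prd := (fun F => prb P p (fun c => F (dual (zk R E k c)))) in hc H hx0.
pose V1 := vx ((32 * n)%N%:Z, - (80 * n)%N%:Z) (16 * n) (160 * n).
pose V2 := vx (- (48 * n)%N%:Z, - (80 * n)%N%:Z) (16 * n) (160 * n).
pose V3 := hx (- (80 * n)%N%:Z, (32 * n)%N%:Z) (160 * n) (16 * n).
pose V4 := hx (- (80 * n)%N%:Z, - (48 * n)%N%:Z) (160 * n) (16 * n).
have p1 : c1 <= prd V1 by exact: le_trans hx0 (pr_vx H _ _ _).
have p2 : c1 <= prd V2 by exact: le_trans hx0 (pr_vx H _ _ _).
have p3 : c1 <= prd V3 by exact: le_trans hx0 (pr_hx H _ _ _).
have p4 : c1 <= prd V4 by exact: le_trans hx0 (pr_hx H _ _ _).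
have g1 : good V1 by exact: good_vx.
have g2 : good V2 by exact: good_vx.
have g3 : good V3 by exact: good_hx.
have g4 : good V4 by exact: good_hx.
have and_ F G : good F -> good G -> forall a b : R, 0 <= a -> 0 <= b -> a <= prd F -> b <= prd G ->
    a * b <= prd (fun zt => F zt /\ G zt).
  by move=> gF gG a b a0 b0 ha hb; apply: le_trans (rsw_and H gF gG); exact: ler_pM.
have p34 := and_ _ _ g3 g4 _ _ c10 c10 p3 p4.
have c2 : 0 <= c1 * c1 by exact: mulr_ge0.
have p234 := and_ _ _ g2 (good_and g3 g4) _ _ c10 c2 p2 p34.
have p1234 := and_ _ _ g1 (good_and g2 (good_and g3 g4)) _ _ c10 (mulr_ge0 c10 c2) p1 p234.
have la := model_local fm (good_arm n0 M).
rewrite lerBrDr addrC -lerBrDr -prbC //.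
rewrite (_ : c1 ^+ 4 = c1 * (c1 * (c1 * c1))); last by rewrite !exprS expr0 mulr1.
apply: le_trans p1234 _; apply: prb_mono.
- exact: (model_dlocal fm (good_and g1 (good_and g2 (good_and g3 g4)))).
- exact: localC.
by move=> c [v1 [v2 [v3 v4]]]; exact: arm_blocked h1 h2 v1 v2 v3 v4.
Qed.

(** The finite-size criterion, for the rectangles produced by [rsw]. *)
Lemma fs_hrect p f r0 n (q : R) : 0 <= p <= 1 -> model f r0 -> (2 * r0 < 16 * n)%N -> q <= 1 / 162 ->
  1 - q <= prb P p (fun c => hrect (160 * n) (8 * n) (f c)) -> P p [set w | Inf (f (cfg_of w))] = 1%E.
Proof.
move=> p01 fm rn hq h; have H := primal_law hP p01 fm.
apply: (finite_size hP p01 fm rn).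
have h1 := le_trans h (pr_hrect n H).
have h2 : (2 * (16 * n) <= 160 * n)%N by lia.
have := le_trans h1 (crossing_long (16 * n) H h2).
by move: hq; set x := prb _ _ _; lra.
Qed.

(** If the graph with all enhancements percolates, then at a large finite scale [k] the arm
    events are likely, so that the dual has long crossings with probability less than [c1]. By
    [dichotomy], at some scale [e] comparable to a large [j], long crossings of the graph have
    probability close to one. With high probability no anchor of a scale beyond [e] is near the
    rectangle, so the enhancements up to the scale [e] make the crossing already, and the finite-
    size criterion applies to them, because [2 ^ e] is comparable to their range. *)
Lemma subcritical p : 0 <= p <= 1 -> p < q_c P E -> percolates (P p) (enhanced R E) ->
  exists N, percolates (P p) (enhanced R (scale_upto E N)).
Proof.
move=> p01 pq perc.
have [rho [r0 r1 [k1 hk1]]] := anchor_decay hP nE p01 pq.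
(* Two errors of size [y] each, for the crossing and for the anchors, must stay below the bound
   of the finite-size criterion. *)
have [y [y01 y162]] : exists y : R, 0 < y < 1 /\ 2 * y <= 1 / 162 by exists (1 / 400); lra.
have [th [th01 thE]] := near_one chain_exp y01.
have [th2 [th201 hth]] := @dual_parameter R (4 * 32) th isT th01.
pose c1 := (1 - th2) ^+ chain_exp.
have th2s : 0 < 1 - th2 by rewrite subr_gt0; case/andP: th201.
have c10 : 0 < c1 by exact: (exprn_gt0 chain_exp th2s).
have e0 : 0 < c1 ^+ 4 / 2 by rewrite divr_gt0 // exprn_gt0.
have [n0 hn0] := percolates_arm e0 perc.
have [j1 hj1] := near_prob hP nE p01 r0 r1 (andP y01).1 hk1.
pose j := maxn j1 (maxn n0 1).
have [jj1 jn0 j0] : [/\ (j1 <= j)%N, (n0 <= j)%N & (0 < j)%N].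
  by rewrite /j !leq_max leqnn !orbT /=; split => //; rewrite leqnn ?orbT.
pose M := (n0 + 60 * 2 ^ (3 * j))%N.
have [ks hks] := hn0 M (leq_addr _ _).
(* All scales [e] up to [3 * j] are allowed by the dichotomy, and [k] must not be smaller than
   them. *)
pose k := maxn ks (3 * j).
have fm := zk_model R nE k.
have [|e /andP[je e3] [hp|hd]] := dichotomy hP p01 fm (m := 32) (a := j) (q := j) th01 th201 isT hth.
- by move=> e; exact: scales_bound.
- exists e; apply/percolates_zk.
  have [B [lB pB hB]] := hj1 e k (leq_trans jj1 je).
  have ek : (e <= k)%N by rewrite /k leq_max; apply/orP; right; move: e3; clear; lia.
  apply: (fs_hrect (n := 2 ^ e) (q := 2 * y) p01 (zk_model R nE e) _ y162).
  + by rewrite expnS; have : (0 < 2 ^ e)%N by [rewrite expn_gt0]; clear; lia.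
  pose X c := hrect (160 * 2 ^ e) (8 * 2 ^ e) (zk R E k c).
  pose Y c := hrect (160 * 2 ^ e) (8 * 2 ^ e) (zk R E e c).
  have lX : local X by exact: (model_local fm (good_hrect _ _)).
  have lY : local Y by exact: (model_local (zk_model R nE e) (good_hrect _ _)).
  have XYB : prb P p X <= prb P p Y + prb P p B.
    apply: le_trans (prb_union P p lY lB); apply: prb_mono => //; first exact: localU.
    move=> c Xc; have [Bc|nB] := pselect (B c); first by right.
    left; apply: compare_hrect ek _ Xc => // i ik w; apply: nB; exact: hB ik w.
  have hX := le_trans thE hp.
  have {}hX : 1 - y <= prb P p X := hX.
  suff : 1 - 2 * y <= prb P p Y by [].
  exact: sub_two hX XYB pB.
exfalso.
have hn : (n0 < 32 * 2 ^ e)%N.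
  have : (e < 2 ^ e)%N by exact: ltn_expl.
  by move: je jn0; clear; lia.
have hM : (60 * 2 ^ e <= M)%N.
  have : (2 ^ e <= 2 ^ (3 * j))%N by apply: leq_pexp2l => //; move: e3; clear; lia.
  by rewrite /M; clear; lia.
have h1 := dual_blocks_arm p01 (ltW c10) hn hM hd.
have h2 := hks k (leq_maxl _ _).
exact: half_contra (exprn_gt0 4 c10) h2 h1.
Qed.

End subcritical_percolation.

(** * Above the threshold *)

(** The number [K] of scales is chosen so large that the factor [2 ^ (k / K)] to the power [E],
    which is lost when boundedly many scales must suffice for the pigeonhole argument of [rsw],
    is beaten by the exponential factor [rho ^ k]. *)
Lemma amp_choice (R : realType) (rho : R) (E : nat) : 0 <= rho -> rho < 1 ->
  exists K, (0 < K)%N /\ forall y : R, 0 < y -> exists k0, forall k, (k0 <= k)%N ->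
    (8 * 2 ^ (k %/ K + 2))%:R ^+ E * rho ^+ k <= y.
Proof.
move=> r0 r1.
have p2 : 0 < (2 : R) ^+ E by rewrite exprn_gt0.
have z0 : 0 < (2 * (2 : R) ^+ E)^-1 by rewrite invr_gt0 mulr_gt0.
have [K0 hK0] := expr_small r0 r1 z0; exists K0.+1; split => // y y0.
pose C : R := 2 ^+ (5 * E); have C0 : 0 < C by rewrite exprn_gt0.
have w0 : 0 < y / C by rewrite divr_gt0.
have h01 : (0 : R) <= 2^-1 by rewrite invr_ge0.
have h11 : (2^-1 : R) < 1 by rewrite invf_lt1 // ltr1n.
have [j hj] := expr_small h01 h11 w0.
exists (j * K0.+1)%N => k hk; set d := (k %/ K0.+1)%N.
have jd : (j <= d)%N by rewrite /d leq_divRL.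
have -> : (8 * 2 ^ (d + 2))%:R ^+ E = C * (2 ^+ E) ^+ d :> R.
  rewrite (_ : (8 * 2 ^ (d + 2) = 2 ^ (5 + d))%N); last by rewrite -[8%N]/(2 ^ 3)%N -expnD; congr (_ ^ _)%N; lia.
  by rewrite natrX -!exprM -exprD; congr (_ ^+ _); lia.
have hr : rho ^+ k <= (rho ^+ K0.+1) ^+ d.
  by rewrite -exprM; apply: ler_wiXn2l => //; [exact: ltW|rewrite mulnC leq_divM].
have hd : (2 ^+ E) ^+ d * (rho ^+ K0.+1) ^+ d <= 2^-1 ^+ d :> R.
  rewrite -exprMn; apply: lerXn2r; rewrite ?nnegrE ?mulr_ge0 ?exprn_ge0 //.
  have := hK0 K0.+1 (leqnSn _); rewrite invfM => h.
  apply: le_trans (ler_wpM2l (ltW p2) h) _; by rewrite mulrCA mulfV ?mulr1 // gt_eqF.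
apply: (@le_trans _ _ (C * (2^-1 ^+ d))).
  rewrite -mulrA ler_wpM2l ?(ltW C0) //; apply: le_trans hd.
  by rewrite ler_wpM2l ?exprn_ge0.
by rewrite mulrC -ler_pdivlMr //; exact: hj.
Qed.

Section amplification.
Variables (R : realType) (P : R -> probability config R).
Hypothesis hP : forall p : R, 0 <= p <= 1 -> bernoulli_percolation p (P p).

Lemma root_bound (x eps : R) n : 0 <= eps -> (0 < n)%N -> (1 - x) ^+ n <= eps ^+ n -> 1 - eps <= x.
Proof.
move=> e0 n0 h; rewrite leNgt; apply/negP => hx; have h1 : eps < 1 - x by lra.
have h2 : eps ^+ n < (1 - x) ^+ n by rewrite ltr_pXn2r // nnegrE (le_trans e0) // ltW.
by move: (lt_le_trans h2 h); rewrite ltxx.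
Qed.

(** If [B] has probability at least [z], its window has at a larger parameter a probability close
    to one, provided that [z] is large compared with the bound of the sharp threshold. *)
Lemma amplify (p1 p2 : R) B n r l M (z eps : R) : 0 <= p1 -> p1 <= p2 -> p2 <= 1 -> incE B ->
  supp (inbox r) B -> (2 * (n + r) + 1 <= l.+1)%N -> (l.+1 <= M * (2 * n + 1))%N ->
  0 < z -> z <= prb P p1 B -> 0 < eps ->
  z^-1 * expR (- (p2 - p1) / 3 * ln (l.+1)%:R) <= eps ^+ (M ^ 2) ->
  1 - eps <= prb P p2 (window n B).
Proof.
move=> p10 p12 p21 iB sB hl hM z0 hz e0 he.
have h := amp_torus hP p10 p12 p21 iB sB hl hM.
have M0 : (0 < M ^ 2)%N by rewrite expn_gt0; case: M hM {h he}.
have lB : local B by exists r.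
have lW : local (window n B) by exists (n + r)%N; exact: window_supp.
have zW : z <= prb P p1 (window n B).
  apply: le_trans hz _; apply: prb_mono => // c b; exists (0, 0); split => //.
  by rewrite (_ : (fun e => _) = c) //; apply/funext => -[[x y] d]; rewrite /shE /= !addr0.
apply: (root_bound (ltW e0) M0); apply: le_trans he.
rewrite mulrC ler_pdivlMr // mulrC; apply: le_trans h.
by rewrite ler_wpM2r // exprn_ge0 // subr_ge0 prb_le1.
Qed.

(** The same for decreasing events and smaller parameters, by exchanging open and closed edges. *)
Lemma amplify_dec (p1 p2 : R) B n r l M (z eps : R) : 0 <= p2 -> p2 <= p1 -> p1 <= 1 -> decE B ->
  supp (inbox r) B -> (2 * (n + r) + 1 <= l.+1)%N -> (l.+1 <= M * (2 * n + 1))%N ->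
  0 < z -> z <= prb P p1 B -> 0 < eps ->
  z^-1 * expR (- (p1 - p2) / 3 * ln (l.+1)%:R) <= eps ^+ (M ^ 2) ->
  1 - eps <= prb P p2 (window n B).
Proof.
move=> p20 p21 p11 dB sB hl hM z0 hz e0 he.
pose B' (c : cfg) := B (fun e => ~~ c e).
have iB' : incE B' by move=> c c' cc; apply: dB => e; apply: contra; exact: cc.
have sB' : supp (inbox r) B' by move=> c c' h; apply: sB => e /h ->.
have lB : local B by exists r.
have lW : local (window n B) by exists (n + r)%N; exact: window_supp.
have p1i : 0 <= p1 <= 1 by lra.
have p2i : 0 <= p2 <= 1 by lra.
rewrite -(prb_neg hP p2i lW).
apply: (@amplify (1 - p1) (1 - p2) B' n r l M z eps); rewrite ?subr_ge0 //.
- by rewrite lerD2l lerN2.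
- by rewrite lerBlDr lerDl.
- by rewrite /B' (prb_neg hP p1i lB).
by rewrite (_ : 1 - p2 - (1 - p1) = p1 - p2) //; ring.
Qed.

End amplification.

Lemma hrect_radius n : forall zt zt' : econf, (forall e, inbox (168 * n) e -> zt e -> zt' e) ->
  hrect (160 * n) (8 * n) zt -> hrect (160 * n) (8 * n) zt'.
Proof.
move=> zt zt' h [l [r [hl hr lr]]]; exists l, r; split => //.
by apply: conn_mono h _ lr => z; rewrite /sqball; lia.
Qed.

(** Translation by a vector of norm at most [n] costs [n] at each end and adds [n] to the height
    on each side. All these crossings are crossings of one fixed rectangle, so that a likely
    window event makes a likely crossing event. *)
Lemma translated_crossing n (v : pt) zt : (`|v.1| <= n)%N -> (`|v.2| <= n)%N ->
  hrect (160 * n) (8 * n) (fun e => zt (shE v e)) -> hx (n%:Z, - (9 * n)%N%:Z) (158 * n) (18 * n) zt.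
Proof.
move=> v1 v2 [l [r [hl hr lr]]].
have := @conn_shift zt v _ (fun z : pt => - (9 * n)%N%:Z <= z.2 <= (9 * n)%N%:Z) l r _ lr.
move=> h; have {}h := h (ltac:(move=> z /=; clear -v1 v2; lia)).
have [] := clip h (a := n%:Z) (b := (159 * n)%N%:Z).
- by rewrite /= hl; clear -v1; lia.
- by clear; lia.
- by rewrite /= hr; clear -v1; lia.
move=> x [y [hx_ hy xy]]; exists x, y; split=> //=.
by apply: conn_weak xy => u; rewrite /boxr /=; clear; lia.
Qed.

Lemma pr_hx_back (R : realType) (pr : (econf -> Prop) -> R) z a b : rsw_law pr ->
  pr (hx z a b) <= pr (hx (0, 0) a b).
Proof.
move=> H; apply: (rsw_le_shift H (v := (- z.1, - z.2))); [exact: good_hx|exact: good_hx|].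
move=> zt [l [r [/= hl hr lr]]]; exists (l.1 - z.1, l.2 - z.2), (r.1 - z.1, r.2 - z.2).
split=> /=; [by rewrite hl subrr|by rewrite hr addrAC subrr|].
by apply: (conn_shift (v := (- z.1, - z.2))) lr; rewrite /boxr /=; lia.
Qed.

Lemma pr_all (R : realType) (pr : (econf -> Prop) -> R) (F : nat -> econf -> Prop) (x : R) T : rsw_law pr ->
  (forall i, good (F i)) -> (forall i, 1 - x <= pr (F i)) ->
  exists A, [/\ good A, 1 - T%:R * x <= pr A & forall zt, A zt -> forall i, (i < T)%N -> F i zt].
Proof.
move=> H gF hF; elim: T => [|T [A [gA pA hA]]].
  by exists (fun=> True); split; [exact: good_cst|rewrite mul0r subr0 (rsw1 H)|].
exists (fun zt => A zt /\ F T zt); split; first exact: good_and.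
  by rewrite -natr1 mulrDl mul1r; exact: (pr_and_ge H gA (gF T) pA (hF T)).
by move=> zt [/hA h f] i; rewrite ltnS leq_eqVlt => /orP[/eqP ->|/h].
Qed.

(** A path of width at least [D] inside the box of radius [3 * D] spans one of the slabs of width
    [b] that tile the columns between [- (b * t)] and [b * t], since [2 * b < D]; a dual crossing
    of this slab prevents that. *)
Lemma slabs_block (b t D : nat) zt x y : (0 < b)%N -> (0 < D)%N -> (2 * b + 1 <= D)%N -> (4 * D <= b * t)%N ->
  (forall i, (i < 2 * t)%N -> vx ((b * i)%N%:Z - (b * t)%N%:Z, - (4 * D)%N%:Z) b (8 * D) (dual zt)) ->
  conn (link zt) (sqball (3 * D)) x y -> x.1 + D%:Z <= y.1 -> False.
Proof.
move=> b0 D0 bD bt hS xy dxy.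
have [x1 x2] := conn_meml xy; have [y1 y2] := conn_memr xy.
pose u := absz (x.1 + (b * t)%N%:Z); pose i := (u %/ b).+1.
have uE : u%:Z = x.1 + (b * t)%N%:Z by rewrite /u; move: x1 bt; clear; lia.
have h1 : (u < b * i)%N by rewrite /i mulnC -ltn_divLR.
have h2 : (b * i <= u + b)%N by rewrite /i mulnS addnC leq_add2r mulnC leq_divM.
have it : (i < 2 * t)%N.
  rewrite -(ltn_pmul2l b0); move: h2 uE dxy y1 bt bD D0.
  rewrite (_ : b * (2 * t) = 2 * (b * t))%N; last by rewrite mulnCA.
  move: (b * i)%N (b * t)%N => bi bt_; clear; lia.
have [c [d [/= hc hd cd]]] := hS i it.
apply: (@dual_incompat zt _ _ _ _ _ _ ((b * i)%N%:Z - (b * t)%N%:Z) ((b * i)%N%:Z - (b * t)%N%:Z + b%:Z + 1)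
  (- (4 * D)%N%:Z + 1) (4 * D)%N%:Z xy cd).
- by move: h1 uE; clear; lia.
- by move: h2 uE dxy bD; clear; lia.
- by move=> z; rewrite /sqball; move: D0; clear; lia.
- by move=> z; rewrite /boxr /=; clear; lia.
- by rewrite hc; clear; lia.
- by rewrite hd; clear; lia.
Qed.

Lemma slabs_block_tr (b t D : nat) zt x y : (0 < b)%N -> (0 < D)%N -> (2 * b + 1 <= D)%N -> (4 * D <= b * t)%N ->
  (forall i, (i < 2 * t)%N -> hx (- (4 * D)%N%:Z, (b * i)%N%:Z - (b * t)%N%:Z) (8 * D) b (dual zt)) ->
  conn (link zt) (sqball (3 * D)) x y -> x.2 + D%:Z <= y.2 -> False.
Proof.
move=> b0 D0 bD bt hS xy dxy.
apply: (@slabs_block b t D (zt \o trE) (tr x) (tr y)) => //.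
  move=> i /hS[l [r [/= hl hr lr]]]; exists (tr l), (tr r); split=> //=.
  by rewrite dual_tr; apply: conn_weak (conn_tr lr) => z; rewrite /boxr /tr /=; clear; lia.
by apply: conn_weak (conn_tr xy) => z; rewrite /sqball /tr /=; clear; lia.
Qed.

(** The hypothesis of [dichotomy] when [q := K] is fixed: [m] must grow like a small power of [2
    ^ k]. *)
Lemma scales_bound_b e k K : (0 < K)%N -> (e + 6 <= k)%N -> (2 * 2 ^ e + 1 < (2 ^ (k %/ K + 2)) ^ K)%N.
Proof.
move=> K0 ek; have h1 : (2 ^ e.+2 <= (2 ^ (k %/ K + 2)) ^ K)%N.
  rewrite -expnM leq_exp2l // mulnDl.
  have := divn_eq k K; have := ltn_pmod k K0; lia.
apply: leq_trans h1; rewrite !expnS; have : (0 < 2 ^ e)%N by rewrite expn_gt0.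
lia.
Qed.

Lemma glue_bound (R : realFieldType) (c eps u v : R) : 162 * c * eps <= 1 -> 1 - u <= c * eps -> u <= v ->
  162 * (1 - v) <= 1.
Proof. nra. Qed.

(** With [th] this close to one, the crossing probabilities that [dichotomy] compares with are at
    most one half, and the probability of a long crossing given by [rsw] is a power of [1 / (8 *
    m)]. *)
Lemma half_parameter (R : realType) (m : nat) : (0 < m)%N ->
  let th : R := 1 - (8 * m)%:R^-1 in 0 < th < 1 /\ 1 - th ^+ (4 * m) <= th ^+ (4 * m).
Proof.
move=> m0 th; have m8 : 1 < (8 * m)%:R :> R by rewrite ltr1n; lia.
have m80 : 0 < (8 * m)%:R :> R by apply: lt_trans m8.
have x0 : 0 < (8 * m)%:R^-1 :> R by rewrite invr_gt0.
have x1 : (8 * m)%:R^-1 < 1 :> R by rewrite invf_lt1.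
split; first by rewrite /th; lra.
have := @bernoulli_ineq R (8 * m)%:R^-1 (4 * m) (_ : _ = true).
rewrite -/th (_ : (4 * m)%:R * (8 * m)%:R^-1 = 1 / 2 :> R).
  by move=> h; have {}h := h (ltac:(by rewrite !ltW)); move: h; set u := th ^+ _; lra.
by rewrite !natrM; field; rewrite pnatr_eq0 -lt0n.
Qed.

Lemma scale_factor (R : realType) (d : R) k : 0 <= d ->
  expR (- d * ln (2 ^ (k + 9))%:R) <= expR (- d * ln 2) ^+ k.
Proof.
move=> d0; rewrite natrX lnXn // -expRM_natl ler_expR.
have l2 : 0 <= ln (2 : R) by rewrite ln_ge0 // ler1n.
rewrite -(mulr_natl (ln 2)) natrD; have : 0 <= d * ln (2 : R) * 9 by rewrite !mulr_ge0.
lra.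
Qed.

Lemma small_eps (R : realType) (u v a : R) : 0 <= u -> 0 <= v -> 0 < a ->
  exists e : R, [/\ 0 < e, u * e <= 1 & v * e < a].
Proof.
move=> u0 v0 a0; have u1 : 0 < u + 1 by lra.
have v1 : 0 < v + 1 by lra.
exists (Num.min (u + 1)^-1 (a / (v + 1))); split.
- by rewrite lt_min invr_gt0 u1 divr_gt0.
- apply: le_trans (ler_wpM2l u0 (_ : _ <= (u + 1)^-1)) _; first by rewrite ge_min lexx.
  by rewrite ler_pdivrMr //; lra.
- apply: le_lt_trans (ler_wpM2l v0 (_ : _ <= a / (v + 1))) _; first by rewrite ge_min lexx orbT.
  by rewrite mulrA ltr_pdivrMr //; nra.
Qed.

Section supercritical.
Variables (R : realType) (P : R -> probability config R).
Hypothesis hP : forall p : R, 0 <= p <= 1 -> bernoulli_percolation p (P p).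
Variables (E : set (graph * graph)).
Hypothesis nE : forall en, E en -> nice en.

Let G k := window (2 ^ k) (anch R E k).

Lemma q_c_ge0 : 0 <= q_c P E.
Proof.
rewrite /q_c; set S := [set _ | _]; have [[x Sx]|/nonemptyPn ->] := pselect (S !=set0); last by rewrite sup0.
apply: le_trans (_ : x <= _); first by case: Sx => /andP[].
by apply: ub_le_sup => //; exists 1 => y [/andP[]].
Qed.

Lemma above_threshold p : 0 <= p <= 1 -> q_c P E < p ->
  exists a : R, 0 < a /\ forall n, exists2 k, (n <= k)%N & a <= prb P p (G k).
Proof.
move=> p01 hp; apply: contrapT => hn; move: hp; rewrite ltNge => /negP; apply.
apply: ub_le_sup; first by exists 1 => y [/andP[]].
split=> //; apply: limsup0_le => [n|eps e0]; first exact: measure_ge0.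
apply: contrapT => h; apply: hn; exists eps; split=> // n; apply: contrapT => hk.
apply: h; exists n => k nk; rewrite (prb_anchor P nE) lee_fin ltW // ltNge; apply/negP => hle.
by apply: hk; exists k.
Qed.

(** An activated copy at the scale [k] is connected and at least [2 ^ k] wide or high. It is
    impossible if the dual crosses all slabs of width [18 * n] in both directions near the
    origin; there are boundedly many of them, as [t * n] and [2 ^ k] are comparable. *)
Lemma dual_blocks_anchor p k n t (eps : R) : 0 <= p <= 1 -> (0 < n)%N -> (37 * n <= 2 ^ k)%N ->
  (8 * 2 ^ k <= t * n)%N ->
  1 - eps <= prb P p (fun c => hx (0, 0) (2 * (18 * n)) (18 * n) (dual (zk R E k c))) ->
  prb P p (G k) <= (2 * t)%:R * ((2 * t + 1)%:R * eps + (2 * t + 1)%:R * eps).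
Proof.
move=> p01 n0 nk tn he; have fm := zk_model R nE k; have H := dual_law hP p01 fm.
set prd := (fun F => prb P p (fun c => F (dual (zk R E k c)))) in H.
pose b := (18 * n)%N; have hb : 1 - prd (hx (0, 0) (2 * b) b) <= eps by rewrite lerBlDr addrC -lerBlDr.
have b0 : (0 < b)%N by rewrite muln_gt0.
have e0 : 0 <= eps by apply: le_trans hb; rewrite subr_ge0; apply: (rsw_le1 H); exact: good_hx.
have t0 : (0 < t)%N by case: t tn => //; have : (0 < 2 ^ k)%N by [rewrite expn_gt0]; clear; lia.
have hlong : 1 - (2 * t + 1)%:R * eps <= prd (hx (0, 0) (8 * 2 ^ k) b).
  have h1 : (8 * 2 ^ k <= (t + 2) * b)%N by rewrite /b; move: tn; clear; lia.
  apply: le_trans (crossing_long b H h1).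
  have := pr_long H b t; rewrite lerBlDr addrC -lerBlDr; apply: le_trans.
  by rewrite lerD2l lerN2 ler_wpM2l.
pose F i zt := vx ((b * i)%N%:Z - (b * t)%N%:Z, - (4 * 2 ^ k)%N%:Z) b (8 * 2 ^ k) zt /\
  hx (- (4 * 2 ^ k)%N%:Z, (b * i)%N%:Z - (b * t)%N%:Z) (8 * 2 ^ k) b zt.
have gF i : good (F i) by apply: good_and; [exact: good_vx|exact: good_hx].
have pF i : 1 - ((2 * t + 1)%:R * eps + (2 * t + 1)%:R * eps) <= prd (F i).
  apply: (pr_and_ge H); [exact: good_vx|exact: good_hx| |].
    exact: le_trans hlong (pr_vx H _ _ _).
  exact: le_trans hlong (pr_hx H _ _ _).
have [A [gA pA hA]] := pr_all (2 * t) H gF pF.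
have lA : local (fun c => A (dual (zk R E k c))) by exact: (model_dlocal fm gA).
have : prb P p (G k) <= 1 - prd A.
  rewrite -prbC //; apply: prb_mono; [exact: (@G_local R E nE k)|exact: localC|].
  move=> c /(anchored_conn nE)[x [y [xy d]]] Ac.
  have hF := hA _ Ac.
  have D0 : (0 < 2 ^ k)%N by rewrite expn_gt0.
  have bD : (2 * b + 1 <= 2 ^ k)%N by rewrite /b; move: nk n0; clear; lia.
  have bt : (4 * 2 ^ k <= b * t)%N.
    by rewrite /b -mulnA [(n * t)%N]mulnC; move: tn; move: (t * n)%N => u; clear; lia.
  have yx := conn_linkS xy.
  have [h|[h|[h|h]]] : x.1 + (2 ^ k)%N%:Z <= y.1 \/ y.1 + (2 ^ k)%N%:Z <= x.1 \/
    x.2 + (2 ^ k)%N%:Z <= y.2 \/ y.2 + (2 ^ k)%N%:Z <= x.2 by move: d; clear; lia.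
  - exact: (slabs_block b0 D0 bD bt (fun i it => (hF i it).1) xy h).
  - exact: (slabs_block b0 D0 bD bt (fun i it => (hF i it).1) yx h).
  - exact: (slabs_block_tr b0 D0 bD bt (fun i it => (hF i it).2) xy h).
  - exact: (slabs_block_tr b0 D0 bD bt (fun i it => (hF i it).2) yx h).
by move=> h; apply: (le_trans h); rewrite lerBlDr addrC -lerBlDr.
Qed.

Lemma window_primal n k c : window n (fun c => hrect (160 * n) (8 * n) (zk R E k c)) c ->
  hx (n%:Z, - (9 * n)%N%:Z) (158 * n) (18 * n) (zk R E k c).
Proof.
move=> [v [v1 v2]]; rewrite (_ : zk R E k _ = (fun e => zk R E k c (shE v e))); last first.
  by apply/funext => e; apply/propext; exact: (mod_shift (zk_model R nE k)).
exact: translated_crossing.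
Qed.

Lemma window_dual n k c : window n (fun c => hrect (160 * n) (8 * n) (dual (zk R E k c))) c ->
  hx (n%:Z, - (9 * n)%N%:Z) (158 * n) (18 * n) (dual (zk R E k c)).
Proof.
move=> [v [v1 v2]]; rewrite (_ : zk R E k _ = (fun e => zk R E k c (shE v e))); last first.
  by apply/funext => e; apply/propext; exact: (mod_shift (zk_model R nE k)).
by rewrite dual_shift; exact: translated_crossing.
Qed.

(** The finite-size criterion needs a scale larger than the range of the model. Gluing a bounded
    number of crossings at the scale [18 * n] provides one at the scale [t * (18 * n)]. *)
Lemma fs_glue p f r0 n t (eps : R) : 0 <= p <= 1 -> model f r0 -> (0 < t)%N -> (2 * r0 < t * (18 * n))%N ->
  162 * (2 * (2 * t) + 1)%:R * eps <= 1 ->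
  1 - eps <= prb P p (fun c => hx (0, 0) (158 * n) (18 * n) (f c)) -> P p [set w | Inf (f (cfg_of w))] = 1%E.
Proof.
move=> p01 fm t0 rn he h; have H := primal_law hP p01 fm.
apply: (finite_size hP p01 fm rn).
set pr := (fun F => prb P p (fun c => F (f c))) in H.
have h1 : 1 - eps <= pr (hx (0, 0) (2 * (18 * n)) (18 * n)).
  by apply: le_trans h _; apply: (crossing_long (18 * n) H); lia.
have e0 : 0 <= eps.
  by have := rsw_le1 H (good_hx (0, 0) (2 * (18 * n)) (18 * n)); move: h1; lra.
have h2 := pr_long H (18 * n) (2 * t).
have h3 : pr (hx (0, 0) ((2 * t + 2) * (18 * n)) (18 * n)) <= pr (hx (0, 0) (2 * (t * (18 * n))) (t * (18 * n))).
  apply: le_trans (crossing_long (18 * n) H (_ : 2 * (t * (18 * n)) <= _)%N) _.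
    by rewrite mulnA leq_mul2r leq_addr orbT.
  apply: (rsw_mono H); [exact: good_hx|exact: good_hx|].
  move=> zt [l [r [hl hr lr]]]; exists l, r; split=> //.
  have tb : (18 * n <= t * (18 * n))%N by rewrite leq_pmull.
  by apply: conn_weak lr => z; rewrite /boxr /=; move: tb; clear; lia.
have h4 : (2 * (2 * t) + 1)%:R * (1 - pr (hx (0, 0) (2 * (18 * n)) (18 * n))) <= (2 * (2 * t) + 1)%:R * eps.
  by rewrite ler_wpM2l // lerBlDr addrC -lerBlDr.
apply: (glue_bound he (le_trans h2 h4) h3).
Qed.

(** Between the threshold and [p] take [p0 < p1]. At [p0] the anchor event has probability at
    least [a] for infinitely many [k]. At such a [k] and at [p1], the dichotomy gives, at a scale
    within a bounded number [s] of [k], a long crossing of the graph or of its dual, with a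
    probability that is a small power of [2 ^ k]. If it is the graph, then by the sharp threshold
    a translate is crossed at [p] with probability close to one, and the finite-size criterion
    applies to the enhancements up to the scale [k]. If it is the dual, then the dual crossings
    are likely at [p0], and they prevent the anchor event, contrary to the choice of [k]. *)
Lemma supercritical p : 0 <= p <= 1 -> q_c P E < p ->
  exists N, percolates (P p) (enhanced R (scale_upto E N)).
Proof.
move=> /andP[pp0 pp1] qp; have q0 := q_c_ge0.
pose p0 := q_c P E + (p - q_c P E) / 3; pose p1 := q_c P E + 2 * (p - q_c P E) / 3.
have [q00 p01 p1p] : [/\ q_c P E < p0, p0 < p1 & p1 < p] by rewrite /p0 /p1; split; lra.
pose d := (p - q_c P E) / 9; have d0 : 0 < d by rewrite /d; lra.
have dE1 : (p - p1) / 3 = d by rewrite /d /p1; lra.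
have dE0 : (p1 - p0) / 3 = d by rewrite /d /p1 /p0; lra.
clearbody p0 p1 d.
have p0i : 0 <= p0 <= 1 by lra.
have p1i : 0 <= p1 <= 1 by lra.
have pi : 0 <= p <= 1 by lra.
have [a [a0 ha]] := above_threshold p0i q00.
have rho1 : expR (- d * ln 2) < 1 by rewrite expR_lt1 mulNr oppr_lt0 mulr_gt0 // ln_gt0 // ltr1n.
have [K [K0 hK]] := amp_choice chain_exp (expR_ge0 _) rho1.
(* The dichotomy needs [2 * K + 1] scales, and the last of them must be small enough compared
   with [k] for the slabs of [dual_blocks_anchor]: the scales are between [k - s] and [k - 6].
   Then [t] slabs cover a distance of order [2 ^ k], and [M] windows cover a torus of that size. *)
have [s sE] : exists s, s = (2 * K + 6)%N by eexists.
have [t tE] : exists t, t = (2 ^ (s + 3))%N by eexists.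
have [M ME] : exists M, M = (2 ^ (s + 8))%N by eexists.
have t0 : (0 < t)%N by rewrite tE expn_gt0.
have u0 : 0 <= 162 * (2 * (2 * t) + 1)%:R :> R by rewrite mulr_ge0.
have v0 : 0 <= (2 * t)%:R * ((2 * t + 1)%:R + (2 * t + 1)%:R) :> R by rewrite mulr_ge0 // addr_ge0.
have [eps [e0 he1 he2]] := small_eps u0 v0 a0.
have y0 : 0 < eps ^+ (M ^ 2) by exact: exprn_gt0.
have [k0 hk0] := hK _ y0.
have [k] := ha (maxn k0 s); rewrite geq_max => /andP[k0k sk] hak.
have fm := zk_model R nE k.
(* Only boundedly many scales are used, so [m] has to grow with [k]; the probabilities given by
   the dichotomy tend to zero, but slowly. *)
pose m := (2 ^ (k %/ K + 2))%N.
have m0 : (0 < m)%N by rewrite expn_gt0.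
have [th01 hth] := @half_parameter R m m0.
have [|e /andP[ke eK] hpd] := dichotomy hP p1i fm (a := (k - s)%N) (q := K) th01 th01 m0 hth.
  by move=> e he; apply: scales_bound_b K0 _; move: he sE sk; clear; lia.
have [ek kes] : (e + 6 <= k)%N /\ (k <= e + s)%N by move: ke eK sE sk; clear; lia.
have [n nE_] : exists n, n = (2 ^ e)%N by eexists.
have n0 : (0 < n)%N by rewrite nE_ expn_gt0.
have nk : (64 * n <= 2 ^ k)%N by rewrite nE_ -[64%N]/(2 ^ 6)%N -expnD leq_exp2l // addnC.
have tn : (8 * 2 ^ k <= t * n)%N.
  by rewrite nE_ tE -[8%N]/(2 ^ 3)%N -!expnD leq_exp2l //; move: kes; clear; lia.
have [l lE] : exists l, (l.+1 = 2 ^ (k + 9))%N by exists (2 ^ (k + 9)).-1; rewrite prednK // expn_gt0.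
have lM : (l.+1 <= M * (2 * n + 1))%N.
  rewrite lE; apply: (@leq_trans (M * (2 * n))%N); last by rewrite leq_mul2l leq_addr orbT.
  by rewrite nE_ ME -expnS -expnD leq_exp2l //; move: kes; clear; lia.
have lr r : (r <= 170 * n + 2 ^ k.+1)%N -> (2 * (n + r) + 1 <= l.+1)%N.
  rewrite lE expnD expnS; have : (0 < 2 ^ k)%N by rewrite expn_gt0.
  by move: nk; rewrite -[(2 ^ 9)%N]/512%N; move: (2 ^ k)%N => D; clear; lia.
pose z : R := (8 * m)%:R^-1 ^+ chain_exp.
have z0 : 0 < z by apply: exprn_gt0; rewrite invr_gt0 ltr0n muln_gt0.
(* The gain from the sharp threshold on a torus of side [2 ^ (k + 9)] outweighs the small
   probability [z]. *)
have hz : z^-1 * expR (- d * ln (l.+1)%:R) <= eps ^+ (M ^ 2).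
  apply: le_trans (hk0 k k0k); rewrite /z exprVn invrK ler_wpM2l ?exprn_ge0 //.
  by rewrite lE; exact: scale_factor (ltW d0).
rewrite -nE_ (_ : 1 - (1 - (8 * m)%:R^-1) = (8 * m)%:R^-1) in hpd; last by rewrite opprB addrC subrK.
case: hpd => hpd.
  exists k; apply/percolates_zk => //.
  have lo : 1 - eps <= prb P p (window n (fun c => hrect (160 * n) (8 * n) (zk R E k c))).
    apply: (amplify hP _ (ltW p1p) pp1 (model_incE fm (good_hrect _ _)) (model_supp fm (@hrect_radius n)) (lr _ _) lM z0 hpd e0).
    - by case/andP: p1i.
    - by rewrite leq_add2r leq_mul2r orbT.
    - by have -> : - (p - p1) / 3 = - d by rewrite mulNr dE1.
  apply: (fs_glue (n := n) pi fm t0 _ he1).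
    move: tn; rewrite mulnCA expnS; move: (t * n)%N => u; have : (0 < 2 ^ k)%N by rewrite expn_gt0.
    by clear; lia.
  apply: le_trans lo _; apply: le_trans _ (pr_hx_back (n%:Z, - (9 * n)%N%:Z) _ _ (primal_law hP pi fm)).
  apply: prb_mono.
  - by exists (n + (168 * n + 2 ^ k.+1))%N; apply: window_supp; exact: (model_supp fm (@hrect_radius n)).
  - exact: (model_local fm (good_hx _ _ _)).
  by move=> c; exact: window_primal.
exfalso.
have lo : 1 - eps <= prb P p0 (window n (fun c => hrect (160 * n) (8 * n) (dual (zk R E k c)))).
  apply: (amplify_dec hP _ (ltW p01) _ (model_decE fm (good_hrect _ _)) (model_dsupp fm (@hrect_radius n)) (lr _ _) lM z0 hpd e0).
  - by case/andP: p0i.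
  - by case/andP: p1i.
  - by move: n0; move: (2 ^ k.+1)%N; clear; lia.
  - by have -> : - (p1 - p0) / 3 = - d by rewrite mulNr dE0.
have nk' : (37 * n <= 2 ^ k)%N by move: nk; clear; lia.
have := dual_blocks_anchor p0i n0 nk' tn (eps := eps).
move=> h; have {}h : prb P p0 (G k) <= (2 * t)%:R * ((2 * t + 1)%:R * eps + (2 * t + 1)%:R * eps).
  apply: h; have Hd := dual_law hP p0i fm.
  have n36 : (2 * (18 * n) <= 158 * n)%N by clear; lia.
  apply: le_trans (crossing_long (18 * n) Hd n36).
  apply: le_trans lo _; apply: le_trans _ (pr_hx_back (n%:Z, - (9 * n)%N%:Z) _ _ Hd).
  apply: prb_mono.
  - by exists (n + ((168 * n).+1 + 2 ^ k.+1))%N; apply: window_supp; exact: (model_dsupp fm (@hrect_radius n)).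
  - exact: (model_dlocal fm (good_hx _ _ _)).
  by move=> c; exact: window_dual.
move: (le_trans hak h); rewrite -mulrDl mulrA leNgt => /negP; apply; exact: he2.
Qed.

End supercritical.

Theorem theorem4 (R : realType) (P : R -> probability config R)
    (hP : forall p, 0 <= p <= 1 -> bernoulli_percolation p (P p))
    (E : set (graph * graph)) (hE : enhancement_set R E)
    (hS : forall e, E e -> subgraph e.2 lattice /\ connected_graph e.2)
    (p : R) (hp : 0 <= p <= 1) :
  (p < q_c P E ->
     (percolates (P p) (enhanced R E) <->
      exists N : nat, percolates (P p) (enhanced R (scale_upto E N)))) /\
  (q_c P E < p ->
     exists N : nat, percolates (P p) (enhanced R (scale_upto E N))).
Proof.
have [hen _ h0] := hE.
have nE en : E en -> nice en.
  by move=> Een; have [lat con] := hS _ Een; exact: Nice (hen _ Een) lat con (h0 _ Een).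
split=> h; last exact: supercritical nE _ hp h.
split; first exact: subcritical nE _ hp h.
by case=> N; exact: (percolates_up nE).
Qed.
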